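(* Let $f(z)=\sum_{k=0}^\infty a_kz^k$ be a formal power series with real coefficients, and for $n=0,1,2,\dots$ let $N_n=N(A(f,n);\mathbb{C}\setminus\mathbb{R})$, where $A(f,n)$ is the $n$-th Appell polynomial of $f$. Then: (1) $0=N_0=N_1\le N_2\le N_3\le\cdots$; (2) if $f$ represents an entire function in $\mathcal{LP}^*$ and $N=N(f;\mathbb{C}\setminus\mathbb{R})$, then $N_n\le N$ for all $n$, and $N_n=N$ for all sufficiently large $n$; and (3) if $\langle N_n\rangle$ is bounded, then $f$ represents an entire function in $\mathcal{LP}^*$.
   Context: For a formal power series $f(z)=\sum_{k\ge 0}a_kz^k$ and $n=0,1,2,\dots$, the $n$-th Appell polynomial of $f$ is $$A(f,n)(z)=\sum_{k=0}^n\frac{n!}{(n-k)!}a_kz^{n-k}.$$ For an entire function $g$ not identically $0$ and $X\subset\mathbb{C}$, $N(g;X)$ denotes the number of zeros of $g$ lying in $X$, counted with multiplicity; if $g$ is identically $0$, set $N(g;X)=0$. An entire function (in particular a polynomial) $g$ is real if $g(\mathbb{R})\subset\mathbb{R}$. A formal power series represents an entire function if its radius of convergence is $\infty$; it is then identified with that entire function. The Laguerre-Pólya class $\mathcal{LP}$ is the collection of entire functions $g$ which can be represented in the form $$g(z)=cz^m e^{-\alpha z^2+\beta z}\prod_j\left(1-\frac{z}{a_j}\right)e^{z/a_j}\qquad(z\in\mathbb{C}),$$ where $c,\beta\in\mathbb{R}$, $m$ is a nonnegative integer, $\alpha\ge 0$, $a_1,a_2,\dots\in\mathbb{R}\setminus\{0\}$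 (a finite, possibly empty, or infinite sequence), and $\sum_j a_j^{-2}<\infty$. The class $\mathcal{LP}^*$ consists of the real entire functions of the form $Pg$, where $P$ is a real polynomial and $g\in\mathcal{LP}$. *)

(* Defs.v *)
From HB Require Import structures.
From mathcomp Require Import all_boot all_order all_algebra.
From mathcomp Require Import complex.
From mathcomp Require Import all_classical all_reals all_analysis.

Set Implicit Arguments.
Unset Strict Implicit.
Unset Printing Implicit Defensive.

Import Order.TTheory GRing.Theory Num.Theory.
Import numFieldNormedType.Exports.

Local Open Scope classical_set_scope.
Local Open Scope ring_scope.
Local Open Scope complex_scope.

(* MathComp-Analysis puts a topology only on abstract numeric fields and on
   R^o; this transfers it to the concrete type R[i], seen as a normed space
   over itself, so that derivability below is complex derivability. *)
#[warnings="-redundant-canonical-projection"]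
HB.instance Definition _ (R : rcfType) := GRing.ComAlgebra.copy R[i] R[i]^o.
#[warnings="-redundant-canonical-projection"]
HB.instance Definition _ (R : rcfType) := NormedModule.copy R[i] R[i]^o.

Definition appell (F : fieldType) (f : nat -> F) (n : nat) : {poly F} :=
  \sum_(k < n.+1) (n`!%:R / (n - k)`!%:R * f k) *: 'X^(n - k).

Section EntireFunctions.
Variable R : realType.
Implicit Types (f : nat -> R[i]) (g : R[i] -> R[i]) (X : set R[i]).

Definition entire g := forall z, derivable g z 1.

Definition real_fun g := forall x : R, g x%:C \is Num.real.

(* Convergence at every z says that the radius of convergence is infinite. *)
Definition represents f g :=
  forall z, series (fun k => f k * z ^+ k) @ \oo --> g z.

Definition zero_of_order g (w : R[i]) (m : nat) :=
  exists h : R[i] -> R[i],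
    [/\ entire h, h w != 0 & forall z, g z = (z - w) ^+ m * h z].

(* For g entire and not identically 0 such an order exists and is unique; it
   is 0 when g w != 0. *)
Definition multiplicity g (w : R[i]) : nat := xget 0%N (zero_of_order g w).

(* Extended-real valued, since an entire function may have infinitely many
   zeros in X; points of X that are not zeros contribute 0. *)
Definition zero_count g X : \bar R :=
  if `[< forall z, g z = 0 >] then 0%E
  else (\esum_(w in X) (multiplicity g w)%:R%:E).

Definition nonreal : set R[i] := [set z | z \isn't Num.real].

(* expR is only defined on a realType, hence the power series over R[i]. *)
Definition cexp (z : R[i]) : R[i] :=
  limn (series (fun k => z ^+ k / k`!%:R)).

Definition primary_factor (a : R) (z : R[i]) : R[i] :=
  (1 - z / a%:C) * cexp (z / a%:C).

Definition canonical_product g :=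
  (exists s : seq R, all (fun a => a != 0) s /\
     forall z, g z = \prod_(a <- s) primary_factor a z)
  \/
  (exists a : nat -> R,
     [/\ forall j, a j != 0,
         cvgn (series (fun j => (a j) ^- 2)) &
         forall z, (fun n => \prod_(j < n) primary_factor (a j) z) @ \oo
                     --> g z]).

Definition laguerre_polya g :=
  entire g /\
  exists (c alpha beta : R) (m : nat) (p : R[i] -> R[i]),
    [/\ 0 <= alpha, canonical_product p &
        forall z, g z = c%:C * z ^+ m
          * cexp (- (alpha%:C * z ^+ 2) + beta%:C * z) * p z].

Definition laguerre_polya_star g :=
  [/\ entire g, real_fun g &
      exists (P : {poly R}) (h : R[i] -> R[i]), laguerre_polya h /\
        forall z, g z = (map_poly (real_complex R) P).[z] * h z].

End EntireFunctions.

(* Main.v *)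
Require Import Defs.
From mathcomp Require Import all_boot all_order all_algebra.
From mathcomp Require Import separable cyclotomic cyclic.
From mathcomp Require Import complex polyrcf.
From mathcomp Require Import all_classical all_reals all_analysis.
From mathcomp Require Import ring lra zify.

Set Implicit Arguments.
Unset Strict Implicit.
Unset Printing Implicit Defensive.

Import Order.TTheory GRing.Theory Num.Theory.
Import numFieldNormedType.Exports.

Local Open Scope classical_set_scope.
Local Open Scope ring_scope.
Local Open Scope complex_scope.

Local Notation Re := (@complex.Re _).
Local Notation Im := (@complex.Im _).
Local Notation nc := (@Normc.normc _).
Local Notation toC := (map_poly (real_complex _)).
Local Notation linprod s := (\prod_(x <- s) ('X - x%:P)).

(* Since A(f,n+1)' = (n+1) A(f,n), Rolle's theorem gives (1).

   For (2), write f = P h with h in LP, moving the real zeros of P into h, so that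
   deg P = N; then A(P,n) is z^(n-N) times a polynomial of degree at most N and
   has at most N nonreal zeros.  Multiplying a power series by 1 - x z (x real)
   turns A into A - x A', which by Rolle and parity has no more nonreal zeros
   than A; multiplying it by z turns A into A'.  As h is a limit of polynomials
   c z^m prod (1 - x z), and a bound on the number of nonreal zeros survives
   coefficientwise limits of polynomials of bounded degree, N_n <= N.  Equality
   for large n follows from the quantitative form of (3): if all N_n <= M, then
   f = P h with deg P <= M and h in LP.

   For (3), assume f(0) = 1.  The polynomials G_n(z) = (z/n)^n A(f,n)(n/z) tend
   coefficientwise to f, and G_n(z) = prod (1 - w z) prod (1 - x z), with at most
   M nonreal w and with real x.  The power sums of the w and x are bounded by
   Newton's identities.  Pigeonhole yields a bounded m such that every w^(2m)
   is within 60 degrees of the positive axis, so the (2m)-th power sum bounds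
   the w; then sum x and sum x^2 are bounded, and so is prod (1 - x z), because
   |1 - x z|^2 <= exp (- 2 x Re z + x^2 |z|^2).  Along an ultrafilter (which
   replaces diagonal extraction) everything converges.  Sorting the x by
   absolute value and using (1 - t) e^(t + t^2/2) = 1 + O(t^3) identifies
   lim prod (1 - x z) as a function in LP. *)

(** * Limits and power series over R[i] *)

(** A bound on nonreal zeros is expressed algebraically, as a factorization over the reals into a
    cofactor of bounded degree and real linear factors. It therefore survives limits by compactness
    of coefficients, and zeros are never counted by contour integrals. Cauchy's estimate is likewise
    proved for polynomials only, by averaging over roots of unity. The obstacle in (3) is that
    nothing bounds the nonreal zeros beforehand, and power sums may cancel. An even exponent makes
    every real zero contribute nonnegatively, and eight sectors suffice to control the arguments of
    the nonreal ones; hence the bound 2 * 8^M on the exponent, which depends on M and not on n. The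
    Gaussian factor comes from a loss of mass: the sums of x^2 may tend to more than the sum of the
    squared limits, when ever more small x share a fixed total. Half of the difference is alpha.
    Conversely, e^(-alpha z^2) is approached by pairs of opposite zeros and e^(beta z) by equal
    ones. *)

Section Modulus.
Variable R : realType.
Implicit Types (z w : R[i]) (x : R).

Lemma nc_ge0 z : 0 <= nc z.
Proof. by case: z => a b; exact: sqrtr_ge0. Qed.

Lemma normE z : `|z| = (nc z)%:C. Proof. by []. Qed.

Lemma nc0 : nc (0 : R[i]) = 0. Proof. exact: Normc.normc0. Qed.
Lemma nc1 : nc (1 : R[i]) = 1. Proof. exact: Normc.normc1. Qed.
Lemma ncM z w : nc (z * w) = nc z * nc w. Proof. exact: Normc.normcM. Qed.
Lemma ncN z : nc (- z) = nc z. Proof. exact: normcN. Qed.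
Lemma ncD z w : nc (z + w) <= nc z + nc w. Proof. exact: le_normcD. Qed.

Lemma ncB z w : nc (z - w) <= nc z + nc w.
Proof. by rewrite -(ncN w) ncD. Qed.

Lemma nc_distC z w : nc (z - w) = nc (w - z).
Proof. by rewrite -ncN opprB. Qed.

Lemma nc_eq0 z : (nc z == 0) = (z == 0).
Proof.
by apply/eqP/eqP => [|->]; [exact: Normc.eq0_normc|exact: nc0].
Qed.

Lemma nc_gt0 z : (0 < nc z) = (z != 0).
Proof. by rewrite lt_neqAle nc_ge0 andbT eq_sym nc_eq0. Qed.

Lemma ncX z k : nc (z ^+ k) = nc z ^+ k.
Proof. by elim: k => [|k IH]; rewrite ?expr0 ?nc1// !exprS ncM IH. Qed.

Lemma nc_prod (I : Type) (r : seq I) (F : I -> R[i]) :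
  nc (\prod_(i <- r) F i) = \prod_(i <- r) nc (F i).
Proof. exact: (big_morph _ ncM nc1). Qed.

Lemma nc_sum (I : Type) (r : seq I) (P : pred I) (F : I -> R[i]) :
  nc (\sum_(i <- r | P i) F i) <= \sum_(i <- r | P i) nc (F i).
Proof.
elim/big_rec2: _ => [|i y x _ h]; first by rewrite nc0.
exact: le_trans (ncD _ _) (lerD _ _).
Qed.

Lemma nc_real x : nc x%:C = `|x|.
Proof. by rewrite /= expr0n /= addr0 sqrtr_sqr. Qed.

Lemma nc_nat k : nc (k%:R : R[i]) = k%:R.
Proof. by rewrite -(rmorph_nat (real_complex R)) nc_real ger0_norm. Qed.

Lemma ncV z : nc z^-1 = (nc z)^-1. Proof. exact: Normc.normcV. Qed.

Lemma nc_sqr z : nc z ^+ 2 = Re z ^+ 2 + Im z ^+ 2.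
Proof. by case: z => a b /=; rewrite sqr_sqrtr// addr_ge0 ?sqr_ge0. Qed.

Lemma Re_le z : `|Re z| <= nc z.
Proof.
rewrite -ler_sqr ?nnegrE ?nc_ge0// nc_sqr real_normK ?num_real//.
by rewrite lerDl sqr_ge0.
Qed.

Lemma Im_le z : `|Im z| <= nc z.
Proof.
rewrite -ler_sqr ?nnegrE ?nc_ge0// nc_sqr real_normK ?num_real//.
by rewrite lerDr sqr_ge0.
Qed.

Lemma nc_leReIm z : nc z <= `|Re z| + `|Im z|.
Proof.
rewrite -ler_sqr ?nnegrE ?nc_ge0 ?addr_ge0// nc_sqr sqrrD !real_normK ?num_real//.
rewrite -addrA lerD2l lerDr mulrn_wge0// mulr_ge0 //.
Qed.

Lemma ReB z w : Re (z - w) = Re z - Re w. Proof. by case: z; case: w. Qed.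
Lemma ImB z w : Im (z - w) = Im z - Im w. Proof. by case: z; case: w. Qed.
Lemma ReD z w : Re (z + w) = Re z + Re w. Proof. by case: z; case: w. Qed.
Lemma ImD z w : Im (z + w) = Im z + Im w. Proof. by case: z; case: w. Qed.

Lemma Re_sum (I : Type) (r : seq I) (P : pred I) (F : I -> R[i]) :
  Re (\sum_(i <- r | P i) F i) = \sum_(i <- r | P i) Re (F i).
Proof. exact: (big_morph _ ReD). Qed.

Lemma Im_sum (I : Type) (r : seq I) (P : pred I) (F : I -> R[i]) :
  Im (\sum_(i <- r | P i) F i) = \sum_(i <- r | P i) Im (F i).
Proof. exact: (big_morph _ ImD). Qed.

End Modulus.

Section ComplexLimits.
Variable R : realType.

(* Convergence in R[i] phrased in R, so that canonical structure inference
   never has to unfold the topology of R[i]. *)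
Definition ctends (T : Type) (F : set_system T) (f : T -> R[i]) (l : R[i]) :=
  (fun t => nc (f t - l)) @ F --> (0 : R).

Section Filter.
Variables (T : Type) (F : set_system T).
Context {FF : Filter F}.
Implicit Types (f g : T -> R[i]) (l a b : R[i]).

Lemma ctendsP f l : f @ F --> l <-> ctends F f l.
Proof.
split => [/cvgrPdist_lt h|/cvgrPdist_lt h].
- apply/cvgrPdist_lt => e e0.
  have /h : 0 < e%:C by rewrite (ltcR 0).
  apply: filterS => t; rewrite normE ltcR sub0r normrN ger0_norm ?nc_ge0//.
  by rewrite nc_distC.
- apply/cvgrPdist_lt => e e0.
  have eE : e = (Re e)%:C by rewrite RRe_real// gtr0_real.
  have /h : 0 < Re e by rewrite -ltcR -eE.
  apply: filterS => t; rewrite eE normE ltcR sub0r normrN ger0_norm ?nc_ge0//.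
  by rewrite nc_distC.
Qed.

Lemma ctendsD f g a b :
  ctends F f a -> ctends F g b -> ctends F (fun t => f t + g t) (a + b).
Proof.
move=> /ctendsP fa /ctendsP gb; apply/ctendsP.
exact: (@cvgD R[i] R[i] T F FF f g a b fa gb).
Qed.

Lemma ctendsM f g a b :
  ctends F f a -> ctends F g b -> ctends F (fun t => f t * g t) (a * b).
Proof.
move=> /ctendsP fa /ctendsP gb; apply/ctendsP.
exact: (@cvgM R[i] T F FF f g a b fa gb).
Qed.

Lemma ctends_cst a : ctends F (fun=> a) a.
Proof. by apply/ctendsP; exact: cvg_cst. Qed.

Lemma ctendsN f a : ctends F f a -> ctends F (fun t => - f t) (- a).
Proof.
move=> /ctendsP fa; apply/ctendsP.
exact: (@cvgN R[i] R[i] T F FF f a fa).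
Qed.

Lemma ctendsB f g a b :
  ctends F f a -> ctends F g b -> ctends F (fun t => f t - g t) (a - b).
Proof. by move=> fa gb; apply: ctendsD => //; exact: ctendsN. Qed.

Lemma ctends_near f g l :
  (\forall t \near F, f t = g t) -> ctends F f l -> ctends F g l.
Proof.
move=> fg; apply: cvg_trans; apply: near_eq_cvg.
by apply: filterS fg => t ->.
Qed.

Lemma ctends_eq f g l : f =1 g -> ctends F f l -> ctends F g l.
Proof. by move=> /funext ->. Qed.

Lemma ctends_le f l (g : T -> R) :
  (\forall t \near F, nc (f t - l) <= g t) -> g @ F --> (0 : R) -> ctends F f l.
Proof.
move=> fg g0; apply: (squeeze_cvgr (f := fun=> 0) (h := g)) => //.
  by apply: filterS fg => t ->; rewrite nc_ge0.
exact: cvg_cst.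
Qed.

Lemma ctends_Im f l : ctends F f l -> (fun t => Im (f t)) @ F --> Im l.
Proof.
move=> h; apply/cvgrPdist_le => e e0; move/cvgrPdist_le : h => /(_ _ e0).
apply: filterS => t; rewrite sub0r normrN ger0_norm ?nc_ge0//.
by rewrite -ImB nc_distC; apply: le_trans; exact: Im_le.
Qed.

Lemma ctends_ReIm f l :
  (fun t => Re (f t)) @ F --> Re l -> (fun t => Im (f t)) @ F --> Im l ->
  ctends F f l.
Proof.
move=> fR fI; apply: (ctends_le (g :=
  fun t => `|Re (f t) - Re l| + `|Im (f t) - Im l|)).
  by apply: nearW => t; rewrite -ReB -ImB nc_leReIm.
rewrite -[0](addr0 (0 : R)); apply: cvgD; rewrite -[0](@normr0 _ R);
  by apply: cvg_norm; apply/subr_cvg0.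
Qed.

Lemma ctends_nc f l : ctends F f l -> (fun t => nc (f t)) @ F --> nc l.
Proof.
move=> h; apply/cvgrPdist_le => e e0; move/cvgrPdist_le : h => /(_ _ e0).
apply: filterS => t; rewrite sub0r normrN ger0_norm ?nc_ge0//.
apply: le_trans.
have h1 := ncD (f t - l) l; have h2 := ncD (l - f t) (f t).
rewrite !subrK in h1 h2; rewrite nc_distC in h2.
by rewrite ler_norml; apply/andP; split; lra.
Qed.

Lemma ctends_real (f : T -> R) (l : R) :
  f @ F --> l -> ctends F (fun t => (f t)%:C) l%:C.
Proof. by move=> h; apply: ctends_ReIm => //=; exact: cvg_cst. Qed.

Lemma ctends_prod (I : Type) (r : seq I) (f : I -> T -> R[i]) (l : I -> R[i]) :
  (forall i, ctends F (f i) (l i)) ->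
  ctends F (fun t => \prod_(i <- r) f i t) (\prod_(i <- r) l i).
Proof.
move=> h; elim: r => [|i r IH].
  rewrite big_nil; apply: ctends_eq (ctends_cst 1) => t.
  by rewrite big_nil.
rewrite big_cons; apply: ctends_eq (ctendsM (h i) IH) => t.
by rewrite big_cons.
Qed.

Lemma ctends_sum (I : Type) (r : seq I) (f : I -> T -> R[i]) (l : I -> R[i]) :
  (forall i, ctends F (f i) (l i)) ->
  ctends F (fun t => \sum_(i <- r) f i t) (\sum_(i <- r) l i).
Proof.
move=> h; elim: r => [|i r IH].
  rewrite big_nil; apply: ctends_eq (ctends_cst 0) => t.
  by rewrite big_nil.
rewrite big_cons; apply: ctends_eq (ctendsD (h i) IH) => t.
by rewrite big_cons.
Qed.

Lemma ctendsX f l k : ctends F f l -> ctends F (fun t => f t ^+ k) (l ^+ k).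
Proof.
move=> h; elim: k => [|k IH]; first exact: ctends_cst.
rewrite exprS; apply: ctends_eq (ctendsM h IH) => t.
by rewrite exprS.
Qed.

End Filter.

Section ProperFilter.
Variables (T : Type) (F : set_system T).
Context {FF : ProperFilter F}.
Implicit Types (f : T -> R[i]) (l : R[i]).

Lemma cvg_le_bound (f : T -> R) (l B : R) :
  f @ F --> l -> (\forall t \near F, f t <= B) -> l <= B.
Proof.
move=> h fB; rewrite -(cvg_lim (@Rhausdorff R) h).
by apply: limr_le => //; apply/cvg_ex; exists l.
Qed.

Lemma ctends_le_bound f l (B : R) :
  ctends F f l -> (\forall t \near F, nc (f t) <= B) -> nc l <= B.
Proof. by move=> /ctends_nc; exact: cvg_le_bound. Qed.

Lemma ctends_unique f l l' : ctends F f l -> ctends F f l' -> l = l'.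
Proof.
move=> fl fl'; apply/eqP; rewrite -subr_eq0 -nc_eq0 eq_le nc_ge0 andbT.
have h : ctends F (fun=> 0) (l - l').
  by apply: ctends_eq (ctendsB fl fl') => t; rewrite subrr.
by apply: (ctends_le_bound h); apply: nearW => t; rewrite nc0.
Qed.

End ProperFilter.

Lemma series_dominated (u : nat -> R[i]) (v : nat -> R) :
  (forall k, nc (u k) <= v k) -> cvgn (series v) ->
  exists l, ctends \oo (series u) l.
Proof.
move=> uv cv.
have v0 k : 0 <= v k by rewrite (le_trans _ (uv k))// nc_ge0.
have cR : cvgn (series (fun k => Re (u k))).
  apply: normed_cvg; apply: (@series_le_cvg R _ v) => // k.
    by rewrite /= normr_ge0.
  exact: le_trans (Re_le (u k)) (uv k).
have cI : cvgn (series (fun k => Im (u k))).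
  apply: normed_cvg; apply: (@series_le_cvg R _ v) => // k.
    by rewrite /= normr_ge0.
  exact: le_trans (Im_le (u k)) (uv k).
exists (limn (series (fun k => Re (u k))) +i* limn (series (fun k => Im (u k)))).
apply: ctends_ReIm => /=.
  move: cR; apply: cvg_trans; apply: near_eq_cvg; apply: nearW => n.
  by rewrite /series /= Re_sum.
move: cI; apply: cvg_trans; apply: near_eq_cvg; apply: nearW => n.
by rewrite /series /= Im_sum.
Qed.

End ComplexLimits.

Section Limits.
Variable R : realType.

(** A segment is compact, so the image filter has a cluster point, and a cluster point of an
    ultrafilter is a limit. *)
Lemma ultra_bounded_cvg (T : Type) (U : set_system T) (f : T -> R) (B : R) :
  UltraFilter U -> (forall t, `|f t| <= B) -> exists l : R, f @ U --> l.
Proof.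
move=> UU fB.
have PU : ProperFilter U by exact: ultra_proper.
have [] := @segment_compact R (- B) B (f @ U) _.
  by apply: (@filterE T U) => t /=; rewrite in_itv /= -ler_norml; exact: fB.
move=> l [_ cl]; exists l => A lA.
have [//|nA] := in_ultra_setVsetC (f @^-1` A) UU.
have [t []] := cl (~` A) A nA lA.
by [].
Qed.

Lemma ultra_bounded_seq (T : Type) (I : Type) (U : set_system T) (f : T -> I -> R)
    (B : I -> R) :
  UltraFilter U -> (forall t i, `|f t i| <= B i) ->
  exists l : I -> R, forall i, f ^~ i @ U --> l i.
Proof.
move=> UU fB; 
have h i : exists l : R, f ^~ i @ U --> l.
  by apply: ultra_bounded_cvg UU (fun t => fB t i).
by have [l hl] := choice h; exists l.
Qed.

(** The bound [e K] is uniform in [t]; this is what permits exchanging the limit in [t] with the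
    limit in [K]. *)
Lemma ctends_interchange (T : Type) (F : set_system T) {FF : Filter F}
    (S : T -> R[i]) (V : T -> nat -> R[i]) (v : nat -> R[i]) (l : R[i])
    (e : nat -> R) :
  (forall K, ctends F (V ^~ K) (v K)) -> e @ \oo --> (0 : R) ->
  (forall t K, nc (S t - V t K) <= e K) -> (forall K, nc (l - v K) <= e K) ->
  ctends F S l.
Proof.
move=> Vv e0 SV lv; apply/cvgrPdist_le => d d0.
have d3 : 0 < d / 3 by rewrite divr_gt0.
move/cvgrPdist_le : e0 => /(_ _ d3) [K _ /(_ K (leqnn K)) eK].
move/cvgrPdist_le : (Vv K) => /(_ _ d3); apply: filterS => t.
rewrite !sub0r !normrN !ger0_norm ?nc_ge0// => h.
have {}eK : e K <= d / 3 by rewrite sub0r normrN in eK; apply: le_trans eK; rewrite ler_norm.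
have -> : S t - l = (S t - V t K) + (V t K - v K) - (l - v K) by ring.
have := ncB ((S t - V t K) + (V t K - v K)) (l - v K).
have := ncD (S t - V t K) (V t K - v K).
have := SV t K; have := lv K.
by move: eK h d0; clear; set a := nc _; set b := nc _; set c := nc _;
   set f := nc _; set g := nc _; lra.
Qed.

Lemma sum_half (m n : nat) :
  \sum_(m <= k < n) (2^-1 : R) ^+ k <= 2 * (2^-1) ^+ m.
Proof.
have h0 k : 0 <= (2^-1 : R) ^+ k by rewrite exprn_ge0// invr_ge0.
have [nm|/ltnW mn] := leqP n m; first by rewrite big_geq// mulr_ge0.
suff -> : \sum_(m <= k < n) (2^-1 : R) ^+ k = 2 * (2^-1) ^+ m - 2 * (2^-1) ^+ n.
  by rewrite gerBl mulr_ge0.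
rewrite -(subnKC mn); elim: (n - m)%N => [|d IH].
  by rewrite addn0 big_geq// subrr.
rewrite addnS big_nat_recr ?leq_addr//= IH exprS; by field.
Qed.

Lemma cvg_half (C : R) : (fun k => C * (2^-1) ^+ k) @ \oo --> (0 : R).
Proof.
apply: (@cvg_geometric R C (2^-1)).
by rewrite ger0_norm ?invr_ge0// invf_lt1// ltr1n.
Qed.

Lemma is_cvg_half (C : R) : cvgn (series (fun k => C * (2^-1) ^+ k)).
Proof.
apply: (@is_cvg_geometric_series R C (2^-1)).
by rewrite ger0_norm ?invr_ge0// invf_lt1// ltr1n.
Qed.

Lemma nc_sum_half (u : nat -> R[i]) (C : R) (m n : nat) :
  (forall k, (m <= k < n)%N -> nc (u k) <= C * (2^-1) ^+ k) -> 0 <= C ->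
  nc (\sum_(m <= k < n) u k) <= C * (2 * (2^-1) ^+ m).
Proof.
move=> uC C0; apply: le_trans (nc_sum _ _ _) _.
apply: (@le_trans _ _ (\sum_(m <= k < n) C * (2^-1) ^+ k)).
  by apply: ler_sum_nat.
by rewrite -mulr_sumr ler_wpM2l// sum_half.
Qed.

Lemma nc_series_tail (u : nat -> R[i]) (C : R) (l : R[i]) m :
  0 <= C -> (forall k, (m <= k)%N -> nc (u k) <= C * (2^-1) ^+ k) ->
  ctends \oo (series u) l ->
  nc (l - \sum_(0 <= k < m) u k) <= C * (2 * (2^-1) ^+ m).
Proof.
move=> C0 uC ul.
have h : ctends \oo (fun n => series u n - \sum_(0 <= k < m) u k)
    (l - \sum_(0 <= k < m) u k).
  by apply: ctendsB => //; exact: ctends_cst.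
apply: (ctends_le_bound h); exists m => // n /= mn.
rewrite /series /= (big_cat_nat (n := m))//= addrAC subrr add0r.
by apply: nc_sum_half => // k /andP[mk _]; exact: uC.
Qed.

End Limits.

Section PowerSeries.
Variable R : realType.

(** Infinite radius of convergence, phrased through Cauchy-type bounds: when uniform along a family,
    these pass to coefficientwise limits. *)
Definition rapid (c : nat -> R[i]) :=
  forall r : R, 0 <= r -> exists2 C : R, 0 <= C & forall k, nc (c k) * r ^+ k <= C.

(** The bound at radius [2 * r] gives geometric decay of ratio 1/2 at radius [r]. *)
Lemma rapid_half c (r : R) : rapid c -> 0 <= r ->
  exists2 C : R, 0 <= C & forall k, nc (c k) * r ^+ k <= C * (2^-1) ^+ k.
Proof.
move=> cr r0; have [|C C0 hC] := cr (2 * r); first by rewrite mulr_ge0.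
exists C => // k; have := hC k.
by rewrite exprMn exprVn ler_pdivlMr ?exprn_gt0// => h; rewrite -mulrA [_ * 2^+k]mulrC.
Qed.

Lemma representsP (c : nat -> R[i]) (F : R[i] -> R[i]) :
  represents c F <-> forall z, ctends \oo (series (fun k => c k * z ^+ k)) (F z).
Proof. by split => h z; apply/ctendsP; exact: h. Qed.

Lemma rapid_represents c : rapid c -> exists F : R[i] -> R[i], represents c F.
Proof.
move=> cr.
have /choice[F hF] : forall z, exists l, ctends \oo (series (fun k => c k * z ^+ k)) l.
  move=> z; have [C C0 hC] := rapid_half cr (nc_ge0 z).
  apply: (series_dominated (v := fun k => C * (2^-1) ^+ k)); last exact: is_cvg_half.
  by move=> k; rewrite ncM ncX.
by exists F; apply/representsP.
Qed.

(** The remainders satisfy R_(k+1) = w R_k + k z^(k-1) (w - z)^2, and [1 <= r] lets exponents of [r]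
    be raised freely. *)
Lemma expr_taylor2 (z w : R[i]) (r : R) k : 1 <= r -> nc z <= r -> nc w <= r ->
  nc (w ^+ k - z ^+ k - k%:R * z ^+ k.-1 * (w - z)) <=
  k%:R ^+ 2 * r ^+ k * nc (w - z) ^+ 2.
Proof.
move=> r1 zr wr; have r0 : 0 <= r by apply: le_trans r1.
elim: k => [|k IH].
  by rewrite !expr0 subrr !mul0r subrr nc0 expr0n /= !mul0r.
have -> : w ^+ k.+1 - z ^+ k.+1 - k.+1%:R * z ^+ k * (w - z) =
    w * (w ^+ k - z ^+ k - k%:R * z ^+ k.-1 * (w - z)) +
    k%:R * z ^+ k.-1 * (w - z) ^+ 2.
  case: k {IH} => [|k]; first by rewrite !expr0 !expr1; ring.
  by rewrite /= !exprS -[k.+2%:R]natr1; ring.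
apply: le_trans (ncD _ _) _; rewrite !ncM !ncX nc_nat.
have h1 : nc z ^+ k.-1 <= r ^+ k.
  apply: (@le_trans _ _ (r ^+ k.-1)); first by rewrite lerXn2r ?nnegrE ?nc_ge0.
  by rewrite ler_weXn2l// leq_pred.
have h2 : nc w * nc (w ^+ k - z ^+ k - k%:R * z ^+ k.-1 * (w - z)) <=
   r * (k%:R ^+ 2 * r ^+ k * nc (w - z) ^+ 2) by rewrite ler_pM ?nc_ge0.
apply: le_trans (lerD h2 (_ : _ <= k%:R * r ^+ k.+1 * nc (w - z) ^+ 2)) _.
  rewrite expr2 ler_wpM2r ?mulr_ge0 ?nc_ge0//; apply: ler_wpM2l => //.
  by rewrite (le_trans h1)// ler_weXn2l.
have -> : r * (k%:R ^+ 2 * r ^+ k * nc (w - z) ^+ 2) +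
    k%:R * r ^+ k.+1 * nc (w - z) ^+ 2 =
    (k%:R ^+ 2 + k%:R) * (r ^+ k.+1 * nc (w - z) ^+ 2) by rewrite [r ^+ k.+1]exprS; ring.
rewrite -mulrA ler_wpM2r ?mulr_ge0 ?exprn_ge0 ?nc_ge0// -natr1.
by have : 0 <= k%:R :> R by []; nra.
Qed.

Lemma sqr_le_exp4 k : (k ^ 2 <= 4 ^ k)%N.
Proof.
have : (k < 2 ^ k)%N by exact: ltn_expl.
by rewrite (_ : 4 = 2 ^ 2)%N// -expnM mulnC expnM => /ltnW; rewrite leq_exp2r.
Qed.

Lemma rapid_derivable c (F : R[i] -> R[i]) z : rapid c -> represents c F ->
  exists d, exists2 K : R, 0 <= K & forall w, nc (w - z) <= 1 ->
    nc (F w - F z - d * (w - z)) <= K * nc (w - z) ^+ 2.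
Proof.
move=> cr /representsP cF; set r := nc z + 1.
have r1 : 1 <= r by rewrite lerDr nc_ge0.
have r0 : 0 <= r by apply: le_trans r1.
(* The factor 4 absorbs the k^2 of the Taylor remainder, as k^2 <= 4^k. *)
have [|C C0 hC] := rapid_half cr (_ : 0 <= 4 * r); first by rewrite mulr_ge0.
have zr : nc z <= r by rewrite lerDl.
have k4 (k : nat) : k%:R ^+ 2 <= 4 ^+ k :> R.
  by rewrite -!natrX ler_nat sqr_le_exp4.
have cb k : nc (c k) * (k%:R ^+ 2 * r ^+ k) <= C * (2^-1) ^+ k.
  apply: le_trans (hC k); rewrite ler_wpM2l ?nc_ge0// exprMn ler_wpM2r//.
  by rewrite exprn_ge0.
have [d hd] : exists d, ctends \oo (series (fun k => c k * (k%:R * z ^+ k.-1))) d.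
  apply: (series_dominated (v := fun k => C * (2^-1) ^+ k)); last exact: is_cvg_half.
  move=> k; apply: le_trans (cb k); rewrite !ncM ncX nc_nat.
  rewrite ler_wpM2l ?nc_ge0//; apply: ler_pM => //.
  - by rewrite exprn_ge0 ?nc_ge0.
  - by rewrite -natrX ler_nat; case: k => // k; rewrite leq_pmulr.
  - apply: (@le_trans _ _ (r ^+ k.-1)); first by rewrite lerXn2r ?nnegrE ?nc_ge0.
    by rewrite ler_weXn2l// leq_pred.
exists d; exists (2 * C); first by rewrite mulr_ge0.
move=> w wz; have wr : nc w <= r.
  by have := ncD (w - z) z; rewrite subrK /r; lra.
pose proof (ctendsB (ctendsB (cF w) (cF z)) (ctendsM hd (ctends_cst (w - z)))) as hw.
apply: (ctends_le_bound hw); apply: nearW => n.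
rewrite /series /= mulr_suml -!sumrB.
under eq_bigr do rewrite -mulrA -!mulrBr.
have -> : 2 * C * nc (w - z) ^+ 2 = C * nc (w - z) ^+ 2 * (2 * (2^-1) ^+ 0).
  by rewrite expr0; ring.
apply: nc_sum_half; last by rewrite mulr_ge0 ?exprn_ge0 ?nc_ge0.
move=> k _; rewrite ncM.
apply: (@le_trans _ _ (nc (c k) * (k%:R ^+ 2 * r ^+ k * nc (w - z) ^+ 2))).
  by rewrite ler_wpM2l ?nc_ge0// expr_taylor2.
by rewrite mulrA [leRHS]mulrAC ler_wpM2r ?exprn_ge0 ?nc_ge0.
Qed.

Lemma derivableCP (g : R[i] -> R[i]) z :
  derivable g z 1 <-> exists d, ctends (0^' : set_system R[i])
    (fun h => h^-1 * (g (h + z) - g z)) d.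
Proof.
rewrite /derivable.
have -> : (fun h : R[i] => h^-1 *: (g (h *: 1 + z) - g z)) =
          (fun h => h^-1 * (g (h + z) - g z)).
  by apply/funext => h; rewrite [h *: 1]mulr1.
split => [/cvg_ex[d /ctendsP hd]|[d /ctendsP hd]]; first by exists d.
by apply/cvg_ex; exists d.
Qed.

Lemma ctends_dnbhs_id : ctends (0^' : set_system R[i]) id 0.
Proof. by apply/ctendsP; apply: cvg_within. Qed.

Lemma near0_small (e : R) : 0 < e -> \forall h \near (0^' : set_system R[i]), nc h <= e.
Proof.
move=> e0; have /cvgrPdist_le/(_ _ e0) := ctends_dnbhs_id.
by apply: filterS => h; rewrite sub0r normrN subr0 ger0_norm ?nc_ge0.
Qed.

Lemma rapid_entire c (F : R[i] -> R[i]) : rapid c -> represents c F -> entire F.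
Proof.
move=> cr cF z; apply/derivableCP.
have [d [K K0 hK]] := rapid_derivable z cr cF.
exists d; apply: (ctends_le (g := fun h => K * nc h)).
  have : \forall h \near (0^' : set_system R[i]), h != 0 by exact: nbhs_dnbhs_neq.
  have := near0_small ltr01; apply: filterS2 => h h1 h0.
  have := hK (h + z); rewrite addrK => /(_ h1).
  have hh : nc h != 0 by rewrite nc_eq0.
  have -> : F (h + z) - F z - d * h = h * (h^-1 * (F (h + z) - F z) - d).
    by field.
  by rewrite ncM expr2 mulrCA ler_pM2l// nc_gt0.
pose proof (ctends_nc ctends_dnbhs_id) as h; rewrite nc0 in h.
by rewrite -(mulr0 K); apply: cvgM => //; exact: cvg_cst.
Qed.

End PowerSeries.

(** * Cauchy's estimate and limits of locally bounded families of polynomials *)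

Section NormalFamilies.
Variable R : realType.

Lemma prim_root_exists (F : closedFieldType) (n : nat) : n%:R != 0 :> F -> (0 < n)%N ->
  {z : F | n.-primitive_root z}.
Proof.
move=> nF n_gt0; pose p : {poly F} := 'X^n - 1; have [r Dp] := closed_field_poly_normal p.
apply/sigW; rewrite (monicP _) ?monicXnsubC // scale1r in Dp.
have rn1: all n.-unity_root r by apply/allP=> z; rewrite -root_prod_XsubC -Dp.
have sz_r: (n < (size r).+1)%N.
  by rewrite -(size_prod_XsubC r id) -Dp size_XnsubC.
have [|z] := hasP (has_prim_root n_gt0 rn1 _ sz_r); last by exists z.
by rewrite -separable_prod_XsubC -Dp separable_Xn_sub_1.
Qed.

(** The number j + (N - k) lies strictly between 0 and 2 N, so it can only be N. *)
Lemma dvdn_add_sub (N j k : nat) :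
  (j < N)%N -> (k < N)%N -> (N %| j + (N - k))%N -> j = k.
Proof.
move=> jN kN /dvdnP[q hq]; case: q hq => [|[|q]]; rewrite ?mulSn; lia.
Qed.

(* Averaging over the vertices of a regular N-gon isolates one coefficient as
   soon as N exceeds the degree. *)
Lemma cauchy_estimate (p : {poly R[i]}) (r B : R) k : 0 <= r ->
  (forall z, nc z <= r -> nc p.[z] <= B) -> nc p`_k * r ^+ k <= B.
Proof.
move=> r0 pB; set N := (maxn (size p) k).+1.
have kN : (k < N)%N by rewrite ltnS leq_maxr.
have pN : (size p <= N)%N by rewrite leqW// leq_maxl.
have N0 : N%:R != 0 :> R[i] by rewrite pnatr_eq0.
have [w wN] := prim_root_exists N0 (ltn0Sn _).
have w1 : nc w = 1.
  have /(congr1 nc) := prim_expr_order wN; rewrite ncX nc1 => /eqP.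
  by rewrite pexpr_eq1 ?nc_ge0// => /eqP.
(* [w ^+ (N - k)] stands for w^(-k); the geometric sum vanishes unless N divides j + (N - k). *)
have sum0 j : (j < N)%N -> \sum_(i < N) (w ^+ (j + (N - k))) ^+ i = (N%:R *+ (j == k))%R.
  move=> jN; have [->|jk] := eqVneq j k.
    rewrite subnKC ?(ltnW kN)// (prim_expr_order wN) mulr1n.
    under eq_bigr do rewrite expr1n.
    by rewrite sumr_const card_ord.
  rewrite mulr0n; apply: (@mulfI _ (w ^+ (j + (N - k)) - 1)).
    rewrite subr_eq0 -(prim_order_dvd wN); apply: contra jk => h.
    by apply/eqP; apply: (dvdn_add_sub _ _ h).
  by rewrite -subrX1 mulr0 exprAC (prim_expr_order wN) expr1n subrr.
have key : \sum_(i < N) p.[r%:C * w ^+ i] * (w ^+ (N - k)) ^+ i = N%:R * (p`_k * r%:C ^+ k).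
  under eq_bigr do rewrite (horner_coef_wide _ pN) mulr_suml.
  rewrite exchange_big /= (bigD1 (Ordinal kN))//= [X in _ + X]big1 => [|j jk].
    rewrite addr0.
    transitivity (\sum_(i < N) (p`_k * r%:C ^+ k) * (w ^+ (k + (N - k))) ^+ i).
      by apply: eq_bigr => i _; rewrite exprMn exprD exprMn -!exprM mulnC !mulrA.
    by rewrite -mulr_sumr sum0// eqxx mulr1n mulrC.
  transitivity (\sum_(i < N) (p`_j * r%:C ^+ j) * (w ^+ (j + (N - k))) ^+ i).
    by apply: eq_bigr => i _; rewrite exprMn exprD exprMn -!exprM [(i * j)%N]mulnC !mulrA.
  by move: jk; rewrite -mulr_sumr sum0// -val_eqE /= => /negbTE ->; rewrite mulr0n mulr0.
have : N%:R * (nc p`_k * r ^+ k) <= N%:R * B.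
  have -> : N%:R * (nc p`_k * r ^+ k) = nc (N%:R * (p`_k * r%:C ^+ k)).
    by rewrite !ncM nc_nat ncX nc_real ger0_norm.
  rewrite -key; apply: le_trans (nc_sum _ _ _) _.
  apply: (@le_trans _ _ (\sum_(i < N) B)).
    apply: ler_sum => i _; rewrite ncM !ncX w1 !expr1n mulr1 pB//.
    by rewrite ncM ncX w1 expr1n mulr1 nc_real ger0_norm.
  by rewrite sumr_const card_ord mulr_natl.
by rewrite ler_pM2l// ltr0n.
Qed.

Definition locally_bounded (T : Type) (p : T -> {poly R[i]}) :=
  forall r : R, 0 <= r -> exists B : R, forall t z, nc z <= r -> nc (p t).[z] <= B.

Lemma horner_nat_sum (p : {poly R[i]}) z n : (size p <= n)%N ->
  p.[z] = \sum_(0 <= k < n) p`_k * z ^+ k.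
Proof. by move=> pn; rewrite (horner_coef_wide _ pn) big_mkord. Qed.

(** Cauchy's estimate at radius [2 * nc z] dominates the Taylor tails at [z] by one geometric series
    for all [t], so coefficientwise convergence gives pointwise convergence. *)
Lemma normal_limit (T : Type) (U : set_system T) {UU : ProperFilter U}
    (p : T -> {poly R[i]}) (c : nat -> R[i]) :
  locally_bounded p -> (forall k, ctends U (fun t => (p t)`_k) (c k)) ->
  rapid c /\ forall F, represents c F ->
    forall z, ctends U (fun t => (p t).[z]) (F z).
Proof.
move=> pb pc; have cr : rapid c.
  move=> r r0; have [B hB] := pb r r0; exists (Num.max B 0).
    by rewrite le_max lexx orbT.
  move=> k; rewrite le_max; apply/orP; left.
  have -> : nc (c k) * r ^+ k = nc (c k * (r%:C) ^+ k).
    by rewrite ncM ncX nc_real ger0_norm.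
  pose proof (ctendsM (pc k) (ctends_cst (r%:C ^+ k))) as h.
  apply: (ctends_le_bound h); apply: nearW => t.
  rewrite ncM ncX nc_real ger0_norm//.
  by apply: cauchy_estimate => // z; exact: hB.
split=> // F /representsP cF z.
have [C1 C10 hC1] := rapid_half cr (nc_ge0 z).
have [|B hB] := pb (2 * nc z); first by rewrite mulr_ge0 ?nc_ge0.
set C := Num.max C1 (Num.max B 0).
have C0 : 0 <= C by rewrite !le_max C10.
have CB : B <= C by rewrite !le_max lexx !orbT.
have CC1 : C1 <= C by rewrite !le_max lexx.
have hc k : nc (c k * z ^+ k) <= C * 2^-1 ^+ k.
  rewrite ncM ncX; apply: le_trans (hC1 k) _.
  by rewrite ler_wpM2r// exprn_ge0// invr_ge0.
have hp t k : nc ((p t)`_k * z ^+ k) <= C * 2^-1 ^+ k.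
  rewrite ncM ncX exprVn ler_pdivlMr ?exprn_gt0// -mulrA [_ * 2 ^+ k]mulrC -exprMn.
  apply: le_trans CB; apply: cauchy_estimate => [|w]; last exact: hB.
  by rewrite mulr_ge0 ?nc_ge0.
apply: (ctends_interchange
  (V := fun t K => \sum_(0 <= k < K) (p t)`_k * z ^+ k)
  (v := fun K => \sum_(0 <= k < K) c k * z ^+ k)
  (e := fun K => C * 2 * 2^-1 ^+ K)).
- move=> K; apply: ctends_sum => k; apply: ctendsM => //; exact: ctends_cst.
- exact: cvg_half.
- move=> t K; rewrite -mulrA.
  have [pK|/ltnW pK] := leqP (size (p t)) K.
    by rewrite (horner_nat_sum _ pK) subrr nc0 !mulr_ge0 ?exprn_ge0 ?invr_ge0.
  rewrite (horner_nat_sum _ (leqnn _)) (big_cat_nat (n := K))//= addrAC subrr add0r.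
  exact: nc_sum_half.
- by move=> K; rewrite -mulrA; apply: nc_series_tail => //; exact: cF.
Qed.

(** Terms are differences of consecutive partial sums, and a convergent sequence is bounded. *)
Lemma represents_rapid (c : nat -> R[i]) F : represents c F -> rapid c.
Proof.
move=> /representsP cF r r0.
pose proof (ctends_nc (cF r%:C)) as h.
have /cvg_seq_bounded : cvgn (fun n => nc (series (fun k => c k * r%:C ^+ k) n)).
  by apply/cvg_ex; exists (nc (F r%:C)).
move=> /bounded_fun_has_ubound[M hM].
have {}hM n : nc (series (fun k => c k * r%:C ^+ k) n) <= M by apply: hM; exists n.
have M0 : 0 <= M by apply: le_trans (hM 0%N); exact: nc_ge0.
exists (2 * M) => [|k]; first by rewrite mulr_ge0.
have -> : nc (c k) * r ^+ k = nc (c k * r%:C ^+ k).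
  by rewrite ncM ncX nc_real ger0_norm.
have -> : c k * r%:C ^+ k = series (fun k => c k * r%:C ^+ k) k.+1 -
    series (fun k => c k * r%:C ^+ k) k.
  by rewrite /series /= big_nat_recr//= addrAC subrr add0r.
apply: le_trans (ncB _ _) _; have := hM k; have := hM k.+1; lra.
Qed.

(** At the first index m where the coefficients differ, by d_m say, the term d_m z^m would have to
    be cancelled by a tail of order |z|^(m+1), which fails for small z. *)
Lemma represents_inj (c c' : nat -> R[i]) F :
  represents c F -> represents c' F -> c =1 c'.
Proof.
move=> cF c'F; pose d k := c k - c' k.
have dF z : ctends \oo (series (fun k => d k * z ^+ k)) 0.
  move/representsP : cF => /(_ z) h; move/representsP : c'F => /(_ z) h'.
  pose proof (ctendsB h h') as hh; rewrite subrr in hh.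
  apply: ctends_eq hh => n; rewrite /series /= -sumrB.
  by apply: eq_bigr => k _; rewrite /d mulrBl.
have dr : rapid d by apply: (@represents_rapid d (fun=> 0)); apply/representsP.
have [C C0 hC] := rapid_half dr (ler01 : 0 <= 1).
suff d0 : forall k, d k = 0 by move=> k; apply/eqP; rewrite -subr_eq0 -/(d k) d0.
move=> m; elim/ltn_ind: m => m IH; apply/eqP; rewrite -nc_eq0; apply/negPn/negP => dm0.
have x0 : 0 < nc (d m) by rewrite lt_neqAle nc_ge0 andbT eq_sym.
set x := nc (d m) in x0.
have b z : nc z <= 1 -> nc z != 0 -> x <= 2 * C * nc z.
  move=> z1 z0.
  have h := @nc_series_tail R (fun k => d k * z ^+ k) (C * nc z ^+ m.+1) 0 m.+1 _ _ (dF z).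
  have {h} : nc (0 - \sum_(0 <= k < m.+1) d k * z ^+ k) <=
     C * nc z ^+ m.+1 * (2 * 2^-1 ^+ m.+1).
    apply: h; first by rewrite mulr_ge0 ?exprn_ge0 ?nc_ge0.
    move=> k mk; rewrite ncM ncX mulrAC; have := hC k; rewrite expr1n mulr1 => hk.
    rewrite ler_pM ?exprn_ge0 ?nc_ge0//.
    by rewrite -(subnKC mk) exprD ler_piMr ?exprn_ge0 ?nc_ge0// exprn_ile1 ?nc_ge0.
  rewrite big_nat_recr//= big_nat big1 => [|k /andP[_ km]]; last by rewrite IH// mul0r.
  rewrite !add0r ncN ncM ncX -/x => h.
  have zm : 0 < nc z ^+ m by rewrite exprn_gt0// lt_neqAle nc_ge0 andbT eq_sym.
  rewrite -(ler_pM2r zm); apply: (le_trans h).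
  have -> : 2 * C * nc z * nc z ^+ m = C * nc z ^+ m.+1 * 2 by rewrite exprS; ring.
  apply: ler_wpM2l; first by rewrite mulr_ge0 ?exprn_ge0 ?nc_ge0.
  by rewrite ler_piMr// exprn_ile1 ?invr_ge0 ?invf_le1// ler1n.
(* Chosen so that 0 < t <= 1 and 2 C t < x, against [b]. *)
pose t := x / (x + 2 * C + 1).
have D0 : 0 < x + 2 * C + 1 by lra.
have t0 : 0 < t by rewrite divr_gt0.
have nt : nc t%:C = t by rewrite nc_real ger0_norm// ltW.
have := b t%:C; rewrite nt => /(_ _ (lt0r_neq0 t0)).
have t1 : t <= 1 by rewrite ler_pdivrMr// mul1r; lra.
move=> /(_ t1); rewrite /t mulrA ler_pdivlMr//; nra.
Qed.

Lemma represents_unique (c : nat -> R[i]) F G :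
  represents c F -> represents c G -> F =1 G.
Proof.
move=> /representsP cF /representsP cG z; exact: ctends_unique (cF z) (cG z).
Qed.

End NormalFamilies.

(** * The complex exponential and estimates of Weierstrass factors *)

Section Exponential.
Variable R : realType.

Definition exp_sum (K : fieldType) (z : K) (n : nat) : K :=
  \sum_(0 <= k < n) z ^+ k / k`!%:R.

Lemma triangle_sum (K : nmodType) (G : nat -> nat -> K) n :
  \sum_(0 <= k < n) \sum_(0 <= i < k.+1) G i (k - i)%N =
  \sum_(0 <= i < n) \sum_(0 <= j < n - i) G i j.
Proof.
elim: n => [|n IH]; first by rewrite !big_geq.
rewrite big_nat_recr//= IH [RHS]big_nat_recr//= subSnn big_nat1.
rewrite big_nat_recr//= subnn addrA; congr (_ + _).
rewrite -big_split /=; apply: eq_big_nat => i /andP[_ iN].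
by rewrite subSn ?(ltnW iN)// big_nat_recr.
Qed.

(** What remains is the part of the index square beyond the antidiagonal. Its coefficients are
    nonnegative, so its modulus is at most the same sum taken at |a| and |b|. *)
Lemma exp_sum_defect (K : numFieldType) (a b : K) n :
  exp_sum a n * exp_sum b n - exp_sum (a + b) n =
  \sum_(0 <= i < n) \sum_(n - i <= j < n) a ^+ i / i`!%:R * (b ^+ j / j`!%:R).
Proof.
have f0 k : k`!%:R != 0 :> K by rewrite pnatr_eq0 -lt0n fact_gt0.
have -> : exp_sum (a + b) n =
    \sum_(0 <= i < n) \sum_(0 <= j < n - i) a ^+ i / i`!%:R * (b ^+ j / j`!%:R).
  rewrite -(triangle_sum (fun i j => a ^+ i / i`!%:R * (b ^+ j / j`!%:R))).
  apply: eq_bigr => k _; rewrite addrC exprDn mulr_suml big_mkord.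
  apply: eq_bigr => i _; have ik : (i <= k)%N by rewrite -ltnS.
  rewrite -mulr_natl -(bin_fact ik) !natrM.
  have c0 : ('C(k, i))%:R != 0 :> K by rewrite pnatr_eq0 -lt0n bin_gt0.
  by field; rewrite c0 !f0.
rewrite /exp_sum mulr_suml -sumrB; apply: eq_bigr => i _.
rewrite mulr_sumr (big_cat_nat (n := (n - i)%N))//= ?leq_subr//.
by rewrite addrAC subrr add0r.
Qed.

Lemma exp_sum_expR (x : R) : exp_sum x @ \oo --> expR x.
Proof. exact: is_cvg_series_exp_coeff. Qed.

Lemma cexp_tends (z : R[i]) : ctends \oo (exp_sum z) (cexp z).
Proof.
have [k|l hl] := @series_dominated R (fun k => z ^+ k / k`!%:R)
  (exp_coeff (nc z)) _ (is_cvg_series_exp_coeff _).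
  by rewrite ncM ncX ncV nc_nat.
suff -> : cexp z = l by exact: hl.
apply: cvg_lim; first exact: norm_hausdorff.
by apply/ctendsP.
Qed.

(** The defect of the partial sums is dominated by the defect at the real numbers |a| and |b|, which
    tends to 0 by [expRD]. *)
Lemma cexpD (a b : R[i]) : cexp (a + b) = cexp a * cexp b.
Proof.
suff h : ctends \oo (fun n => exp_sum a n * exp_sum b n - exp_sum (a + b) n) 0.
  pose proof (ctendsB (ctendsM (cexp_tends a) (cexp_tends b)) (cexp_tends (a + b))) as h'.
  pose proof (ctends_unique h h') as e.
  by move/esym/eqP : e; rewrite subr_eq0 => /eqP.
apply: (ctends_le (g := fun n => exp_sum (nc a) n * exp_sum (nc b) n -
    exp_sum (nc a + nc b) n)).
  apply: nearW => n; rewrite subr0 !exp_sum_defect.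
  apply: le_trans (nc_sum _ _ _) _; apply: ler_sum => i _.
  apply: le_trans (nc_sum _ _ _) _; apply: ler_sum => j _.
  by rewrite !ncM !ncX !ncV !nc_nat.
rewrite -(subrr (expR (nc a + nc b))) {1}expRD.
by apply: cvgB; [apply: cvgM|]; exact: exp_sum_expR.
Qed.

Lemma cexp0 : cexp (0 : R[i]) = 1.
Proof.
apply: (ctends_unique (cexp_tends 0)); apply: ctends_near (ctends_cst 1).
exists 1%N => // -[//|n] _; rewrite /exp_sum big_nat_recl// expr0 fact0 divr1.
by rewrite big1 ?addr0// => k _; rewrite expr0n mul0r.
Qed.

Lemma cexpN (a : R[i]) : cexp a * cexp (- a) = 1.
Proof. by rewrite -cexpD subrr cexp0. Qed.

Lemma cexp_neq0 (a : R[i]) : cexp a != 0.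
Proof. by apply/eqP => h; have /eqP := cexpN a; rewrite h mul0r eq_sym oner_eq0. Qed.

Lemma cexp_sum (I : Type) (r : seq I) (f : I -> R[i]) :
  \prod_(i <- r) cexp (f i) = cexp (\sum_(i <- r) f i).
Proof. by symmetry; apply: (big_morph _ cexpD cexp0). Qed.

Lemma cexp_tail (z : R[i]) m : nc z <= 1 ->
  nc (cexp z - exp_sum z m) <= 4 * nc z ^+ m.
Proof.
move=> z1; have zm : 0 <= nc z ^+ m by rewrite exprn_ge0 ?nc_ge0.
(* The constant [2 * nc z ^+ m] comes from 1/k! <= 2 / 2^k and |z|^k <= |z|^m; the geometric sum
   contributes the other factor 2. *)
have := @nc_series_tail R (fun k => z ^+ k / k`!%:R) (2 * nc z ^+ m) (cexp z) m _ _
  (cexp_tends z).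
move=> /(_ _ _)/le_trans; apply; first by rewrite mulr_ge0.
  move=> k mk; rewrite ncM ncX ncV nc_nat (mulrC 2) -mulrA ler_pM ?exprn_ge0 ?nc_ge0 ?invr_ge0//.
    by rewrite -(subnKC mk) exprD ler_piMr// exprn_ile1 ?nc_ge0.
  rewrite exprVn -lef_pV2 ?posrE ?mulr_gt0 ?invr_gt0 ?exprn_gt0 ?ltr0n ?fact_gt0//.
  rewrite invrK invfM invrK; case: k {mk} => [|k]; first by rewrite expr0 mulr1 invf_le1 ?ler1n.
  rewrite exprS mulrA mulVf// mul1r -natrX ler_nat.
  elim: k => // k IH; rewrite expnS factS leq_mul//.
have -> : 4 * nc z ^+ m = 2 * nc z ^+ m * (2 * 1) by ring.
by rewrite ler_wpM2l ?mulr_ge0// ler_wpM2l// exprn_ile1 ?invr_ge0 ?invf_le1 ?ler1n.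
Qed.

Lemma cexp_sub1 (z : R[i]) : nc z <= 1 -> nc (cexp z - 1) <= 4 * nc z.
Proof. by move=> /(cexp_tail 1); rewrite /exp_sum big_nat1 expr0 fact0 divr1 expr1. Qed.

Lemma ctends_cexp (T : Type) (F : set_system T) {FF : Filter F} (f : T -> R[i]) l :
  ctends F f l -> ctends F (fun t => cexp (f t)) (cexp l).
Proof.
move=> fl; apply: (ctends_le (g := fun t => 4 * nc (cexp l) * nc (f t - l))).
  move/cvgrPdist_le : (fl) => /(_ _ ltr01); apply: filterS => t.
  rewrite sub0r normrN ger0_norm ?nc_ge0// => /cexp_sub1 h.
  have -> : cexp (f t) - cexp l = cexp l * (cexp (f t - l) - 1).
    by rewrite mulrBr mulr1 -cexpD [l + _]addrC subrK.
  by rewrite ncM -mulrA mulrCA ler_wpM2l ?nc_ge0.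
rewrite -(mulr0 (4 * nc (cexp l))); apply: cvgM => //; exact: cvg_cst.
Qed.

Lemma weierstrass1_sub1 (t : R[i]) : nc t <= 1 ->
  nc ((1 - t) * cexp t - 1) <= 9 * nc t ^+ 2.
Proof.
move=> t1; have := cexp_tail 2 t1.
rewrite /exp_sum !big_nat_recr//= big_geq// add0r expr0 expr1 fact0 !divr1.
set e := cexp t => h.
have -> : (1 - t) * e - 1 = (1 - t) * (e - (1 + t)) - t ^+ 2 by ring.
apply: le_trans (ncB _ _) _; rewrite ncM ncX.
have h2 : nc (1 - t) <= 2 by apply: le_trans (ncB _ _) _; rewrite nc1; lra.
have := nc_ge0 (1 - t); have := nc_ge0 (e - (1 + t)); nra.
Qed.

(** The exponent is -log (1 - t) to second order, so the error is cubic. The bounds |1 - t| <= 2, 4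
    |u|^3 for the exponential tail and |u|^3 <= 2 |t|^3 give 16; the explicit polynomial remainder
    adds at most 1. *)
Lemma weierstrass2_sub1 (t : R[i]) : nc t <= 2^-1 ->
  nc ((1 - t) * cexp (t + t ^+ 2 / 2) - 1) <= 20 * nc t ^+ 3.
Proof.
move=> t1; set u := t + t ^+ 2 / 2; have t0 := nc_ge0 t.
have u1 : nc u <= 5 / 4 * nc t.
  by apply: le_trans (ncD _ _) _; rewrite ncM ncX ncV (nc_nat _ 2); nra.
have := cexp_tail 3 (_ : nc u <= 1) => /(_ _)/wrap[]; first by lra.
rewrite /exp_sum !big_nat_recr//= big_geq// add0r expr0 expr1 fact0 !divr1.
set e := cexp u => h.
have -> : (1 - t) * e - 1 = (1 - t) * (e - (1 + u + u ^+ 2 / 2%:R)) -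
   t ^+ 3 * (2^-1 + t * (3 / 8) + t ^+ 2 / 8).
  by rewrite /u; field.
apply: le_trans (ncB _ _) _.
rewrite [nc ((1 - t) * _)]ncM [nc (t ^+ 3 * _)]ncM ncX.
have h2 : nc (1 - t) <= 2 by apply: le_trans (ncB _ _) _; rewrite nc1; lra.
have h3 : nc (2^-1 + t * (3 / 8) + t ^+ 2 / 8) <= 1.
  apply: le_trans (ncD _ _) _; rewrite ncM ncX ncV (nc_nat _ 8).
  have := ncD 2^-1 (t * (3 / 8)); rewrite !ncM !ncV !nc_nat.
  nra.
have h4 : nc u ^+ 3 <= 2 * nc t ^+ 3.
  apply: (@le_trans _ _ ((5 / 4 * nc t) ^+ 3)); first by rewrite lerXn2r ?nnegrE ?nc_ge0//; lra.
  rewrite exprMn ler_wpM2r ?exprn_ge0//; lra.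
have h5 : 0 <= nc t ^+ 3 by rewrite exprn_ge0.
have := nc_ge0 (1 - t); have := nc_ge0 (e - (1 + u + u ^+ 2 / 2%:R)).
have : nc t ^+ 3 * nc (2^-1 + t * (3 / 8) + t ^+ 2 / 8) <= nc t ^+ 3 by rewrite ler_piMr.
nra.
Qed.

(** The bound 1/2 on the sum closes the induction: with s the sum over the rest, the cross term 2 s
    e_i is at most e_i. *)
Lemma nc_prod_sub1 (I : eqType) (r : seq I) (f : I -> R[i]) (e : I -> R) :
  (forall i, i \in r -> nc (f i - 1) <= e i) -> \sum_(i <- r) e i <= 2^-1 ->
  nc (\prod_(i <- r) f i - 1) <= 2 * \sum_(i <- r) e i.
Proof.
elim: r => [|i r IH] fe; first by rewrite !big_nil subrr nc0 mulr0.
have e0 j : j \in i :: r -> 0 <= e j by move=> /fe; apply: le_trans; exact: nc_ge0.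
have s0 : 0 <= \sum_(j <- r) e j.
  by rewrite big_seq sumr_ge0// => j jr; rewrite e0// in_cons jr orbT.
have hr := e0 i (mem_head _ _).
rewrite !big_cons => h.
have {}IH : nc (\prod_(j <- r) f j - 1) <= 2 * \sum_(j <- r) e j.
  by apply: IH => [j jr|]; [apply: fe; rewrite in_cons jr orbT|lra].
set P := \prod_(j <- r) f j in IH *; set s := \sum_(j <- r) e j in IH s0 h *.
have -> : f i * P - 1 = (f i - 1) * (P - 1) + (f i - 1) + (P - 1) by ring.
apply: le_trans (ncD _ _) _; have := ncD ((f i - 1) * (P - 1)) (f i - 1).
rewrite ncM; have := fe i (mem_head _ _).
have := nc_ge0 (f i - 1); have := nc_ge0 (P - 1).
nra.
Qed.

End Exponential.

(** * Real zeros of real polynomials *)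

Section RealZeros.
Variable R : realType.
Implicit Types (p q g : {poly R}) (s : seq R) (N : nat).

Notation linprod s := (\prod_(x <- s) ('X - x%:P)).

Definition rootfree q := forall x, ~~ root q x.

(* At most N nonreal zeros: q may still have real zeros, and every N works for
   p = 0. *)
Definition nonreal_le p N :=
  exists q s, p = q * linprod s /\ (size q <= N.+1)%N.

Lemma rootfree_neq0 q : rootfree q -> q != 0.
Proof. by move=> qf; apply/eqP => q0; have := qf 0; rewrite q0 root0. Qed.

Lemma rootfree_odd q : rootfree q -> odd (size q).
Proof.
by move=> qf; apply/negPn/negP => /odd_poly_root[x]; rewrite (negbTE (qf x)).
Qed.

Lemma rootfree_factor p : p != 0 -> exists q s, p = q * linprod s /\ rootfree q.
Proof.
elim: {p}(size p) {-2}p (leqnn (size p)) => [p|n IH p pn p0].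
  by rewrite leqn0 size_poly_eq0 => ->.
have [[x px]|h] := pselect (exists x, root p x); last first.
  exists p, [::]; rewrite big_nil mulr1; split=> // x.
  by apply/negP => px; apply: h; exists x.
have [p' pE] := factor_theorem _ _ px.
have p'0 : p' != 0 by apply: contra p0; rewrite pE => /eqP ->; rewrite mul0r.
have [|q [s [p'E qf]]] := IH p' _ p'0.
  by move: pn; rewrite pE size_Mmonic ?monicXsubC// size_XsubC addn2.
by exists q, (x :: s); split=> //; rewrite big_cons pE p'E mulrAC mulrA.
Qed.

Lemma nonreal_le_rootfree p N : p != 0 -> nonreal_le p N ->
  exists q s, [/\ p = q * linprod s, rootfree q & (size q <= N.+1)%N].
Proof.
move=> p0 [q [s [pE qN]]].
have q0 : q != 0 by apply: contra p0; rewrite pE => /eqP ->; rewrite mul0r.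
have [q' [s' [qE q'f]]] := rootfree_factor q0.
exists q', (s' ++ s); split=> //; first by rewrite big_cat pE qE mulrA.
apply: leq_trans qN; rewrite qE size_Mmonic ?rootfree_neq0 ?monic_prod_XsubC//.
by rewrite size_prod_XsubC addnS leq_addr.
Qed.

Lemma nonreal_le_mono p N N' : (N <= N')%N -> nonreal_le p N -> nonreal_le p N'.
Proof. by move=> h [q [s [pE qN]]]; exists q, s; split=> //; rewrite (leq_trans qN). Qed.

Lemma nonreal_le0 N : nonreal_le 0 N.
Proof. by exists 0, [::]; rewrite mul0r size_poly0. Qed.

Lemma nonreal_le_size p N : (size p <= N.+1)%N -> nonreal_le p N.
Proof. by exists p, [::]; rewrite big_nil mulr1. Qed.

Lemma nonreal_leZ p N (c : R) : nonreal_le p N -> nonreal_le (c *: p) N.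
Proof.
move=> [q [s [-> qN]]]; exists (c *: q), s; rewrite scalerAl; split=> //.
exact: leq_trans (size_scale_leq _ _) qN.
Qed.

Lemma nonreal_leM p N s : nonreal_le p N -> nonreal_le (p * linprod s) N.
Proof. by move=> [q [s' [-> qN]]]; exists q, (s' ++ s); rewrite big_cat mulrA. Qed.

Lemma size_rootfree_factor q s : rootfree q -> size (q * linprod s) = (size q + size s)%N.
Proof.
move=> /rootfree_neq0 q0; rewrite size_Mmonic ?monic_prod_XsubC//.
by rewrite size_prod_XsubC addnS.
Qed.

Lemma prod_XsubC_exp_dvdp (ds : seq R) (m : R -> nat) g : uniq ds ->
  (forall z, z \in ds -> ('X - z%:P) ^+ m z %| g) ->
  \prod_(z <- ds) ('X - z%:P) ^+ m z %| g.
Proof.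
elim: ds => [|z ds IH] /=; first by rewrite big_nil dvd1p.
move=> /andP[zds uds] h; rewrite big_cons Gauss_dvdp.
  rewrite h ?mem_head// IH// => w wds; apply: h.
  by rewrite inE wds orbT.
rewrite coprimep_sym coprimep_expr// coprimep_XsubC.
elim: ds zds {IH uds h} => [|w ds IH]; first by rewrite big_nil root1.
rewrite inE negb_or => /andP[zw zds]; rewrite big_cons rootM negb_or IH// andbT.
by rewrite /root horner_exp hornerXsubC expf_neq0// subr_eq0.
Qed.

Lemma linprod_dvdp s g :
  (forall z, ('X - z%:P) ^+ count_mem z s %| g) -> linprod s %| g.
Proof.
move=> h; rewrite -prodr_undup_exp_count.
by apply: prod_XsubC_exp_dvdp; [exact: undup_uniq|move=> z _; exact: h].
Qed.

(* Rolle's theorem for x |-> exp (c x) p(x). *)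
Lemma rolle_exp p (c a b : R) : a < b -> root p a -> root p b ->
  exists2 y, a < y < b & root (c *: p + p^`()) y.
Proof.
move=> ab pa pb; pose f := fun x : R => expR (c * x) * p.[x].
have df (x : R) : is_derive x 1 f (expR (c * x) * (c * p.[x] + p^`().[x])).
  have h1 : is_derive x 1 (fun x : R => expR (c * x)) (c * expR (c * x)).
    have h0 : is_derive x 1 (fun x : R => c * x) c.
      by apply: is_derive_eq; rewrite /GRing.scale /=; ring.
    have := is_derive1_comp (is_derive_expR (c * x)) h0.
    by rewrite /GRing.scale /= mulrC.
  have h2 := is_derive_poly p x.
  apply: is_derive_eq.
  by rewrite /GRing.scale /=; ring.
have [|||y] := @Rolle R f a b ab.
- by move=> x _; case: (df x).
- apply: continuous_subspaceT => x; apply: differentiable_continuous.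
  by apply/derivable1_diffP; case: (df x).
- by rewrite /f (rootP pa) (rootP pb) !mulr0.
rewrite in_itv /= => yab h; exists y => //.
have := df y; move: h => [_ h1] [_ h2].
move: h2; rewrite h1 => /esym/eqP; rewrite mulf_eq0 gt_eqF ?expR_gt0//=.
by rewrite /root !hornerE => /eqP ->.
Qed.

(** Rolle between consecutive entries. The clause [x < y] carries distinctness through the
    induction; avoiding the old zeros keeps the new ones apart from those left over from multiple
    zeros. *)
Lemma interlacing_roots p (c : R) (x : R) s :
  path <%R x s -> all (root p) (x :: s) ->
  exists ys, [/\ size ys = size s, all (root (c *: p + p^`())) ys, uniq ys,
     all (fun y => x < y) ys & all (fun y => y \notin x :: s) ys].
Proof.
elim: s x => [|x1 s IH] x /=; first by exists [::].
move=> /andP[xx1 px1] /and3P[rx rx1 rs].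
have [|ys [sz ry uy gy ny]] := IH x1 px1; first by rewrite /= rx1.
have [y /andP[xy yx1] ry0] := rolle_exp c xx1 rx rx1.
exists (y :: ys); split => /=.
- by rewrite sz.
- by rewrite ry0.
- rewrite uy andbT; apply/negP => /(allP gy); rewrite ltNge.
  by rewrite (ltW yx1).
- by rewrite xy; apply/allP => z /(allP gy); apply: lt_trans.
- apply/andP; split.
    rewrite !inE !negb_or (gt_eqF xy) (lt_eqF yx1)/=.
    apply/negP => ys'; move: px1; rewrite (path_sortedE lt_trans) => /andP[/allP + _].
    by move=> /(_ _ ys'); rewrite ltNge (ltW yx1).
  apply/allP => z zys; have /(_ _ zys) := allP ny => zn.
  rewrite in_cons negb_or zn andbT; have /(_ _ zys) := allP gy => x1z.
  by rewrite gt_eqF// (lt_trans xx1).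
Qed.

(** A zero listed k times in [s] persists k - 1 times, and Rolle adds one zero in each gap between
    consecutive distinct zeros; the total is one less than [size s]. *)
Lemma linprod_derive_dvdp p (c : R) s : (0 < size s)%N -> linprod s %| p ->
  exists2 s', (size s).-1 = size s' & linprod s' %| c *: p + p^`().
Proof.
move=> s0 sp; set g := c *: p + p^`().
have dvdpow z : ('X - z%:P) ^+ count_mem z s %| p.
  apply: dvdp_trans sp; rewrite -prodr_undup_exp_count.
  have [zs|zs] := boolP (z \in s).
    by rewrite (bigD1_seq z) ?mem_undup ?undup_uniq//= dvdp_mulr.
  by rewrite (count_memPn zs) expr0 dvd1p.
have rootp z : z \in s -> root p z.
  move=> zs; rewrite root_factor_theorem; apply: dvdp_trans (dvdpow z).
  by rewrite -{1}[_ - _]expr1 dvdp_exp2l// -has_count has_pred1.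
(* [rest] lists every zero once less often than [s] does. *)
have [rest sE] := perm_to_subseq (undup_subseq s).
set ds := sort <=%R (undup s).
have mds z : (z \in ds) = (z \in s) by rewrite mem_sort mem_undup.
have sds : sorted <%R ds by rewrite sort_lt_sorted undup_uniq.
have zds : size ds = size (undup s) by rewrite size_sort.
case dsE : ds => [|x0 t].
  by move: s0; rewrite -has_predT => /hasP[a]; rewrite -mds dsE.
rewrite dsE in sds zds mds; move: sds => /= pt.
have at0 : all (root p) (x0 :: t) by apply/allP => z; rewrite mds; exact: rootp.
have [ys [szy ry uy _ ny]] := interlacing_roots c pt at0.
exists (ys ++ rest).
  have := perm_size sE; rewrite !size_cat -zds /= addSn => ->.
  by rewrite szy.
apply: linprod_dvdp => z; rewrite count_cat.
have := permP sE (pred1 z); rewrite count_cat => cE.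
have [zy|zy] := boolP (z \in ys).
  have zs : z \notin s by rewrite -mds; exact: (allP ny).
  move: cE; rewrite (count_memPn zs) => /esym/eqP; rewrite addn_eq0 => /andP[_ /eqP ->].
  by rewrite addn0 count_uniq_mem// zy expr1 dvdp_XsubCl; exact: (allP ry).
rewrite (count_memPn zy) add0n.
have [zs|zs] := boolP (z \in s); last first.
  move: cE; rewrite (count_memPn zs) => /esym/eqP; rewrite addn_eq0 => /andP[_ /eqP ->].
  by rewrite expr0 dvd1p.
move: cE; rewrite (count_uniq_mem _ (undup_uniq s)) mem_undup zs add1n => cE.
have := dvdpow z; rewrite cE => /dvdpP[v pE].
rewrite /g pE derivM deriv_exp derivXsubC.
have d1 : ('X - z%:P) ^+ count_mem z rest %| ('X - z%:P) ^+ (count_mem z rest).+1.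
  exact: dvdp_exp2l.
rewrite mul1r -mulr_natl -mul_polyC.
by rewrite !dvdp_add// !dvdp_mull.
Qed.

Lemma nonreal_le_dvdp g s N : g != 0 -> linprod s %| g ->
  (size g <= N.+1 + size s)%N -> nonreal_le g N.
Proof.
move=> g0 /dvdpP[h gE] gN; exists h, s; split=> //.
have h0 : h != 0 by apply: contra g0; rewrite gE => /eqP ->; rewrite mul0r.
move: gN; rewrite gE size_Mmonic ?monic_prod_XsubC// size_prod_XsubC addnS /=.
by rewrite leq_add2r.
Qed.

(** The degree drops and at most one real zero is lost, so the cofactor does not grow. *)
Lemma nonreal_le_deriv p N : nonreal_le p N -> nonreal_le p^`() N.
Proof.
move=> pN; have [->|g0] := eqVneq p^`() 0; first exact: nonreal_le0.
have p0 : p != 0 by apply: contra g0 => /eqP ->; rewrite deriv0.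
have [q [s [pE qf qN]]] := nonreal_le_rootfree p0 pN.
have sg : (size p^`() < size p)%N by rewrite lt_size_deriv.
have sp : size p = (size q + size s)%N by rewrite pE size_rootfree_factor.
have [s0|s0] := posnP (size s).
  by apply: nonreal_le_size; rewrite (leq_trans (ltnW sg))// sp s0 addn0.
have [|s' ss' sg'] := @linprod_derive_dvdp p 0 s s0; first by rewrite pE dvdp_mull.
rewrite scale0r add0r in sg'.
apply: (nonreal_le_dvdp g0 sg'); rewrite -ss'.
by move: sg; rewrite sp; move: qN s0; clear; lia.
Qed.

(* Rolle alone gives at most one extra nonreal zero; parity excludes it. *)
Lemma nonreal_le_addderiv p N (c : R) : c != 0 ->
  nonreal_le p N -> nonreal_le (c *: p + p^`()) N.
Proof.
move=> c0 pN; have [->|p0] := eqVneq p 0.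
  by rewrite scaler0 deriv0 addr0; exact: nonreal_le0.
have [q [s [pE qf qN]]] := nonreal_le_rootfree p0 pN.
have sp : size p = (size q + size s)%N by rewrite pE size_rootfree_factor.
have sg : size (c *: p + p^`()) = size p.
  by rewrite size_polyDl size_scale// lt_size_deriv.
have g0 : c *: p + p^`() != 0 by rewrite -size_poly_gt0 sg size_poly_gt0.
have [s0|s0] := posnP (size s).
  by apply: nonreal_le_size; rewrite sg sp s0 addn0.
have [|s' ss' sg'] := @linprod_derive_dvdp p c s s0; first by rewrite pE dvdp_mull.
have : nonreal_le (c *: p + p^`()) (size q).
  by apply: (nonreal_le_dvdp g0 sg'); rewrite sg sp -ss' addSn -addnS prednK.
move=> /(nonreal_le_rootfree g0)[h [t [gE hf hq]]]; exists h, t; split=> //.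
apply: leq_trans qN; have := rootfree_odd hf; have := rootfree_odd qf.
by move: hq; rewrite leq_eqVlt => /predU1P[-> /=|//]; move=> ->.
Qed.

Lemma nonreal_le_subderiv p N (x : R) :
  nonreal_le p N -> nonreal_le (p - x *: p^`()) N.
Proof.
move=> pN; have [->|x0] := eqVneq x 0; first by rewrite scale0r subr0.
have -> : p - x *: p^`() = (- x) *: ((- x^-1) *: p + p^`()).
  by rewrite scalerDr scalerA mulrNN mulfV// scale1r scaleNr.
by apply/nonreal_leZ/nonreal_le_addderiv; rewrite // oppr_eq0 invr_eq0.
Qed.

(** Normalised homogeneous coordinates of the zero b.2 / b.1 on the projective line, with (0, 1) the
    point at infinity. The equation says that one of the coordinates is 1; written as a product it
    passes to limits. *)
Definition unit_linear (b : R * R) :=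
  [/\ `|b.1| <= 1, `|b.2| <= 1 & (b.1 - 1) * (b.2 - 1) = 0].

Definition linear_of (b : R * R) : {poly R} := b.1 *: 'X - b.2%:P.

Lemma linear_of01 : linear_of (0, 1) = (-1)%:P.
Proof. by rewrite -[LHS]/(0 *: 'X - 1%:P) scale0r sub0r polyCN. Qed.

Lemma linear_of_neq0 b : unit_linear b -> linear_of b != 0.
Proof.
case: b => b c [/= _ _ h]; apply/eqP => /polyP e.
have := e 0%N; have := e 1%N; rewrite /linear_of !coefB !coefZ !coefX !coefC ?coef0 /fst /snd /=.
rewrite mulr1 mulr0 subr0 sub0r => b0 /eqP; rewrite oppr_eq0 => /eqP c0.
by move: h; rewrite b0 c0 !sub0r mulrNN mulr1 => /eqP; rewrite oner_eq0.
Qed.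

Lemma nonreal_le_linear p N b : nonreal_le p N -> nonreal_le (p * linear_of b) N.
Proof.
case: b => b c pN; rewrite /linear_of /=; have [->|b0] := eqVneq b 0.
  rewrite scale0r sub0r -polyCN mulrC mul_polyC; exact: nonreal_leZ.
have -> : p * (b *: 'X - c%:P) = b *: (p * linprod [:: c / b]).
  rewrite big_seq1 scalerAr; congr (p * _).
  by rewrite scalerBr -[b *: (c / b)%:P]mul_polyC -polyCM mulrC divfK.
exact/nonreal_leZ/nonreal_leM.
Qed.

Lemma nonreal_le_linears p N (b : nat -> R * R) D :
  nonreal_le p N -> nonreal_le (p * \prod_(i < D) linear_of (b i)) N.
Proof.
move=> pN; elim: D => [|D IH]; first by rewrite big_ord0 mulr1.
by rewrite big_ord_recr mulrA; exact: nonreal_le_linear.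
Qed.

Lemma XsubC_unit_linear (x : R) : exists (l : R) b, unit_linear b /\
  'X - x%:P = l *: linear_of b.
Proof.
have [x1|x1] := lerP `|x| 1.
  exists 1, (1, x); rewrite /unit_linear /linear_of /= normr1 subrr mul0r.
  by rewrite !scale1r.
have x0 : x != 0 by rewrite -normr_gt0 (lt_trans _ x1).
exists x, (x^-1, 1); rewrite /unit_linear /linear_of /= normr1 subrr mulr0.
rewrite normfV invf_le1 ?(ltW x1) ?(lt_trans _ x1)//; split=> //.
by rewrite scalerBr scalerA mulfV// scale1r -[x *: 1%:P]mul_polyC mulr1.
Qed.

(* Roots may escape to infinity in a limit of polynomials; with coefficients
   normalised as here, limits of the factors stay nonzero. *)
Lemma nonreal_le_normal_form p N D : nonreal_le p N -> (size p <= D)%N ->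
  exists (l : R) q (b : nat -> R * R),
  [/\ (size q <= N.+1)%N, \sum_(i < N.+1) `|q`_i| = 1, forall i, unit_linear (b i) &
     p = l *: (q * \prod_(i < D) linear_of (b i))].
Proof.
have u0 : unit_linear (0, 1).
  by split; rewrite /= ?normr0 ?normr1 ?subrr ?mulr0.
have [-> _ _|p0] := eqVneq p 0.
  exists 0, 1, (fun=> (0, 1)); split=> //; last by rewrite scale0r.
    by rewrite size_poly1.
  rewrite big_ord_recl coef1 normr1 big1 ?addr0// => i _.
  by rewrite coef1 normr0.
move=> pN pD; have [q [s [pE qf qN]]] := nonreal_le_rootfree p0 pN.
have sD : (size s <= D)%N.
  by apply: leq_trans pD; rewrite pE size_rootfree_factor// leq_addl.
have [l [b [bu sE]]] : exists (l : R) (b : nat -> R * R), (forall i, unit_linear (b i)) /\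
    linprod s = l *: \prod_(i < D) linear_of (b i).
  elim: s D sD {pE pD} => [|x s IH] D sD.
    (* The missing zeros are placed at infinity; each contributes the constant -1, whence the
       sign. *)
    exists ((-1) ^+ D), (fun=> (0, 1)); split=> //.
    by rewrite linear_of01 prodr_const card_ord big_nil -polyC_exp -mul_polyC -polyCM -exprMn
      mulrNN mulr1 expr1n.
  case: D sD => // D /IH[l [b [bu sE]]].
  have [m [c [cu xE]]] := XsubC_unit_linear x.
  exists (m * l), (fun i => if i is j.+1 then b j else c); split; first by case.
  by rewrite big_cons xE sE big_ord_recl /= -scalerAl -scalerAr scalerA.
set S := \sum_(i < N.+1) `|q`_i|.
have S0 : 0 < S.
  rewrite lt_neqAle sumr_ge0// andbT eq_sym; apply/negP => /eqP S0.
  have := rootfree_neq0 qf; apply/negP/negPn/eqP/polyP => i; rewrite coef0.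
  have [iN|iN] := ltnP i N.+1; last by rewrite nth_default// (leq_trans qN).
  apply/eqP; rewrite -normr_eq0; apply/eqP.
  by have /psumr_eq0P := S0; move=> /(_ (fun _ _ => normr_ge0 _) (Ordinal iN) isT).
exists (S * l), (S^-1 *: q), b; split=> //.
- exact: leq_trans (size_scale_leq _ _) qN.
- under eq_bigr do rewrite coefZ normrM.
  by rewrite -mulr_sumr ger0_norm ?invr_ge0 ?ltW// mulVf// gt_eqF.
- by rewrite pE sE -scalerAl scalerA mulrAC mulfV ?gt_eqF// mul1r -scalerAr.
Qed.

Section CoefficientLimits.
Variables (T : Type) (U : set_system T).
Context {FU : Filter U}.

Definition ptends (p : T -> {poly R}) (P : {poly R}) :=
  forall k, (fun t => (p t)`_k) @ U --> P`_k.

Lemma cvg_sumR (n : nat) (f : 'I_n -> T -> R) (l : 'I_n -> R) :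
  (forall i, f i @ U --> l i) -> (fun t => \sum_(i < n) f i t) @ U --> \sum_(i < n) l i.
Proof.
move=> h; elim: n f l h => [|n IH] f l h.
  by under eq_fun do rewrite big_ord0; rewrite big_ord0; exact: cvg_cst.
under eq_fun do rewrite big_ord_recl; rewrite big_ord_recl.
by apply: cvgD; [exact: h|apply: IH].
Qed.

Lemma ptendsM (p q : T -> {poly R}) P Q : ptends p P -> ptends q Q -> ptends (fun t => p t * q t) (P * Q).
Proof.
move=> pP qQ k; under eq_fun do rewrite coefM; rewrite coefM.
by apply: cvg_sumR => i; apply: cvgM.
Qed.

Lemma ptends_cst P : ptends (fun=> P) P.
Proof. by move=> k; exact: cvg_cst. Qed.

Lemma ptends_prod n (p : 'I_n -> T -> {poly R}) (P : 'I_n -> {poly R}) :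
  (forall i, ptends (p i) (P i)) ->
  ptends (fun t => \prod_(i < n) p i t) (\prod_(i < n) P i).
Proof.
elim: n p P => [|n IH] p P h.
  under eq_fun do rewrite big_ord0; rewrite big_ord0; exact: ptends_cst.
under eq_fun do rewrite big_ord_recl; rewrite big_ord_recl.
by apply: ptendsM => //; apply: IH.
Qed.

End CoefficientLimits.

(** Only the scalars [l t] are not bounded a priori. The normalised factors converge along [U] to a
    nonzero polynomial [L], and a nonvanishing coefficient of [L] then forces [l t] to converge. *)
Lemma nonreal_le_limit (T : Type) (U : set_system T) (p : T -> {poly R}) P N D :
  UltraFilter U -> (forall t, (size (p t) <= D)%N) -> ptends U p P ->
  (forall t, nonreal_le (p t) N) -> nonreal_le P N.
Proof.
move=> UU pD pP pN; have PU : ProperFilter U by exact: ultra_proper.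
have /choice[l] := fun t => nonreal_le_normal_form (pN t) (pD t).
move=> /choice[q] /choice[b hqb].
have qN t i : `|(q t)`_i| <= 1.
  have [h <- _ _] := hqb t; have [iN|iN] := ltnP i N.+1.
    by rewrite (bigD1 (Ordinal iN))//= lerDl sumr_ge0.
  by rewrite nth_default ?normr0 ?sumr_ge0// (leq_trans h).
have [q_ hq] := ultra_bounded_seq UU qN.
have [b1 hb1] : exists b1 : nat -> R, forall i, (fun t => (b t i).1) @ U --> b1 i.
  by apply: (@ultra_bounded_seq R T nat U (fun t i => (b t i).1) (fun=> 1)) => // t i;
     have [_ _ /(_ i)[]] := hqb t.
have [b2 hb2] : exists b2 : nat -> R, forall i, (fun t => (b t i).2) @ U --> b2 i.
  by apply: (@ultra_bounded_seq R T nat U (fun t i => (b t i).2) (fun=> 1)) => // t i;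
     have [_ _ /(_ i)[]] := hqb t.
pose bb i := (b1 i, b2 i).
have bu i : unit_linear (bb i).
  split => /=.
  - apply: (cvg_le_bound (cvg_norm (hb1 i))); apply: nearW => t.
    by have [_ _ /(_ i)[]] := hqb t.
  - apply: (cvg_le_bound (cvg_norm (hb2 i))); apply: nearW => t.
    by have [_ _ /(_ i)[]] := hqb t.
  - have h : (fun t => ((b t i).1 - 1) * ((b t i).2 - 1)) @ U -->
        ((b1 i - 1) * (b2 i - 1)).
      by apply: cvgM; apply: cvgB => //; exact: cvg_cst.
    apply: (cvg_unique (@Rhausdorff R) h).
    rewrite (_ : (fun t => _) = fun=> 0); first exact: cvg_cst.
    by apply/funext => t; have [_ _ /(_ i)[]] := hqb t.
pose Q := \poly_(i < N.+1) q_ i.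
have qQ : ptends U q Q.
  move=> k; rewrite coef_poly; case: ltnP => kN; first exact: hq.
  rewrite (_ : (fun t => _) = fun=> 0); first exact: cvg_cst.
  by apply/funext => t; have [h _ _ _] := hqb t; rewrite nth_default// (leq_trans h).
(* The normalisation of the coefficient sum to 1 passes to the limit. *)
have Q0 : Q != 0.
  apply/eqP => Q0; have h : (fun t => \sum_(i < N.+1) `|(q t)`_i|) @ U -->
      \sum_(i < N.+1) `|Q`_i| by apply: cvg_sumR => i; apply: cvg_norm; exact: qQ.
  have h' : (fun t => \sum_(i < N.+1) `|(q t)`_i|) @ U --> (1 : R).
    rewrite (_ : (fun t => _) = fun=> 1); first exact: cvg_cst.
    by apply/funext => t; have [] := hqb t.
  pose proof (cvg_unique (@Rhausdorff R) h h') as e; move: e; rewrite Q0 big1 => [|i _].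
    by move/eqP; rewrite eq_sym oner_eq0.
  by rewrite coef0 normr0.
have bL i : ptends U (fun t => linear_of (b t i)) (linear_of (bb i)).
  move=> k; rewrite /linear_of; under eq_fun do rewrite coefB coefZ coefC.
  rewrite coefB coefZ coefC; apply: cvgB.
    by apply: cvgM; [exact: hb1|exact: cvg_cst].
  by case: (k == 0%N); [exact: hb2|exact: cvg_cst].
pose Lt t := q t * \prod_(i < D) linear_of (b t i).
pose L := Q * \prod_(i < D) linear_of (bb i).
have LtL : ptends U Lt L by apply: ptendsM => //; apply: ptends_prod.
have L0 : L != 0.
  rewrite mulf_neq0//; apply/prodf_neq0 => i _; exact: linear_of_neq0.
have pE t : p t = l t *: Lt t by have [_ _ _ ->] := hqb t.
have [k Lk] : exists k, L`_k != 0.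
  by exists (size L).-1; rewrite -lead_coefE lead_coef_eq0.
have ll : l @ U --> P`_k / L`_k.
  have h : (fun t => (p t)`_k / (Lt t)`_k) @ U --> P`_k / L`_k.
    by apply: cvgM => //; apply: cvgV.
  apply: cvg_trans h; apply: near_eq_cvg.
  have : \forall t \near U, (Lt t)`_k != 0.
    have Lk0 : 0 < `|L`_k| by rewrite normr_gt0.
    have /cvgrPdist_lt/(_ _ Lk0) := LtL k; apply: filterS => t.
    by apply: contraTneq => ->; rewrite subr0 ltxx.
  by apply: filterS => t h; rewrite pE coefZ mulfK.
have -> : P = (P`_k / L`_k) *: L.
  apply/polyP => j; rewrite coefZ.
  apply: (cvg_unique (@Rhausdorff R) (pP j)).
  rewrite (_ : (fun t => _) = fun t => l t * (Lt t)`_j); first by apply: cvgM.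
  by apply/funext => t; rewrite pE coefZ.
apply/nonreal_leZ/nonreal_le_linears/nonreal_le_size; exact: size_poly.
Qed.

End RealZeros.

(** * Counting nonreal zeros *)

Section EntireAlgebra.
Variable R : realType.
Implicit Types (g h : R[i] -> R[i]) (z w : R[i]).

Lemma ctends_dnbhs_shift g z : derivable g z 1 ->
  ctends (0^' : set_system R[i]) (fun e => g (e + z)) (g z).
Proof.
move=> /derivableCP[d hd].
pose proof (ctendsD (ctendsM (@ctends_dnbhs_id R) hd) (ctends_cst (g z))) as h.
rewrite mul0r add0r in h; apply: ctends_near h.
have : \forall e \near (0^' : set_system R[i]), e != 0 by exact: nbhs_dnbhs_neq.
by apply: filterS => e e0; rewrite mulrA mulfV// mul1r subrK.
Qed.

Lemma entireM g h : entire g -> entire h -> entire (fun z => g z * h z).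
Proof.
move=> eg eh z; apply/derivableCP.
have [d hd] := (derivableCP g z).1 (eg z).
have [d' hd'] := (derivableCP h z).1 (eh z).
exists (d * h z + g z * d').
pose proof (ctendsD (ctendsM hd (ctends_dnbhs_shift (eh z)))
                    (ctendsM (ctends_cst (g z)) hd')) as k.
by apply: ctends_eq k => e; ring.
Qed.

Lemma entireD g h : entire g -> entire h -> entire (fun z => g z + h z).
Proof.
move=> eg eh z; apply/derivableCP.
have [d hd] := (derivableCP g z).1 (eg z).
have [d' hd'] := (derivableCP h z).1 (eh z).
exists (d + d'); pose proof (ctendsD hd hd') as k.
by apply: ctends_eq k => e; ring.
Qed.

Lemma entire_cst (c : R[i]) : entire (fun=> c).
Proof.
move=> z; apply/derivableCP; exists 0.
by apply: ctends_eq (ctends_cst 0) => e; rewrite subrr mulr0.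
Qed.

Lemma entire_id : entire (fun z : R[i] => z).
Proof.
move=> z; apply/derivableCP; exists 1; apply: ctends_near (ctends_cst 1).
have : \forall e \near (0^' : set_system R[i]), e != 0 by exact: nbhs_dnbhs_neq.
by apply: filterS => e e0; rewrite addrK mulVf.
Qed.

Lemma entire_horner (p : {poly R[i]}) : entire (horner p).
Proof.
elim/poly_ind: p => [|p c IH].
  rewrite (_ : horner 0 = fun=> 0); first exact: entire_cst.
  by apply/funext => z; rewrite horner0.
rewrite (_ : horner _ = fun z => p.[z] * z + c).
  pose proof (entireD (entireM IH entire_id) (@entire_cst c)) as e; exact: e.
by apply/funext => z; rewrite hornerMXaddC.
Qed.

(** After cancelling the smaller power of z - w away from w, continuity at w makes the cofactor of
    the smaller order vanish there. *)
Lemma zero_of_order_unique g w m m' :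
  zero_of_order g w m -> zero_of_order g w m' -> m = m'.
Proof.
wlog mm : m m' / (m < m')%N.
  move=> H h h'; case: (ltngtP m m') => // mm; first exact: H h h'.
  by symmetry; exact: H h' h.
move=> [h [eh hw gE]] [h' [eh' _ gE']].
case/eqP: hw.
pose proof (ctends_dnbhs_shift (eh w)) as l1.
pose proof (ctendsM (ctendsX (m' - m) (@ctends_dnbhs_id R))
                     (ctends_dnbhs_shift (eh' w))) as l2.
rewrite expr0n subn_eq0 leqNgt mm mul0r in l2.
apply: (ctends_unique l1); apply: ctends_near l2.
have : \forall e \near (0^' : set_system R[i]), e != 0 by exact: nbhs_dnbhs_neq.
apply: filterS => e e0; have := gE (e + w); rewrite gE' addrK.
rewrite -(subnKC (ltnW mm)) exprD -mulrA => /(mulfI (expf_neq0 _ e0)).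
by rewrite addKn.
Qed.

Lemma multiplicityE g w m : zero_of_order g w m -> multiplicity g w = m.
Proof.
move=> h; apply: xget_unique => // m' h'.
exact: zero_of_order_unique h' h.
Qed.

Lemma count_sum_undup (T : eqType) (P : pred T) (l : seq T) :
  count P l = (\sum_(w <- undup l | P w) count_mem w l)%N.
Proof.
rewrite -sum1_count -big_undup_iterop_count; apply: eq_bigr => w _.
by rewrite Monoid.iteropE; elim: (count_mem w l) => //= n ->.
Qed.

Lemma notin_nonreal_exists (l : seq R[i]) : exists2 z, z \isn't Num.real & z \notin l.
Proof.
pose L := [seq (0 +i* k.+1%:R : R[i]) | k <- iota 0 (size l).+1].
have uL : uniq L.
  rewrite map_inj_uniq ?iota_uniq// => j k [] /eqP.
  by rewrite eqr_nat => /eqP[].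
have : has [predC l] L.
  apply/negPn/negP; rewrite -all_predC => /allP h.
  have : (size L <= size l)%N.
    by apply: uniq_leq_size => // z /h /=; rewrite negbK.
  by rewrite size_map size_iota ltnn.
move=> /hasP[z /mapP[k _ ->] zl]; exists (0 +i* k.+1%:R) => //.
by rewrite complex_real pnatr_eq0.
Qed.

(** At a nonreal w, [h] and the linear factors of the other zeros form a cofactor that does not
    vanish at w, so the multiplicity is the number of occurrences in [l]. On the real axis [h] may
    vanish, as a Laguerre-Pólya factor does. *)
Lemma zero_count_factor g h (l : seq R[i]) : entire h ->
  (forall z, z \isn't Num.real -> h z != 0) ->
  (forall z, g z = (\prod_(w <- l) ('X - w%:P)).[z] * h z) ->
  zero_count g (@nonreal R) = (count (fun w => w \isn't Num.real) l)%:R%:E.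
Proof.
move=> eh h0 gE; rewrite /zero_count ifF; last first.
  apply/negbTE/asboolPn => g0; have [z zr zl] := notin_nonreal_exists l.
  have /eqP := g0 z; rewrite gE mulf_eq0 (negbTE (h0 _ zr)) orbF.
  by rewrite -/(root _ z) root_prod_XsubC (negbTE zl).
have mE w : w \isn't Num.real -> multiplicity g w = count_mem w l.
  move=> wr; apply: multiplicityE.
  exists (fun z => (\prod_(x <- l | x != w) ('X - x%:P)).[z] * h z); split.
  - pose proof (entireM (@entire_horner (\prod_(x <- l | x != w) ('X - x%:P))) eh) as e; exact: e.
  - rewrite mulf_neq0 ?h0// horner_prod prodf_seq_neq0.
    by apply/allP => x _; apply/implyP => xw; rewrite hornerXsubC subr_eq0 eq_sym.
  - move=> z; rewrite gE mulrA (bigID (pred1 w))/= hornerM; congr (_ * _ * _).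
    rewrite (eq_bigr (fun=> 'X - w%:P)) => [|x /eqP -> //].
    by rewrite big_const_seq iter_mulr_1 horner_exp hornerXsubC.
transitivity (\esum_(w in [set` undup l]) (if w \isn't Num.real then (count_mem w l)%:R%:E else 0 : \bar R)%E).
  rewrite esum_mkcond [RHS]esum_mkcond; apply: eq_esum => w _.
  have [|] := boolP (w \in @nonreal R); rewrite ?inE => wr.
    rewrite mE// wr; case: ifPn => //; rewrite notin_setE /= mem_undup => /negP wl.
    by rewrite (count_memPn wl).
  case: ifPn => // _; rewrite ifF//; apply/negbTE.
  by move: wr; rewrite notin_setE /nonreal /= => /negP.
rewrite esum_fset; last first.
- by move=> w _; case: ifPn => // _; rewrite lee_fin ler0n.
- exact: finite_seq.
rewrite -fsbig_seq ?undup_uniq// -big_mkcond /= sumEFin.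
by rewrite -natr_sum -count_sum_undup.
Qed.


Lemma toC_linprod (s : seq R) : toC (linprod s) = \prod_(w <- [seq x%:C | x <- s]) ('X - w%:P).
Proof.
rewrite rmorph_prod big_map; apply: eq_bigr => x _.
by rewrite rmorphB /= map_polyX map_polyC.
Qed.

Lemma toC_factor (q : {poly R}) : rootfree q -> exists ws : seq R[i],
  [/\ toC q = (lead_coef q)%:C *: \prod_(w <- ws) ('X - w%:P),
      size ws = (size q).-1 & all (fun w => w \isn't Num.real) ws].
Proof.
move=> qf; have [ws qE] := closed_field_poly_normal (toC q).
have lq : (lead_coef q)%:C != 0.
  by rewrite (inj_eq (@complexI R) _ 0) lead_coef_eq0 rootfree_neq0.
rewrite lead_coef_map /= in qE; exists ws; split=> //.
  by rewrite -(size_map_poly (real_complex R)) qE size_scale// size_prod_XsubC.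
apply/allP => w wws; apply/negP => /complex_realP[x wx].
have := qf x; rewrite -(fmorph_root (real_complex R)) /= -wx qE.
by rewrite rootZ// root_prod_XsubC wws.
Qed.

Lemma zero_count_rootfree g h (q : {poly R}) s : rootfree q -> entire h ->
  (forall z, z \isn't Num.real -> h z != 0) ->
  (forall z, g z = (toC (q * linprod s)).[z] * h z) ->
  zero_count g (@nonreal R) = ((size q).-1)%:R%:E.
Proof.
move=> qf eh h0 gE; have [ws [qE sws nws]] := toC_factor qf.
have lq : (lead_coef q)%:C != 0.
  by rewrite (inj_eq (@complexI R) _ 0) lead_coef_eq0 rootfree_neq0.
rewrite (@zero_count_factor g (fun z => (lead_coef q)%:C * h z)
    (ws ++ [seq x%:C | x <- s])).
- rewrite count_cat -sws; congr (_%:R%:E).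
  rewrite (_ : count _ [seq _ | _ <- _] = 0)%N ?addn0; first by apply/eqP; rewrite -all_count.
  by rewrite count_map; apply/eqP; rewrite -leqn0 leqNgt -has_count -all_predC;
     apply/allP => x _ /=; rewrite negbK; apply/complex_realP; exists x.
- pose proof (entireM (@entire_cst (lead_coef q)%:C) eh) as e; exact: e.
- by move=> z zr; rewrite mulf_neq0// h0.
- move=> z; rewrite gE rmorphM /= toC_linprod qE big_cat /= !hornerM hornerZ.
  by ring.
Qed.

Lemma zero_count_real_poly (p : {poly R}) : exists d : nat,
  [/\ zero_count (horner (toC p)) (@nonreal R) = d%:R%:E, nonreal_le p d &
      forall N, nonreal_le p N -> (d <= N)%N].
Proof.
have [->|p0] := eqVneq p 0.
  exists 0%N; split=> //; last exact: nonreal_le0.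
  rewrite /zero_count ifT//; apply/asboolP => z.
  by rewrite map_poly0 horner0.
have zE q s : rootfree q -> p = q * linprod s ->
    zero_count (horner (toC p)) (@nonreal R) = ((size q).-1)%:R%:E.
  move=> qf pE; apply: (@zero_count_rootfree _ (fun=> 1) q s qf).
  - by pose proof (@entire_cst 1) as e; exact: e.
  - by move=> z _; rewrite oner_neq0.
  - by move=> z; rewrite mulr1 pE.
have [q [s [pE qf]]] := rootfree_factor p0.
exists (size q).-1; split; first exact: zE pE.
- exists q, s; split=> //; exact: leqSpred.
- move=> N /(nonreal_le_rootfree p0)[q' [s' [pE' qf' qN]]].
  (* Both factorizations compute the same count, so their root-free cofactors have the same
     degree. *)
  have := zE _ _ qf' pE'; rewrite (zE _ _ qf pE) => -[] /eqP.
  by rewrite eqr_nat => /eqP ->; rewrite -subn1 leq_subLR.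
Qed.

End EntireAlgebra.

(** The parameters are reciprocals of zeros: zeros escaping to infinity become parameters tending to
    0, and the constant term stays 1. *)
Definition revprod (K : nzRingType) (l : seq K) : {poly K} :=
  \prod_(x <- l) (1 - x *: 'X).

(** * Laguerre-Pólya functions as limits of real-rooted polynomials *)

Section ReversedProducts.
Variable R : realType.
Implicit Types (l : seq R) (z : R[i]).

Lemma horner_revprod (K : comNzRingType) (l : seq K) (z : K) :
  (revprod l).[z] = \prod_(x <- l) (1 - x * z).
Proof. by rewrite horner_prod; apply: eq_bigr => x _; rewrite !hornerE. Qed.

Lemma toC_revprod l : toC (revprod l) = revprod [seq x%:C | x <- l].
Proof.
rewrite /revprod rmorph_prod big_map; apply: eq_bigr => x _.
by rewrite rmorphB rmorph1 /= map_polyZ map_polyX.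
Qed.

Lemma horner_toC_revprod l z :
  (toC (revprod l)).[z] = \prod_(x <- l) (1 - x%:C * z).
Proof. by rewrite toC_revprod horner_revprod big_map. Qed.

Lemma sqr_nc_revprod l z :
  nc (toC (revprod l)).[z] ^+ 2 <=
  expR (- 2 * (\sum_(x <- l) x) * Re z + (\sum_(x <- l) x ^+ 2) * nc z ^+ 2).
Proof.
rewrite horner_toC_revprod; elim: l => [|x l IH].
  by rewrite !big_nil nc1 expr1n mulr0 !mul0r addr0 expR0.
rewrite !big_cons ncM exprMn.
have -> : - 2 * (x + \sum_(x0 <- l) x0) * Re z +
   (x ^+ 2 + \sum_(x0 <- l) x0 ^+ 2) * nc z ^+ 2 =
   (- 2 * x * Re z + x ^+ 2 * nc z ^+ 2) +
   (- 2 * (\sum_(x0 <- l) x0) * Re z + (\sum_(x0 <- l) x0 ^+ 2) * nc z ^+ 2).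
  by ring.
rewrite expRD ler_pM ?exprn_ge0 ?nc_ge0//.
apply: le_trans (expR_ge1Dx _); rewrite !nc_sqr.
by case: z {IH} => a b /=; rewrite le_eqVlt; apply/orP; left; apply/eqP; ring.
Qed.

Lemma revprod_locally_bounded (T : Type) (L : T -> seq R) (s S : R) :
  (forall t, `|\sum_(x <- L t) x| <= s) -> (forall t, \sum_(x <- L t) x ^+ 2 <= S) ->
  locally_bounded (fun t => toC (revprod (L t))).
Proof.
move=> Ls LS r r0; exists (1 + expR (2 * s * r + S * r ^+ 2)) => t z zr.
set e := expR _; have e0 : 0 < e by exact: expR_gt0.
have : nc (toC (revprod (L t))).[z] ^+ 2 <= e.
  apply: le_trans (sqr_nc_revprod _ _) _; rewrite ler_expR.
  have S0 : 0 <= \sum_(x <- L t) x ^+ 2 by rewrite sumr_ge0// => x _; rewrite sqr_ge0.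
  apply: lerD; last first.
    apply: ler_pM => //; first by rewrite exprn_ge0 ?nc_ge0.
    by rewrite lerXn2r ?nnegrE ?nc_ge0.
  have h : `|\sum_(x <- L t) x * Re z| <= s * r.
    rewrite -mulr_suml normrM ler_pM//; exact: le_trans (Re_le _) zr.
  move: h; rewrite -mulr_suml ler_norml => /andP[h _]; lra.
have := nc_ge0 (toC (revprod (L t))).[z]; nra.
Qed.

End ReversedProducts.

Section LaguerrePolya.
Variable R : realType.
Implicit Types (z : R[i]) (p h : R[i] -> R[i]).

(** The primary factor in terms of the reciprocal x = 1 / a; it still makes sense at x = 0, where it
    is 1. *)
Definition wfactor (x : R) z := (1 - x%:C * z) * cexp (x%:C * z).

Lemma primary_factorE (a : R) z : primary_factor a z = wfactor a^-1 z.
Proof. by rewrite /primary_factor /wfactor fmorphV mulrC [_^-1 * z]mulrC mulrC. Qed.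

Lemma wfactor_neq0 (x : R) z : z \isn't Num.real -> wfactor x z != 0.
Proof.
move=> zr; rewrite mulf_neq0 ?cexp_neq0// subr_eq0; apply: contra zr => /eqP e.
have x0 : x%:C != 0 :> R[i].
  by apply/eqP => x0; move/eqP: e; rewrite x0 mul0r oner_eq0.
apply/complex_realP; exists x^-1; rewrite fmorphV.
by apply: (mulfI x0); rewrite -e mulfV.
Qed.

Lemma wfactor_sub1 (x : R) z : nc z ^+ 2 * x ^+ 2 <= 1 ->
  nc (wfactor x z - 1) <= 9 * nc z ^+ 2 * x ^+ 2.
Proof.
have e : nc (x%:C * z) ^+ 2 = nc z ^+ 2 * x ^+ 2.
  by rewrite ncM nc_real exprMn real_normK ?num_real// mulrC.
move=> h; apply: le_trans (weierstrass1_sub1 _) _; last by rewrite e mulrA.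
by rewrite -(@expr_le1 _ 2) ?nc_ge0// e.
Qed.

Lemma sqr_inv (a : R) : a ^- 2 = (a^-1) ^+ 2. Proof. by rewrite exprVn. Qed.

Lemma ctends_ge_bound (T : Type) (F : set_system T) {FF : ProperFilter F}
    (f : T -> R[i]) l (B : R) :
  ctends F f l -> (\forall t \near F, B <= nc (f t)) -> B <= nc l.
Proof.
move=> /ctends_nc h fB; rewrite -(cvg_lim (@Rhausdorff R) h).
by apply: limr_ge => //; apply/cvg_ex; exists (nc l).
Qed.

(** An infinite product is a nonvanishing finite product times a tail that stays within 1/2 of 1. *)
Lemma canonical_product_neq0 p z : canonical_product p -> z \isn't Num.real -> p z != 0.
Proof.
move=> [[s [_ pE]]|[a [a0 ca pE]]] zr.
  rewrite pE prodf_seq_neq0; apply/allP => x _; rewrite /= primary_factorE.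
  exact: wfactor_neq0.
set Z := 9 * nc z ^+ 2; have Z0 : 0 <= Z by rewrite mulr_ge0 ?exprn_ge0 ?nc_ge0.
(* Makes the tail sum of 9 |z|^2 x^2 at most 1/4, so that the tail product is within 1/2 of 1. *)
pose d := (4 * (Z + 1))^-1; have d0 : 0 < d by rewrite invr_gt0; lra.
have Zd : Z * d <= 4^-1.
  by rewrite /d ler_pdivrMr ?mulr_gt0//; lra.
pose v := limn (series (fun j => (a j) ^- 2)).
have nd : nondecreasing_seq (series (fun j => (a j) ^- 2)).
  by apply: nondecreasing_series => j _ _; rewrite sqr_inv sqr_ge0.
have [J _ hJ] : \forall n \near \oo, v - series (fun j => (a j) ^- 2) n <= d.
  have /cvgrPdist_le/(_ _ d0) : series (fun j => (a j) ^- 2) @ \oo --> v by exact: ca.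
  by apply: filterS => n; apply: le_trans; exact: ler_norm.
have tail n : (J <= n)%N -> \sum_(J <= j < n) (a j)^-1 ^+ 2 <= d.
  move=> Jn; apply: le_trans (hJ J (leqnn J)); rewrite lerBrDr.
  apply: le_trans (nondecreasing_cvgn_le nd ca n).
  rewrite /series /= [leRHS](big_cat_nat (n := J))//= [leRHS]addrC lerD2r.
  by apply: ler_sum => j _; rewrite sqr_inv.
have tail1 j : (J <= j)%N -> (a j)^-1 ^+ 2 <= d.
  move=> Jj; apply: le_trans (tail j.+1 (leqW Jj)).
  by rewrite big_nat_recr//= lerDr sumr_ge0// => i _; rewrite sqr_ge0.
set P := \prod_(j < J) primary_factor (a j) z.
have P0 : P != 0.
  by apply/prodf_neq0 => j _; rewrite primary_factorE wfactor_neq0.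
suff : nc P / 2 <= nc (p z).
  by move=> h; rewrite -nc_gt0 (lt_le_trans _ h)// divr_gt0// nc_gt0.
pose proof ((ctendsP _ _).1 (pE z)) as hp.
apply: (ctends_ge_bound hp); exists J => // n /= Jn.
rewrite -(big_mkord xpredT (fun j => primary_factor (a j) z)).
rewrite (big_cat_nat (n := J))//= big_mkord -/P ncM ler_wpM2l ?nc_ge0//.
set T := \prod_(J <= j < n) _.
have sE : \sum_(J <= j < n) 9 * nc z ^+ 2 * (a j)^-1 ^+ 2 <= 4^-1.
  by rewrite -mulr_sumr -/Z (le_trans _ Zd)// ler_wpM2l// tail.
have : nc (T - 1) <= 2 * \sum_(J <= j < n) 9 * nc z ^+ 2 * (a j)^-1 ^+ 2.
  apply: nc_prod_sub1; last by apply: le_trans sE _; rewrite lef_pV2 ?posrE// ler_nat.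
  move=> j; rewrite mem_index_iota => /andP[Jj _].
  rewrite primary_factorE; apply: wfactor_sub1.
  apply: (@le_trans _ _ (Z * d)).
    apply: ler_pM; rewrite ?sqr_ge0 ?exprn_ge0 ?nc_ge0 ?tail1//.
    by rewrite /Z ler_peMl ?exprn_ge0 ?nc_ge0// ler1n.
  by apply: le_trans Zd _; rewrite invf_le1 ?ler1n.
have := ncB T (T - 1); rewrite subKr nc1.
lra.
Qed.

(** Finite and infinite products in one form. Only the squares are bounded; the sums of x over [L j]
    may diverge. *)
Lemma canonical_product_lists p : canonical_product p ->
  exists (L : nat -> seq R) (B : R), (forall j, \sum_(x <- L j) x ^+ 2 <= B) /\
    forall z, ctends \oo (fun j => \prod_(x <- L j) wfactor x z) (p z).
Proof.
move=> [[s [_ pE]]|[a [a0 ca pE]]].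
  exists (fun=> [seq a^-1 | a <- s]), (\sum_(x <- [seq a^-1 | a <- s]) x ^+ 2).
  split=> // z; rewrite pE big_map.
  have -> : \prod_(a <- s) primary_factor a z = \prod_(a <- s) wfactor a^-1 z.
    by apply: eq_bigr => x _; exact: primary_factorE.
  exact: ctends_cst.
exists (fun n => [seq (a j)^-1 | j <- iota 0 n]), (limn (series (fun j => (a j) ^- 2))).
split=> [n|z].
  rewrite big_map.
  have nd : nondecreasing_seq (series (fun j => (a j) ^- 2)).
    by apply: nondecreasing_series => j _ _; rewrite sqr_inv sqr_ge0.
  apply: le_trans (nondecreasing_cvgn_le nd ca n).
  rewrite /series /= /index_iota subn0.
  by apply: ler_sum => j _; rewrite sqr_inv.
pose proof ((ctendsP _ _).1 (pE z)) as hp; apply: ctends_eq hp => n.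
rewrite big_map -(big_mkord xpredT (fun j => primary_factor (a j) z)).
rewrite /index_iota subn0; apply: eq_bigr => j _; exact: primary_factorE.
Qed.

(** Since (1 - t) e^t = 1 + O(t^2), the K-th power is 1 + O(K t^2); 18 is twice the 9 of
    [weierstrass1_sub1]. *)
Lemma ctends_pow1 (K : nat -> nat) (t : nat -> R[i]) (C : R) :
  0 <= C -> (forall j, (0 < K j)%N) ->
  (forall j, (K j)%:R * nc (t j) ^+ 2 <= C * j.+1%:R^-1) ->
  ctends \oo (fun j => ((1 - t j) * cexp (t j)) ^+ K j) 1.
Proof.
move=> C0 K0 tC.
have h0 : (fun j => C * j.+1%:R^-1) @ \oo --> (0 : R).
  by rewrite -(mulr0 C); apply: cvgM; [exact: cvg_cst|exact: cvg_harmonic].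
apply: (ctends_le (g := fun j => 18 * (C * j.+1%:R^-1))); last first.
  by rewrite -(mulr0 18); apply: cvgM => //; exact: cvg_cst.
have e0 : (0 : R) < 18^-1 by rewrite invr_gt0.
have /cvgrPdist_le/(_ _ e0) := h0; apply: filterS => j.
rewrite sub0r normrN ger0_norm ?mulr_ge0 ?invr_ge0// => hj.
have t1 : nc (t j) <= 1.
  rewrite -(@expr_le1 _ 2) ?nc_ge0//.
  apply: (@le_trans _ _ ((K j)%:R * nc (t j) ^+ 2)).
    by rewrite ler_peMl ?exprn_ge0 ?nc_ge0// ler1n.
  by apply: le_trans (tC j) _; apply: le_trans hj _; rewrite invf_le1 ?ler1n.
have sE : \sum_(i <- nseq (K j) tt) 9 * nc (t j) ^+ 2 = 9 * ((K j)%:R * nc (t j) ^+ 2).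
  by rewrite big_nseq iter_addr_0 -mulr_natl; ring.
have := @nc_prod_sub1 R _ (nseq (K j) tt) (fun=> (1 - t j) * cexp (t j))
  (fun=> 9 * nc (t j) ^+ 2) _ _.
rewrite sE big_nseq iter_mulr_1.
move=> /(_ _ _)/le_trans; apply.
- by move=> _ _; exact: weierstrass1_sub1.
- apply: (@le_trans _ _ (9 * 18^-1)); last lra.
  by rewrite ler_wpM2l// (le_trans (tC j)).
- by have := tC j; move: (C / _) ((K j)%:R * _) => u v; lra.
Qed.

Lemma cexpX (a : R[i]) n : cexp a ^+ n = cexp (n%:R * a).
Proof.
elim: n => [|n IH]; first by rewrite mul0r cexp0.
by rewrite exprS IH -cexpD -[in RHS]natr1 mulrDl mul1r addrC.
Qed.

(** With b = beta + sum of [L j], the factor (1 + b z / K)^K approaches e^(b z), which provides both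
    e^(beta z) and the exponentials of the primary factors, while (1 - alpha z^2 / (j + 1))^(j + 1)
    approaches e^(-alpha z^2). The sum over [M j] is then exactly -beta, although the sums over
    [L j] may be unbounded. *)
Lemma laguerre_polya_approx h : laguerre_polya h -> 
  exists (c : R) (m : nat) (M : nat -> seq R) (s S : R),
  [/\ forall j, `|\sum_(x <- M j) x| <= s, forall j, \sum_(x <- M j) x ^+ 2 <= S,
     forall z, ctends \oo (fun j => c%:C * z ^+ m * (toC (revprod (M j))).[z]) (h z)
     & (c = 0 \/ forall z, z \isn't Num.real -> h z != 0)].
Proof.
move=> [_ [c [alpha [beta [m [p [al0 cp hE]]]]]]].
have [L [B [LB Lp]]] := canonical_product_lists cp.
pose b j := beta + \sum_(x <- L j) x.
(* As b may be unbounded in j, K must outgrow b^2: it makes b^2 / K at most 1 / (j + 1). *)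
pose K j := (Num.bound ((b j ^+ 2 + 1) * j.+1%:R)).
have K1 j : (b j ^+ 2 + 1) * j.+1%:R < (K j)%:R.
  by apply: archi_boundP; rewrite mulr_ge0// addr_ge0 ?sqr_ge0.
have K0 j : (0 < K j)%N.
  rewrite -(ltr0n R); apply: le_lt_trans (K1 j).
  by rewrite mulr_ge0// addr_ge0 ?sqr_ge0.
pose r j := Num.sqrt (alpha / j.+1%:R).
have r2 j : r j ^+ 2 = alpha / j.+1%:R by rewrite sqr_sqrtr// divr_ge0.
pose M j := L j ++ nseq (K j) (- (b j / (K j)%:R)) ++ nseq j.+1 (r j) ++ nseq j.+1 (- r j).
have KR j : (K j)%:R != 0 :> R by rewrite pnatr_eq0 -lt0n.
have b2 j : b j ^+ 2 / (K j)%:R <= j.+1%:R^-1.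
  rewrite ler_pdivrMr ?ltr0n// mulrC ler_pdivlMr ?ltr0n//.
  by apply: le_trans (ltW (K1 j)); rewrite ler_wpM2r// lerDl.
exists c, m, M, `|beta|, (B + 1 + 2 * alpha); split.
- move=> j; rewrite !big_cat !big_nseq !iter_addr_0 /=.
  by rewrite !mulNrn subrr addr0 -[b j / _ *+ _]mulr_natr divfK// /b opprD addrCA subrr addr0 normrN.
- move=> j; rewrite !big_cat !big_nseq !iter_addr_0 /=.
  rewrite !sqrrN !r2.
  have -> : (b j / (K j)%:R) ^+ 2 *+ K j = b j ^+ 2 / (K j)%:R.
    by rewrite -[_ ^+ 2 *+ _]mulr_natl; field.
  have -> : alpha / j.+1%:R *+ j.+1 = alpha.
    by rewrite -[_ / _ *+ _]mulr_natr divfK// pnatr_eq0.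
  have : b j ^+ 2 / (K j)%:R <= 1 by apply: le_trans (b2 j) _; rewrite invf_le1 ?ler1n.
  have := LB j; lra.
- move=> z; rewrite hE.
  pose t1 j := (- (b j / (K j)%:R))%:C * z.
  pose t2 j := (alpha / j.+1%:R)%:C * z ^+ 2.
  have l1 : ctends \oo (fun j => ((1 - t1 j) * cexp (t1 j)) ^+ K j) 1.
    apply: (@ctends_pow1 K t1 (nc z ^+ 2)); rewrite ?exprn_ge0 ?nc_ge0// => j.
    rewrite ncM nc_real normrN exprMn real_normK ?num_real// exprMn.
    have -> : (K j)%:R * (b j ^+ 2 * (K j)%:R^-1 ^+ 2 * nc z ^+ 2) =
      nc z ^+ 2 * (b j ^+ 2 / (K j)%:R) by field.
    by rewrite ler_wpM2l ?exprn_ge0 ?nc_ge0.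
  have l2 : ctends \oo (fun j => ((1 - t2 j) * cexp (t2 j)) ^+ j.+1) 1.
    apply: (@ctends_pow1 S t2 (alpha ^+ 2 * nc z ^+ 4)) => // [|j].
      by rewrite mulr_ge0 ?exprn_ge0 ?nc_ge0.
    rewrite ncM ncX nc_real exprMn real_normK ?num_real// -exprM exprMn.
    have j0 : j.+1%:R != 0 :> R by rewrite pnatr_eq0.
    rewrite le_eqVlt; apply/orP; left; apply/eqP; by field.
  pose proof (ctendsM (ctendsM (ctendsM (ctends_cst (c%:C * z ^+ m *
    cexp (- (alpha%:C * z ^+ 2) + beta%:C * z))) (Lp z)) l1) l2) as l.
  rewrite !mulr1 in l; apply: ctends_eq l => j.
  have -> : (toC (revprod (M j))).[z] = \prod_(x <- L j) (1 - x%:C * z) *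
      (1 - t1 j) ^+ K j * (1 - t2 j) ^+ j.+1.
    rewrite horner_toC_revprod !big_cat !big_nseq !iter_mulr_1 [LHS]/= -exprMn.
    rewrite mulrA; congr (_ * _ ^+ _); rewrite /t2 -r2 rmorphXn rmorphN /=; ring.
  have -> : \prod_(x <- L j) wfactor x z =
      \prod_(x <- L j) (1 - x%:C * z) * cexp ((\sum_(x <- L j) x)%:C * z).
    by rewrite /wfactor big_split /= cexp_sum -mulr_suml rmorph_sum.
  rewrite [((1 - t1 j) * _) ^+ _]exprMn [((1 - t2 j) * _) ^+ _]exprMn.
  have -> : cexp (t1 j) ^+ K j = cexp (- ((b j)%:C * z)).
    rewrite cexpX /t1 -(rmorph_nat (real_complex R)) mulrA -rmorphM /=.
    by rewrite mulrN mulrCA mulfV// mulr1 rmorphN mulNr.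
  have -> : cexp (t2 j) ^+ j.+1 = cexp (alpha%:C * z ^+ 2).
    rewrite cexpX /t2 -(rmorph_nat (real_complex R)) mulrA -rmorphM /=.
    by rewrite (mulrCA j.+1%:R alpha) mulfV ?mulr1// pnatr_eq0.
  (* The exponentials inserted to make each factor close to 1 cancel against that of [h]. *)
  have e1 : cexp (- (alpha%:C * z ^+ 2) + beta%:C * z) *
      cexp ((\sum_(x <- L j) x)%:C * z) * cexp (- ((b j)%:C * z)) *
      cexp (alpha%:C * z ^+ 2) = 1.
    rewrite -!cexpD -cexp0; congr cexp.
    by rewrite /b rmorphD /=; ring.
  move: e1; set e1 := cexp _; set e2 := cexp _; set e3 := cexp _; set e4 := cexp _.
  move=> e1234; rewrite -[RHS]mulr1 -e1234; ring.
- have [->|c0] := eqVneq c 0; [by left|right=> z zr].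
  have z0 : z != 0 by apply: contra zr => /eqP ->; rewrite real0.
  rewrite hE !mulf_neq0 ?cexp_neq0 ?expf_neq0 ?(canonical_product_neq0 cp)//.
  by rewrite (inj_eq (@complexI R) _ 0).
Qed.

End LaguerrePolya.

(** * Appell polynomials *)

Section Appell.
Variable F : numFieldType.
Implicit Types (f : nat -> F) (P : {poly F}).

Lemma coef_appell f n i :
  (appell f n)`_i = if (i <= n)%N then n`!%:R / i`!%:R * f (n - i)%N else 0.
Proof.
rewrite /appell coef_sum; case: leqP => [lin|nin].
  have lt : (n - i < n.+1)%N by rewrite ltnS leq_subr.
  rewrite (bigD1 (Ordinal lt))//= coefZ coefXn subKn// eqxx mulr1 big1 ?addr0//.
  move=> k /eqP kn; rewrite coefZ coefXn; case: eqP => [e|]; last by rewrite mulr0.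
  case: kn; apply: val_inj => /=; rewrite e subKn//.
  by rewrite -ltnS.
rewrite big1// => k _; rewrite coefZ coefXn; case: eqP => [e|]; last by rewrite mulr0.
by move: nin; rewrite e ltnNge leq_subr.
Qed.

Lemma size_appell f n : (size (appell f n) <= n.+1)%N.
Proof.
apply/leq_sizeP => j nj; rewrite coef_appell ifF//; apply/negbTE.
by rewrite -ltnNge.
Qed.

Lemma factE_neq0 n : n`!%:R != 0 :> F.
Proof. by rewrite pnatr_eq0 -lt0n fact_gt0. Qed.

Lemma appell_deriv f n : (appell f n.+1)^`() = n.+1%:R *: appell f n.
Proof.
apply/polyP => i; rewrite coef_deriv coefZ !coef_appell ltnS subSS.
case: leqP => _; last by rewrite mul0rn mulr0.
have h1 := factE_neq0 n; have h2 := factE_neq0 i.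
have h3 : i.+1%:R != 0 :> F by rewrite pnatr_eq0.
rewrite !factS !natrM -mulr_natr; field; by rewrite h2 addrC natr1.
Qed.

Lemma appellM_revlinear P (x : F) n :
  appell (fun k => (P * (1 - x *: 'X))`_k) n =
  appell (fun k => P`_k) n - x *: (appell (fun k => P`_k) n)^`().
Proof.
apply/polyP => i; rewrite coefB coefZ coef_deriv !coef_appell.
rewrite mulrBr mulr1 -scalerAr coefB coefZ coefMX.
case: (ltngtP i n) => [lin|nin|->]; rewrite ?mul0rn ?mulr0 ?subr0//.
  have [d dE] : exists d, (n - i = d.+1)%N by exists (n - i).-1; rewrite prednK ?subn_gt0.
  have -> : (n - i.+1 = d)%N by rewrite subnS dE.
  rewrite dE /= factS natrM -mulr_natr.
  have h1 := factE_neq0 i; have h2 : i.+1%:R != 0 :> F by rewrite pnatr_eq0.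
  by field; rewrite h1 addrC natr1.
by rewrite subnn /= mulr0 subr0.
Qed.

Lemma appellMX P n :
  appell (fun k => (P * 'X)`_k) n = (appell (fun k => P`_k) n)^`().
Proof.
apply/polyP => i; rewrite coef_deriv !coef_appell coefMX.
case: (ltngtP i n) => [lin|nin|->]; rewrite ?mul0rn ?mulr0//.
  have [d dE] : exists d, (n - i = d.+1)%N by exists (n - i).-1; rewrite prednK ?subn_gt0.
  have -> : (n - i.+1 = d)%N by rewrite subnS dE.
  rewrite dE /= factS natrM -mulr_natr.
  have h1 := factE_neq0 i; have h2 : i.+1%:R != 0 :> F by rewrite pnatr_eq0.
  by field; rewrite h1 addrC natr1.
by rewrite subnn /= mulr0.
Qed.

Lemma appellZ P (c : F) n :
  appell (fun k => (c *: P)`_k) n = c *: appell (fun k => P`_k) n.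
Proof.
apply/polyP => i; rewrite coefZ !coef_appell coefZ.
by case: ifP; rewrite ?mulr0// mulrCA.
Qed.

End Appell.

Section AppellZeros.
Variable R : realType.
Implicit Types (a : nat -> R) (P : {poly R}).

Lemma appell_toC a n : appell (fun k => (a k)%:C) n = toC (appell a n).
Proof.
apply/polyP => i; rewrite coef_map /= !coef_appell; case: ifP => //= _.
by rewrite !rmorphM fmorphV !rmorph_nat.
Qed.

Lemma nonreal_le_appell_poly P n : nonreal_le (appell (fun k => P`_k) n) (size P).-1.
Proof.
(* A coefficient of A of index below [k] involves only coefficients of P beyond its degree. For
   small n the truncated subtraction gives k = 0. *)
set A := appell _ n; pose k := (n.+1 - size P)%N.
have -> : A = drop_poly k A * linprod (nseq k 0).
  rewrite -[LHS](poly_take_drop k) big_nseq iter_mulr_1 subr0.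
  rewrite (_ : take_poly k A = 0) ?add0r//.
  apply/polyP => i; rewrite coef0 coef_take_poly; case: ifP => // ik.
  rewrite coef_appell; case: ifP => // lin; rewrite nth_default ?mulr0//.
  by move: ik lin; rewrite /k; move: (size P) => sP; lia.
apply/nonreal_leM/nonreal_le_size; rewrite size_drop_poly.
apply: leq_trans (leq_sub2r k (size_appell _ _)) _; rewrite /k.
by move: (size P) => sP; case: sP => [|sP]; lia.
Qed.

Lemma nonreal_le_appell_revprod P n N (l : seq R) :
  nonreal_le (appell (fun k => P`_k) n) N ->
  nonreal_le (appell (fun k => (P * revprod l)`_k) n) N.
Proof.
elim: l P => [|x l IH] P h; first by rewrite /revprod big_nil mulr1.
rewrite /revprod big_cons mulrA; apply: IH.
by rewrite appellM_revlinear; exact: nonreal_le_subderiv.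
Qed.

Lemma nonreal_le_appell_Xn P n N m :
  nonreal_le (appell (fun k => P`_k) n) N ->
  nonreal_le (appell (fun k => (P * 'X^m)`_k) n) N.
Proof.
elim: m P => [|m IH] P h; first by rewrite expr0 mulr1.
rewrite exprS mulrA; apply: IH; rewrite appellMX; exact: nonreal_le_deriv.
Qed.

Lemma linprod_revprod (s : seq R) : exists (c : R) m (l : seq R),
  linprod s = c *: 'X^m * revprod l.
Proof.
elim: s => [|x s [c [m [l E]]]].
  by exists 1, 0%N, [::]; rewrite /revprod !big_nil scale1r mulr1.
rewrite big_cons E; have [->|x0] := eqVneq x 0.
  by exists c, m.+1, l; rewrite subr0 mulrA -scalerAr -exprS.
exists (- x * c), m, (x^-1 :: l); rewrite /revprod big_cons.
have -> : 'X - x%:P = (- x) *: (1 - x^-1 *: 'X).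
  by rewrite scalerBr scalerA mulNr mulfV// scaleN1r opprK scaleNr alg_polyC addrC.
by rewrite -/(revprod l) -!mul_polyC polyCM !polyCN; ring.
Qed.

Lemma ctends_sub (T : Type) (F G : set_system T) (f : T -> R[i]) l :
  F `<=` G -> ctends F f l -> ctends G f l.
Proof. by move=> FG h A /h; exact: FG. Qed.

Lemma ultra_oo : exists U : set_system nat, UltraFilter U /\ \oo `<=` U.
Proof. exact: ultraFilterLemma. Qed.

Lemma ptends_appell (T : Type) (U : set_system T) {FU : Filter U}
    (p : T -> nat -> R) a n :
  (forall k, p^~ k @ U --> a k) -> ptends U (fun t => appell (p t) n) (appell a n).
Proof.
move=> pa k; under eq_fun do rewrite coef_appell; rewrite coef_appell.
case: ifP => _; last exact: cvg_cst.
by apply: cvgM => //; exact: cvg_cst.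
Qed.

Lemma locally_boundedM (T : Type) (p q : T -> {poly R[i]}) :
  locally_bounded p -> locally_bounded q -> locally_bounded (fun t => p t * q t).
Proof.
move=> pb qb r r0; have [B hB] := pb r r0; have [C hC] := qb r r0.
exists (B * C) => t z zr; rewrite hornerM ncM ler_pM ?nc_ge0//; [exact: hB|exact: hC].
Qed.

Lemma locally_bounded_cst (T : Type) (p : {poly R[i]}) :
  locally_bounded (fun _ : T => p).
Proof.
move=> r r0; exists (\sum_(0 <= k < size p) nc p`_k * r ^+ k) => _ z zr.
rewrite (horner_nat_sum _ (leqnn _)); apply: le_trans (nc_sum _ _ _) _.
apply: ler_sum => k _; rewrite ncM ncX ler_wpM2l ?nc_ge0//.
by rewrite lerXn2r ?nnegrE ?nc_ge0.
Qed.

(* Pointwise convergence plus local boundedness: along an ultrafilter the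
   coefficients converge, and uniqueness of power series identifies the limits. *)
Lemma coef_limit (p : nat -> {poly R}) a (F : R[i] -> R[i]) (U : set_system nat) :
  UltraFilter U -> \oo `<=` U ->
  locally_bounded (fun t => toC (p t)) ->
  (forall z, ctends \oo (fun t => (toC (p t)).[z]) (F z)) ->
  represents (fun k => (a k)%:C) F ->
  forall k, (fun t => (p t)`_k) @ U --> a k.
Proof.
move=> UU Uoo pb pF aF; have PU : ProperFilter U by exact: ultra_proper.
have [B hB] := pb 1 ler01.
have cB t k : `|(p t)`_k| <= B.
  have := @cauchy_estimate R (toC (p t)) 1 B k ler01 (hB t).
  by rewrite coef_map expr1n mulr1 -nc_real.
have [b hb] := ultra_bounded_seq UU cB.
have [|br bF] := @normal_limit R nat U _ (fun t => toC (p t)) (fun k => (b k)%:C) pb.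
  move=> k; pose proof (ctends_real (hb k)) as h; apply: ctends_eq h => t.
  by rewrite coef_map.
have [G bG] := rapid_represents br.
have FG : F =1 G.
  move=> z; pose proof (ctends_sub Uoo (pF z)) as h1; pose proof (bF G bG z) as h2.
  exact: ctends_unique h1 h2.
move=> k; have -> : a k = b k.
  have bF' : represents (fun k => (b k)%:C) F by move=> z; rewrite FG.
  exact: complexI (represents_inj aF bF' k).
exact: hb.
Qed.

Lemma represents0 (f : nat -> R[i]) F : represents f F ->
  (forall z, F z = 0) -> forall k, f k = 0.
Proof.
move=> fF F0; apply: (represents_inj fF); apply/representsP => z; rewrite F0.
apply: ctends_eq (ctends_cst 0) => n; rewrite /series /= big1// => k _.
by rewrite mul0r.
Qed.

Lemma appell0 a n : (forall k, a k = 0) -> appell a n = 0.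
Proof.
move=> a0; apply/polyP => i; rewrite coef_appell coef0 a0 mulr0.
by case: ifP.
Qed.

Lemma laguerre_polya_factor_neq0 (P : {poly R}) (h : R[i] -> R[i]) :
  laguerre_polya h -> ~ (forall z, (toC P).[z] * h z = 0) ->
  (forall z, z \isn't Num.real -> h z != 0) /\ P != 0.
Proof.
move=> lph F0; split; last first.
  by apply/eqP => P0; apply: F0 => z; rewrite P0 map_poly0 horner0 mul0r.
have [c [m [M [s [S [_ _ Mh [c0|//]]]]]]] := laguerre_polya_approx lph.
case: F0 => w; have -> : h w = 0; last by rewrite mulr0.
pose proof (Mh w) as l; rewrite c0 in l.
by apply: (ctends_unique l); apply: ctends_eq (ctends_cst 0) => j; rewrite !mul0r.
Qed.

(** [h] has no nonreal zeros, so the root-free cofactor [q] of [P] determines the count for F. The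
    bound on the Appell polynomials is proved for the approximating [p j] and passes to the limit at
    each fixed n. *)
Lemma laguerre_polya_star_count a F :
  represents (fun k => (a k)%:C) F -> laguerre_polya_star F ->
  exists d : nat, zero_count F (@nonreal R) = d%:R%:E /\
    forall n, nonreal_le (appell a n) d.
Proof.
move=> aF [_ _ [P [h [lph FE]]]].
have [F0|F0] := pselect (forall z, F z = 0).
  exists 0%N; split; first by rewrite /zero_count ifT//; apply/asboolP.
  move=> n; rewrite appell0; first exact: nonreal_le0.
  by move=> k; apply: complexI; rewrite (represents0 aF F0).
have eh : entire h by case: lph.
have [h0 P0] : (forall z, z \isn't Num.real -> h z != 0) /\ P != 0.
  by apply: laguerre_polya_factor_neq0 => // Ph0; apply: F0 => z; rewrite FE Ph0.
have [c [m [M [s [S [Ms MS Mh _]]]]]] := laguerre_polya_approx lph.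
have [q [l [PE qf]]] := rootfree_factor P0.
exists (size q).-1; split.
  by apply: (zero_count_rootfree qf eh h0) => z; rewrite FE PE.
have [U [UU Uoo]] := ultra_oo.
have PU : ProperFilter U by exact: ultra_proper.
pose p j := P * (c *: 'X^m) * revprod (M j).
have cp : forall k, (fun t => (p t)`_k) @ U --> a k.
  apply: (coef_limit UU Uoo _ _ aF).
  - have := locally_boundedM (locally_bounded_cst nat (toC (P * (c *: 'X^m))))
      (revprod_locally_bounded Ms MS).
    by rewrite /p; under [in X in _ -> X]eq_fun do rewrite rmorphM.
  - move=> z; pose proof (ctendsM (ctends_cst (toC P).[z]) (Mh z)) as k.
    rewrite FE; apply: ctends_eq k => j.
    rewrite /p !rmorphM /= !hornerM map_polyZ /= hornerZ map_polyXn hornerXn.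
    by rewrite !mulrA.
move=> n.
apply: (@nonreal_le_limit R nat U (fun t => appell (fun k => (p t)`_k) n) _ _ n.+1 UU).
- by move=> t; exact: size_appell.
- exact: ptends_appell.
(* Only [q] is estimated by its degree; the zeros in [M t], the power of X and the real zeros [l] of
   P are stripped off in turn. *)
- move=> t; rewrite /p; apply: nonreal_le_appell_revprod.
  rewrite -scalerAr appellZ; apply/nonreal_leZ/nonreal_le_appell_Xn.
  have [c' [m' [l' lE]]] := linprod_revprod l.
  rewrite PE lE -scalerAl -scalerAr appellZ; apply/nonreal_leZ.
  rewrite mulrA; apply/nonreal_le_appell_revprod/nonreal_le_appell_Xn.
  exact: nonreal_le_appell_poly.
Qed.

End AppellZeros.

(** * Power sums *)

Section Newton.
Variable K : fieldType.
Implicit Types (l : seq K).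

Lemma revprod_cons (x : K) l : revprod (x :: l) = (1 - x *: 'X) * revprod l.
Proof. by rewrite /revprod big_cons. Qed.

Lemma revprod_cat l1 l2 : revprod (l1 ++ l2) = revprod l1 * revprod l2.
Proof. by rewrite /revprod big_cat. Qed.

Lemma coef_revlinearM (x : K) (p : {poly K}) k :
  ((1 - x *: 'X) * p)`_k = p`_k - (if k is k'.+1 then x * p`_k' else 0).
Proof.
rewrite mulrBl mul1r coefB -scalerAl coefZ coefXM; case: k => //=.
by rewrite mulr0.
Qed.

Lemma size_revprod l : (size (revprod l) <= (size l).+1)%N.
Proof.
elim: l => [|x l IH]; first by rewrite /revprod big_nil size_poly1.
rewrite revprod_cons; apply: leq_trans (size_polyMleq _ _) _ => /=.
have s2 : (size (1 - x *: 'X : {poly K})%R <= 2)%N.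
  apply: leq_trans (size_polyD _ _) _; rewrite size_poly1 size_polyN geq_max /=.
  by apply: leq_trans (size_scale_leq _ _) _; rewrite size_polyX.
by rewrite -subn1 leq_subLR add1n; apply: leq_trans (leq_add s2 IH) _.
Qed.

Lemma coef_revprod0 l : (revprod l)`_0 = 1.
Proof.
elim: l => [|x l IH]; first by rewrite /revprod big_nil coef1.
by rewrite revprod_cons coef_revlinearM subr0.
Qed.

(** [revprod] is the reciprocal polynomial of [linprod]; the scaling [c] will be 1 / n. *)
Lemma coef_revprod_scaled l (c : K) k : (k <= size l)%N ->
  (revprod [seq c * y | y <- l])`_k = c ^+ k * (linprod l)`_(size l - k).
Proof.
elim: l k => [|y l IH] k /=.
  by rewrite leqn0 => /eqP ->; rewrite /revprod !big_nil expr0 mul1r.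
move=> kl; rewrite revprod_cons big_cons coef_revlinearM.
rewrite mulrBl coefB coefXM mul_polyC coefZ.
have [->|kn] := eqVneq k (size l).+1.
  rewrite subnn eqxx sub0r nth_default.
    by rewrite IH// subnn exprS sub0r; ring.
  by apply: leq_trans (size_revprod _) _; rewrite size_map.
have {kn}kl' : (k <= size l)%N by rewrite -ltnS ltn_neqAle kn.
rewrite IH// subSn//=; case: k kl' {kl} => [|k] kl.
  rewrite subn0 expr0 !mul1r subr0 [(linprod l)`_(size l).+1]nth_default ?mulr0 ?subr0//.
  by rewrite size_prod_XsubC.
by rewrite IH 1?ltnW// -subSn// subSS exprS; ring.
Qed.

Definition psum l k := \sum_(y <- l) y ^+ k.

Definition newton_series l N : {poly K} :=
  \sum_(y <- l) y *: \sum_(j < N) (y *: 'X) ^+ j.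

Lemma coef_newton_series l N k : (k < N)%N -> (newton_series l N)`_k = psum l k.+1.
Proof.
move=> kN; rewrite /newton_series coef_sum; apply: eq_bigr => y _.
rewrite coefZ coef_sum (bigD1 (Ordinal kN))//= big1 => [|j jk].
  by rewrite exprZn coefZ coefXn eqxx mulr1 addr0 exprS.
rewrite exprZn coefZ coefXn; case: eqP => [e|]; last by rewrite mulr0.
by move: jk; rewrite -val_eqE /= e eqxx.
Qed.

(* G' / G = - sum_k psum (k+1) X^k as power series, truncated at order N. *)
Lemma newton_identity l N : exists v : {poly K},
  (revprod l)^`() + newton_series l N * revprod l = v * 'X^N.
Proof.
elim: l => [|y l [v IH]].
  by exists 0; rewrite /revprod /newton_series !big_nil derivC !mul0r addr0.
exists ((1 - y *: 'X) * v - (y ^+ N.+1) *: revprod l).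
rewrite revprod_cons /newton_series big_cons -/(newton_series l N) derivM.
have -> : (1 - y *: 'X)^`() = - y%:P.
  by rewrite derivB derivC derivZ derivX sub0r alg_polyC.
have e : (1 - y *: 'X) * (\sum_(j < N) (y *: 'X) ^+ j) = 1 - (y ^+ N)%:P * 'X^N :> {poly K}.
  by rewrite -[LHS]opprK -mulNr opprB -subrX1 opprB exprZn mul_polyC.
set S := \sum_(j < N) _ in e *; set G := revprod l in IH *.
have -> : - y%:P * G + (1 - y *: 'X) * G^`() +
   (y *: S + newton_series l N) * ((1 - y *: 'X) * G) =
   - y%:P * G + (1 - y *: 'X) * (G^`() + newton_series l N * G) +
   y%:P * ((1 - y *: 'X) * S) * G by rewrite -[y *: S]mul_polyC; ring.
by rewrite e IH -[y ^+ N.+1 *: G]mul_polyC [y ^+ N.+1]exprS polyCM; ring.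
Qed.

Lemma newton_recurrence l k :
  psum l k.+1 = - (k.+1%:R * (revprod l)`_k.+1) -
    \sum_(i < k) psum l i.+1 * (revprod l)`_(k - i).
Proof.
have [v /(congr1 (fun p : {poly K} => p`_k))] := newton_identity l k.+1.
rewrite coefMXn ltnSn coefD coef_deriv coefM big_ord_recr /= subnn coef_revprod0.
rewrite mulr1 coef_newton_series// => /eqP.
rewrite (eq_bigr (fun i : 'I_k => psum l i.+1 * (revprod l)`_(k - i))) => [|i _]; last first.
  by rewrite coef_newton_series// ltnS ltnW.
rewrite addrA addr_eq0 => /eqP; rewrite -[RHS]mulN1r -[(revprod l)`_k.+1 *+ _]mulr_natl => e.
by rewrite -[LHS]opprK -[- psum l k.+1]mulN1r -e opprD.
Qed.

End Newton.

(** * A priori bounds on the reciprocal zeros *)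

Section BoundedZeros.
Variable R : realType.
Implicit Types (w u v : R[i]) (ws : seq R[i]) (xs : seq R).

(** Newton's recurrence bounds each power sum by the coefficients and the earlier sums,
    independently of the length of [l]. *)
Lemma psum_bound (a : nat -> R) n : exists B : nat -> R, forall l : seq R[i],
  (forall k, nc (revprod l)`_k <= a k) ->
  forall k, (k < n)%N -> nc (psum l k.+1) <= B k.
Proof.
elim: n => [|n [B hB]]; first by exists (fun=> 0).
exists (fun k => if k == n then n.+1%:R * a n.+1 + \sum_(i < n) B i * a (n - i)%N else B k).
move=> l la k; rewrite ltnS leq_eqVlt => /predU1P[->|kn]; last first.
  by rewrite ltn_eqF// hB.
rewrite eqxx newton_recurrence; apply: le_trans (ncB _ _) _.
rewrite ncN ncM nc_nat lerD ?ler_wpM2l//.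
apply: le_trans (nc_sum _ _ _) _; apply: ler_sum => i _.
by rewrite ncM ler_pM ?nc_ge0// hB.
Qed.

(** The octant of [w]: nonzero numbers in one sector differ in argument by at most 45 degrees. *)
Definition sector w : bool * bool * bool :=
  (0 <= Re w, 0 <= Im w, `|Re w| <= `|Im w|).

Lemma same_sign_mul (x y : R) : (0 <= x) = (0 <= y) -> x * y = `|x| * `|y|.
Proof.
case: (lerP 0 x) => hx; case: (lerP 0 y) => hy // _.
  by rewrite !ger0_norm.
by rewrite !ltr0_norm// mulrNN.
Qed.

(** Within one octant the products of like coordinates are nonnegative and the same coordinate
    dominates in both numbers; its product alone is at least |u| |v| / 2. The constant 1/2, weaker
    than cos 45, avoids a square root. *)
Lemma sector_acute u v : sector u = sector v ->
  nc u * nc v / 2 <= Re u * Re v + Im u * Im v.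
Proof.
move=> [h1 h2 h3]; rewrite (same_sign_mul h1) (same_sign_mul h2).
have nu := nc_sqr u; have nv := nc_sqr v.
rewrite -(real_normK (num_real (Re u))) -(real_normK (num_real (Im u))) in nu.
rewrite -(real_normK (num_real (Re v))) -(real_normK (num_real (Im v))) in nv.
move: nu nv h3 (normr_ge0 (Re u)) (normr_ge0 (Im u)) (normr_ge0 (Re v)) (normr_ge0 (Im v)).
move: (nc_ge0 u) (nc_ge0 v).
move: (nc u) (nc v) `|Re u| `|Im u| `|Re v| `|Im v| => U V a b c d U0 V0 hU hV h3 a0 b0 c0 d0.
clear h1 h2.
suff : (U * V / 2) ^+ 2 <= (a * c + b * d) ^+ 2.
  by rewrite ler_sqr// nnegrE ?divr_ge0 ?addr_ge0 ?mulr_ge0.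
rewrite !exprMn hU hV exprVn.
case: (lerP a b) h3 => [ab|ab] /esym; [move=> cd|move=> /negbT; rewrite -ltNge => cd].
  have h : (a ^+ 2 + b ^+ 2) * (c ^+ 2 + d ^+ 2) <= (2 * b ^+ 2) * (2 * d ^+ 2).
    by rewrite ler_pM ?addr_ge0 ?exprn_ge0//; nra.
  have : 0 <= a * c by rewrite mulr_ge0.
  have : 0 <= b * d by rewrite mulr_ge0.
  nra.
have h : (a ^+ 2 + b ^+ 2) * (c ^+ 2 + d ^+ 2) <= (2 * a ^+ 2) * (2 * c ^+ 2).
  by rewrite ler_pM ?addr_ge0 ?exprn_ge0//; nra.
have : 0 <= a * c by rewrite mulr_ge0.
have : 0 <= b * d by rewrite mulr_ge0.
nra.
Qed.

Lemma Re_mul_conj u v : Re (u * conjc v) = Re u * Re v + Im u * Im v.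
Proof. by case: u => a b; case: v => c d /=; rewrite mulrN opprK. Qed.

(* Pigeonhole on the sectors of the powers w^(2i): this is Dirichlet
   approximation of all the arguments at once. *)
Lemma simultaneous_acute ws M : (size ws <= M)%N ->
  exists2 m, (0 < m <= 8 ^ M)%N &
    forall w, w \in ws -> nc w ^+ (2 * m) / 2 <= Re (w ^+ (2 * m)).
Proof.
move=> wsM.
(* There are 8^M + 1 exponents for 8^M patterns; positions past the end of [ws] read the default 0
   and merely pad the pattern. *)
pose f (i : 'I_(8 ^ M).+1) := [ffun j : 'I_M => sector (nth 0 ws j ^+ (2 * i))].
have /injectivePn[i0 [j0 ij0 fij0]] : ~~ injectiveb f.
  apply/negP => /injectiveP/leq_card.
  by rewrite card_ord card_ffun !card_prod !card_bool card_ord ltnn.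
have [i [j [ij fij]]] : exists i j : 'I_(8 ^ M).+1, (i < j)%N /\ f i = f j.
  case: (ltngtP i0 j0) => h; [by exists i0, j0|by exists j0, i0|].
  by move: ij0; rewrite -val_eqE /= h eqxx.
exists (j - i)%N; first by rewrite subn_gt0 ij /= (leq_trans (leq_subr _ _))// -ltnS.
move=> w /(nthP 0)[k kws wE].
have kM : (k < M)%N by apply: leq_trans kws wsM.
have /ffunP/(_ (Ordinal kM)) := fij; rewrite !ffunE /= wE => /esym/sector_acute.
rewrite -Re_mul_conj !ncX.
have [->|w0] := eqVneq w 0.
  by move=> _; rewrite nc0 !expr0n muln_eq0 /= subn_eq0 leqNgt ij /= mul0r.
have nw : 0 < nc w by rewrite nc_gt0.
(* The angle between w^(2i) and w^(2j) is the argument of w^(2(j - i)). *)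
have -> : w ^+ (2 * j) * conjc (w ^+ (2 * i)) =
    w ^+ (2 * (j - i)) * ((nc w ^+ (4 * i)))%:C.
  rewrite rmorphXn /= -{1}(subnK (ltnW ij)) mulnDr exprD -mulrA; congr (_ * _).
  rewrite -exprMn -sqr_normc normE rmorphXn /= -exprM.
  by congr (_ ^+ _); lia.
have -> : forall z (x : R), Re (z * x%:C) = Re z * x.
  by move=> [c d] x /=; rewrite mulr0 subr0.
rewrite -ler_pdivrMr ?exprn_gt0//; apply: le_trans.
rewrite le_eqVlt; apply/orP; left; apply/eqP.
have -> : nc w ^+ (2 * j) = nc w ^+ (2 * (j - i)) * nc w ^+ (2 * i).
  by rewrite -exprD; congr (_ ^+ _); lia.
have -> : nc w ^+ (4 * i) = nc w ^+ (2 * i) * nc w ^+ (2 * i).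
  by rewrite -exprD; congr (_ ^+ _); lia.
by field; rewrite expf_neq0// gt_eqF.
Qed.

Lemma psum_real_cat ws xs k :
  Re (psum (ws ++ [seq x%:C | x <- xs]) k) =
  \sum_(w <- ws) Re (w ^+ k) + \sum_(x <- xs) x ^+ k.
Proof.
rewrite /psum big_cat ReD !Re_sum big_map; congr (_ + _).
by apply: eq_bigr => x _; rewrite -rmorphXn.
Qed.

Lemma zeros_bounded (a : nat -> R) (M : nat) : exists T s S : R, 0 <= T /\
  forall ws xs, (size ws <= M)%N ->
  (forall k, nc (revprod (ws ++ [seq x%:C | x <- xs]))`_k <= a k) ->
  [/\ forall w, w \in ws -> nc w <= T, `|\sum_(x <- xs) x| <= s &
     \sum_(x <- xs) x ^+ 2 <= S].
Proof.
(* Covers the exponents 2m <= 2 * 8^M as well as 1 and 2. *)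
have [B hB] := psum_bound a (2 * 8 ^ M + 2).
pose b := \sum_(k < (2 * 8 ^ M + 2)%N) `|B k|.
have b0 : 0 <= b by rewrite sumr_ge0.
have Bb k : (k < 2 * 8 ^ M + 2)%N -> B k <= b.
  move=> kn; rewrite /b (bigD1 (Ordinal kn))//=; apply: le_trans (ler_norm _) _.
  by rewrite lerDl sumr_ge0.
(* Either |w| <= 1, or |w| <= |w|^(2m) <= 2 b. *)
pose T := 1 + 2 * b; exists T, (b + M%:R * T), (b + M%:R * T ^+ 2).
have T0 : 0 <= T by rewrite /T; lra.
split=> // ws xs wsM la.
have pb k : (0 < k <= 2 * 8 ^ M + 2)%N -> nc (psum (ws ++ [seq x%:C | x <- xs]) k) <= b.
  by case: k => // k /= kn; apply: le_trans (hB _ la _ kn) (Bb _ kn).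
have wT w : w \in ws -> nc w <= T.
  move=> wws; have [m /andP[m0 mM] hm] := simultaneous_acute wsM.
  have h : nc w ^+ (2 * m) / 2 <= b.
    apply: le_trans (_ : _ <= Re (psum (ws ++ [seq x%:C | x <- xs]) (2 * m))) _.
      rewrite psum_real_cat (big_rem _ wws)/= -addrA.
      apply: le_trans (hm w wws) _; rewrite lerDl addr_ge0//.
        rewrite big_seq sumr_ge0// => u /mem_rem uws.
        by apply: le_trans (hm u uws); rewrite divr_ge0// exprn_ge0 ?nc_ge0.
      by rewrite sumr_ge0// => x _; rewrite mulnC exprM sqr_ge0.
    apply: le_trans (ler_norm _) _; apply: le_trans (Re_le _) _; apply: pb.
    by lia.
  have [w1|w1] := lerP (nc w) 1; first by rewrite /T; lra.
  have : nc w <= nc w ^+ (2 * m).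
    by rewrite -{1}[nc w]expr1 ler_weXn2l ?(ltW w1)// muln_gt0 m0.
  rewrite /T; lra.
have sumT k : \sum_(w <- ws) nc w ^+ k <= M%:R * T ^+ k.
  apply: (@le_trans _ _ (\sum_(w <- ws) T ^+ k)).
    rewrite big_seq [leRHS]big_seq; apply: ler_sum => w wws.
    by rewrite lerXn2r ?nnegrE ?nc_ge0// wT.
  rewrite big_const_seq count_predT iter_addr_0 -[T ^+ k *+ _]mulr_natl ler_wpM2r ?exprn_ge0//.
  by rewrite ler_nat.
have ReT k : `|\sum_(w <- ws) Re (w ^+ k)| <= M%:R * T ^+ k.
  apply: le_trans (sumT k); apply: le_trans (ler_norm_sum _ _ _) _.
  by apply: ler_sum => w _; rewrite -ncX Re_le.
have key k : (0 < k <= 2)%N -> `|\sum_(x <- xs) x ^+ k| <= b + M%:R * T ^+ k.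
  move=> k2; have -> : \sum_(x <- xs) x ^+ k =
     Re (psum (ws ++ [seq x%:C | x <- xs]) k) - \sum_(w <- ws) Re (w ^+ k).
    by rewrite psum_real_cat addrAC subrr add0r.
  apply: le_trans (ler_normB _ _) _; apply: lerD (ReT k).
  apply: le_trans (Re_le _) _; apply: pb.
  by move: k2 => /andP[-> /= k2]; rewrite (leq_trans k2)// leq_addl.
split=> //.
  by have := key 1%N isT; rewrite expr1; under eq_bigr do rewrite expr1.
exact: le_trans (ler_norm _) (key 2 isT).
Qed.

End BoundedZeros.

(** * Limits of real-rooted polynomials *)

Section LimitFunctions.
Variable R : realType.
Implicit Types (xs : seq R) (z : R[i]).

Definition absge (x y : R) := `|y| <= `|x|.

(** Indices past the end read 0, where [f] is neutral; lists of varying length thus become families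
    indexed by all naturals. *)
Lemma big_take_nth (V : Type) (idx : V) (op : Monoid.law idx) (f : R -> V) J xs :
  f 0 = idx ->
  \big[op/idx]_(x <- take J xs) f x = \big[op/idx]_(j < J) f (nth 0 xs j).
Proof.
move=> f0; elim: J xs => [|J IH] [|x xs]; rewrite ?take0 ?big_nil ?big_ord0//=.
  by rewrite big1// => j _; rewrite nth_nil f0.
by rewrite big_cons big_ord_recl IH.
Qed.

Lemma absge_nth xs i j : sorted absge xs -> (i <= j)%N ->
  `|nth 0 xs j| <= `|nth 0 xs i|.
Proof.
move=> sx ij; have [js|js] := ltnP j (size xs); last by rewrite [nth 0 xs j]nth_default// normr0.
apply: (sorted_leq_nth _ _ 0 sx) => //.
- by move=> x y z h1 h2; exact: le_trans h2 h1.
- by move=> x; rewrite /absge.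
- exact: leq_ltn_trans ij js.
Qed.

Lemma sum_sqr_nth_le xs J : \sum_(j < J) nth 0 xs j ^+ 2 <= \sum_(x <- xs) x ^+ 2.
Proof.
rewrite -(big_take_nth _ (f := fun x => x ^+ 2)) ?expr0n//.
rewrite -{2}(cat_take_drop J xs) big_cat /= lerDl.
by rewrite sumr_ge0// => x _; rewrite sqr_ge0.
Qed.

(** Each of the first J + 1 squares is at least the one at J, so the entries decay like 1 / sqrt (J
    + 1) uniformly over lists with bounded sum of squares. *)
Lemma absge_sqr_le xs J : sorted absge xs ->
  J.+1%:R * nth 0 xs J ^+ 2 <= \sum_(x <- xs) x ^+ 2.
Proof.
move=> sx; apply: le_trans (sum_sqr_nth_le xs J.+1).
have -> : J.+1%:R * nth 0 xs J ^+ 2 = \sum_(j < J.+1) nth 0 xs J ^+ 2.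
  by rewrite sumr_const card_ord mulr_natl.
apply: ler_sum => j _; rewrite -real_normK ?num_real// -[leRHS]real_normK ?num_real//.
by rewrite lerXn2r ?nnegrE// absge_nth// -ltnS.
Qed.

(** The Weierstrass factor of genus 2. In genus 1 the tails are governed by sums of x^2, which need
    not be small uniformly over the lists; sums of |x|^3 are, because the tail entries are small. *)
Definition wfactor2 (u : R[i]) := (1 - u) * cexp (u + u ^+ 2 / 2).

Lemma wfactor2_0 : wfactor2 0 = 1.
Proof. by rewrite /wfactor2 expr0n mul0r addr0 cexp0 subr0 mulr1. Qed.

Lemma prod_wfactor2 xs z : \prod_(x <- xs) wfactor2 (x%:C * z) =
  (toC (revprod xs)).[z] *
  cexp ((\sum_(x <- xs) x)%:C * z + (\sum_(x <- xs) x ^+ 2)%:C * (z ^+ 2 / 2)).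
Proof.
rewrite horner_toC_revprod /wfactor2 big_split /= cexp_sum; congr (_ * cexp _).
rewrite !rmorph_sum !mulr_suml -big_split /=; apply: eq_bigr => x _.
by rewrite exprMn rmorphXn /= mulrA.
Qed.

Lemma ctends_wfactor2 (T : Type) (F : set_system T) {FF : Filter F} (f : T -> R[i]) l :
  ctends F f l -> ctends F (fun t => wfactor2 (f t)) (wfactor2 l).
Proof.
move=> fl; pose proof (ctendsM (ctendsB (ctends_cst 1) fl)
  (ctends_cexp (ctendsD fl (ctendsM (ctendsX 2 fl) (ctends_cst 2^-1))))) as h.
exact: h.
Qed.

Section UltrafilterLimit.
Variables (T : Type) (U : set_system T) (xs : T -> seq R) (s S : R).
Variables (H : R[i] -> R[i]).
Hypothesis UU : UltraFilter U.
Hypothesis xs_s : forall t, `|\sum_(x <- xs t) x| <= s.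
Hypothesis xs_S : forall t, \sum_(x <- xs t) x ^+ 2 <= S.
Hypothesis xs_sorted : forall t, sorted absge (xs t).
Hypothesis xs_H : forall z, ctends U (fun t => (toC (revprod (xs t))).[z]) (H z).

Let PU : ProperFilter U. Proof. exact: ultra_proper. Qed.

Let S_ge0 t : 0 <= \sum_(x <- xs t) x ^+ 2.
Proof. by rewrite sumr_ge0// => x _; rewrite sqr_ge0. Qed.

Lemma limit_zeros : exists (x : nat -> R) (s' S' : R),
  [/\ forall j, (fun t => nth 0 (xs t) j) @ U --> x j,
      (fun t => \sum_(x <- xs t) x) @ U --> s' &
      (fun t => \sum_(x <- xs t) x ^+ 2) @ U --> S'].
Proof.
have [s' hs'] := ultra_bounded_cvg UU xs_s.
have S1 t : `|\sum_(x <- xs t) x ^+ 2| <= S by rewrite ger0_norm.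
have [S' hS'] := ultra_bounded_cvg UU S1.
have b t j : `|nth 0 (xs t) j| <= 1 + S.
  have h : nth 0 (xs t) j ^+ 2 <= S.
    apply: le_trans (xs_S t); apply: le_trans (absge_sqr_le j (xs_sorted t)).
    by rewrite ler_peMl ?sqr_ge0// ler1n.
  have : `|nth 0 (xs t) j| ^+ 2 <= S by rewrite real_normK ?num_real.
  by have := normr_ge0 (nth 0 (xs t) j); nra.
have [x hx] := @ultra_bounded_seq R T nat U (fun t j => nth 0 (xs t) j) (fun=> 1 + S) UU b.
by exists x, s', S'.
Qed.

(** The sum of |x|^3 is at most the largest tail entry, bounded by sqrt (S / (J + 1)), times the sum
    of squares. The first hypothesis gives |x z| <= 1/2 on the tail. *)
Lemma tail_wfactor2 z J t (e : R) : nc z ^+ 2 * S * 4 <= J.+1%:R ->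
  e = 20 * nc z ^+ 3 * S * Num.sqrt (S / J.+1%:R) -> e <= 2^-1 ->
  nc (\prod_(x <- drop J (xs t)) wfactor2 (x%:C * z) - 1) <= 2 * e.
Proof.
move=> hJ eE e2; have S0 : 0 <= S by apply: le_trans (S_ge0 t) (xs_S t).
have J0 : 0 < J.+1%:R :> R by rewrite ltr0n.
have xb x : x \in drop J (xs t) -> x ^+ 2 <= S / J.+1%:R.
  move=> /(nthP 0)[i _ <-]; rewrite nth_drop ler_pdivlMr// mulrC.
  apply: le_trans (xs_S t); apply: le_trans (absge_sqr_le J (xs_sorted t)).
  rewrite ler_wpM2l// -real_normK ?num_real// -[leRHS]real_normK ?num_real//.
  by rewrite lerXn2r ?nnegrE// absge_nth// leq_addr.
have sE : \sum_(x <- drop J (xs t)) 20 * nc (x%:C * z) ^+ 3 <= e.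
  apply: (@le_trans _ _ (\sum_(x <- drop J (xs t))
      20 * nc z ^+ 3 * Num.sqrt (S / J.+1%:R) * x ^+ 2)).
    rewrite big_seq [leRHS]big_seq; apply: ler_sum => x xd.
    rewrite ncM nc_real exprMn [`|x| ^+ 3]exprS real_normK ?num_real//.
    have h : `|x| <= Num.sqrt (S / J.+1%:R).
      by rewrite -sqrtr_sqr ler_sqrt ?xb// divr_ge0.
    have -> : 20 * (`|x| * x ^+ 2 * nc z ^+ 3) = 20 * nc z ^+ 3 * `|x| * x ^+ 2 by ring.
    by rewrite ler_wpM2r ?sqr_ge0// ler_wpM2l// mulr_ge0// exprn_ge0 ?nc_ge0.
  rewrite -mulr_sumr -[leLHS]mulrA eE -[leRHS]mulrA.
  apply: ler_wpM2l; first by rewrite mulr_ge0// exprn_ge0 ?nc_ge0.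
  rewrite [leRHS]mulrC ler_wpM2l ?sqrtr_ge0//; apply: le_trans (xs_S t).
  rewrite -{2}(cat_take_drop J (xs t)) big_cat /= lerDr.
  by rewrite sumr_ge0// => x _; rewrite sqr_ge0.
have := @nc_prod_sub1 R _ (drop J (xs t)) (fun x => wfactor2 (x%:C * z))
  (fun x => 20 * nc (x%:C * z) ^+ 3).
move=> /(_ _ _)/le_trans; apply.
- move=> x xd; apply: weierstrass2_sub1.
  rewrite -(@ler_pXn2r _ 2) ?nnegrE ?nc_ge0 ?invr_ge0//.
  rewrite ncM nc_real exprMn real_normK ?num_real//.
  apply: (@le_trans _ _ (S / J.+1%:R * nc z ^+ 2)).
    by rewrite ler_wpM2r ?exprn_ge0 ?nc_ge0// xb.
  rewrite mulrAC ler_pdivrMr//; move: hJ; rewrite exprVn; move: J.+1%:R => j.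
  by move: (nc z ^+ 2) => y; lra.
- exact: le_trans sE e2.
- by rewrite ler_wpM2l.
Qed.

(** The full product over [xs t] and its first J factors differ by a tail factor estimated
    independently of [t], so the limits along [U] and in J can be exchanged. *)
Lemma limit_partial_products (x : nat -> R) (s' S' : R) z :
  (forall j, (fun t => nth 0 (xs t) j) @ U --> x j) ->
  (fun t => \sum_(x <- xs t) x) @ U --> s' ->
  (fun t => \sum_(x <- xs t) x ^+ 2) @ U --> S' ->
  ctends \oo (fun J => \prod_(j < J) wfactor2 ((x j)%:C * z))
    (H z * cexp (s'%:C * z + S'%:C * (z ^+ 2 / 2))).
Proof.
move=> hx hs hS; set L := H z * _.
have Sge0 : 0 <= S.
  have [t] : exists t : T, True; last by move=> _; apply: le_trans (S_ge0 t) (xs_S t).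
  have /filter_ex[t _] : \forall t \near U, True by apply: nearW.
  by exists t.
have TL : ctends U (fun t => \prod_(x <- xs t) wfactor2 (x%:C * z)) L.
  pose proof (ctendsM (xs_H z) (ctends_cexp (ctendsD
     (ctendsM (ctends_real hs) (ctends_cst z))
     (ctendsM (ctends_real hS) (ctends_cst (z ^+ 2 / 2)))))) as h.
  by apply: ctends_eq h => t; rewrite prod_wfactor2.
pose e J := 20 * nc z ^+ 3 * S * Num.sqrt (S / J.+1%:R).
have ecvg : e @ \oo --> (0 : R).
  rewrite -(mulr0 (20 * nc z ^+ 3 * S)); apply: cvgM; first exact: cvg_cst.
  rewrite -(@sqrtr0 R); apply: continuous_cvg; first exact: sqrt_continuous.
  by rewrite -(mulr0 S); apply: cvgM; [exact: cvg_cst|exact: cvg_harmonic].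
pose V t J := \prod_(j < J) wfactor2 ((nth 0 (xs t) j)%:C * z).
pose W J := \prod_(j < J) wfactor2 ((x j)%:C * z).
have VW J : ctends U (V ^~ J) (W J).
  apply: ctends_prod => j; apply: ctends_wfactor2.
  by apply: ctendsM; [exact: ctends_real|exact: ctends_cst].
have b J : nc z ^+ 2 * S * 4 <= J.+1%:R -> e J <= 4^-1 ->
    nc (W J - L) <= 4 * nc L * e J.
  move=> hJ eJ.
  have e0 : 0 <= e J by rewrite !mulr_ge0 ?exprn_ge0 ?nc_ge0 ?sqrtr_ge0.
  (* Only the error relative to [W J] is controlled; since e J <= 1/4, [W J] on the right can be
     traded for [L]. *)
  have h : nc (L - W J) <= 2 * e J * nc (W J).
    have h1 t : nc (\prod_(x <- xs t) wfactor2 (x%:C * z) - V t J) <=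
        2 * e J * nc (V t J).
      rewrite -{1}(cat_take_drop J (xs t)) big_cat /=.
      rewrite (big_take_nth _ (f := fun x => wfactor2 (x%:C * z))) ?mul0r ?wfactor2_0//.
      rewrite -/(V t J) -{2}[V t J]mulr1 -mulrBr ncM mulrC ler_wpM2r ?nc_ge0//.
      by apply: tail_wfactor2 => //; apply: le_trans eJ _; rewrite lef_pV2 ?posrE// ler_nat.
    pose proof (ctends_nc (ctendsB TL (VW J))) as h2.
    have h3 : (fun t => nc (\prod_(x <- xs t) wfactor2 (x%:C * z) - V t J) -
        2 * e J * nc (V t J)) @ U --> nc (L - W J) - 2 * e J * nc (W J).
      apply: cvgB => //; apply: cvgM; first exact: cvg_cst.
      exact: ctends_nc (VW J).
    rewrite -subr_le0; apply: (cvg_le_bound h3); apply: nearW => t.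
    by rewrite subr_le0.
  have := ncB L (L - W J); rewrite subKr => h4; rewrite nc_distC.
  have h5 : 2 * e J * nc (W J) <= 2 * e J * (nc L + nc (L - W J)).
    by rewrite ler_wpM2l// mulr_ge0.
  have h6 : e J * nc (L - W J) <= 4^-1 * nc (L - W J) by rewrite ler_wpM2r ?nc_ge0.
  move: h h5 h6; move: (e J) (nc L) (nc (L - W J)) (nc (W J)) => E l d w; nra.
apply: (ctends_le (g := fun J => 4 * nc L * e J)); last first.
  by rewrite -(mulr0 (4 * nc L)); apply: cvgM => //; exact: cvg_cst.
have q : (0 : R) < 4^-1 by rewrite invr_gt0.
have near1 : \forall J \near \oo, (Num.bound (nc z ^+ 2 * S * 4) <= J)%N.
  by exists (Num.bound (nc z ^+ 2 * S * 4)).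
have /cvgrPdist_le/(_ _ q) := ecvg; apply: filterS2 near1 => J hJ.
rewrite sub0r normrN => eJ; apply: b; last exact: le_trans (ler_norm _) eJ.
have h0 : 0 <= nc z ^+ 2 * S * 4 by rewrite !mulr_ge0 ?exprn_ge0 ?nc_ge0.
apply: le_trans (ltW (archi_boundP h0)) _.
by rewrite ler_nat (leq_trans hJ).
Qed.

(** Passing from genus 2 to genus 1 removes e^(x_j^2 z^2 / 2) for each limit entry, in all e^(sg z^2
    / 2), whereas the limit of the full products carries e^(S' z^2 / 2). The discrepancy is the
    Gaussian factor. *)
Lemma limit_laguerre_polya : entire H -> laguerre_polya H.
Proof.
move=> eH; split=> //.
have [x [s' [S' [hx hs hS]]]] := limit_zeros.
have sumS J : series (fun j => x j ^+ 2) J <= S'.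
  have h : (fun t => \sum_(j < J) nth 0 (xs t) j ^+ 2 - \sum_(x <- xs t) x ^+ 2) @ U -->
      \sum_(j < J) x j ^+ 2 - S'.
    by apply: cvgB => //; apply: cvg_sumR => j; apply: cvgM.
  rewrite /series /= big_mkord -subr_le0; apply: (cvg_le_bound h); apply: nearW => t.
  by rewrite subr_le0 sum_sqr_nth_le.
have nd : nondecreasing_seq (series (fun j => x j ^+ 2)).
  by apply: nondecreasing_series => j _ _; rewrite sqr_ge0.
have cx : cvgn (series (fun j => x j ^+ 2)).
  by apply: nondecreasing_is_cvgn => //; exists S' => _ [J _ <-].
pose sg := limn (series (fun j => x j ^+ 2)).
have sgS : sg <= S' by apply: limr_le => //; apply: nearW.
(* Half of the sum of squares lost in the entrywise limit; nonnegative because the partial sums of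
   the limits stay below S'. *)
pose al := (S' - sg) / 2.
pose p z := cexp (al%:C * z ^+ 2 + s'%:C * z) * H z.
have pV z : ctends \oo (fun J => \prod_(j < J) wfactor (x j) z) (p z).
  pose proof (ctendsM (limit_partial_products z hx hs hS)
     (ctends_cexp (ctendsN (ctendsM (ctends_real cx) (ctends_cst (z ^+ 2 / 2)))))) as h.
  have -> : p z = H z * cexp (s'%:C * z + S'%:C * (z ^+ 2 / 2)) *
      cexp (- (sg%:C * (z ^+ 2 / 2))).
    rewrite /p -mulrA -cexpD mulrC; congr (_ * cexp _).
    by rewrite /al rmorphM rmorphB fmorphV rmorph_nat /=; ring.
  apply: ctends_eq h => J.
  rewrite /series /= big_mkord rmorph_sum mulr_suml -sumrN -cexp_sum -big_split /=.
  apply: eq_bigr => j _; rewrite /wfactor /wfactor2 -mulrA -cexpD rmorphXn /=.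
  by congr (_ * cexp _); rewrite exprMn; ring.
exists 1, al, (- s'), 0%N, p; split.
- by rewrite /al divr_ge0// subr_ge0.
(* [canonical_product] asks for genuine zeros a = 1 / x. By the ordering, once some x j vanishes so
   do all later ones, and the product is finite. *)
- have [[J0 xJ0]|xn] := pselect (exists j, x j = 0); last first.
    right; exists (fun j => (x j)^-1); split=> [j||z].
    + by rewrite invr_eq0; apply/eqP => xj; apply: xn; exists j.
    + by under eq_fun do rewrite exprVn invrK.
    + apply/ctendsP; apply: ctends_eq (pV z) => J; apply: eq_bigr => j _.
      by rewrite primary_factorE invrK.
  left; have ex : exists j, x j == 0 by exists J0; rewrite xJ0.
  pose m := ex_minn ex.
  have [xm mmin] : x m = 0 /\ forall j, x j == 0 -> (m <= j)%N.
    by rewrite /m; case: ex_minnP => k /eqP.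
  have x0 j : (m <= j)%N -> x j = 0.
    move=> mj; apply/eqP; rewrite -normr_le0 -(normr0 R) -[0 in leRHS]xm.
    have h : (fun t => `|nth 0 (xs t) j| - `|nth 0 (xs t) m|) @ U --> `|x j| - `|x m|.
      by apply: cvgB; apply: cvg_norm.
    rewrite -subr_le0; apply: (cvg_le_bound h); apply: nearW => t.
    by rewrite subr_le0 absge_nth.
  exists [seq (x j)^-1 | j <- iota 0 m]; split.
    apply/allP => y /mapP[j]; rewrite mem_iota /= add0n => jm ->{y}.
    by rewrite invr_eq0; apply/negP => /mmin; rewrite leqNgt jm.
  move=> z; apply: (ctends_unique (pV z)).
  apply: ctends_near (ctends_cst _); exists m => // J /= mJ.
  rewrite big_map -(big_mkord xpredT (fun j => wfactor (x j) z)).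
  rewrite (big_cat_nat (n := m))//= [X in _ * X]big_nat [X in _ * X]big1.
    rewrite mulr1 /index_iota subn0; apply: eq_bigr => j _.
    by rewrite primary_factorE invrK.
  by move=> j /andP[mj _]; rewrite x0// /wfactor mul0r subr0 mul1r cexp0.
- move=> z; rewrite expr0 mul1r !mul1r /p mulrA -cexpD.
  by rewrite (_ : _ + _ = 0) ?cexp0 ?mul1r// rmorphN /=; ring.
Qed.

End UltrafilterLimit.
End LimitFunctions.

(** * Power series whose Appell polynomials have boundedly many nonreal zeros *)

Section BoundedAppell.
Variable R : realType.
Implicit Types (a : nat -> R).

(** The factor by which the k-th coefficient of (z/n)^n A(f,n)(n/z) is obtained from a_k; it lies in
    [0, 1] and tends to 1. *)
Definition falling_ratio n k : R := (n ^_ k)%:R / n%:R ^+ k.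

Lemma falling_ratio_le1 n k : 0 <= falling_ratio n k <= 1.
Proof.
rewrite /falling_ratio divr_ge0 ?exprn_ge0//=; have [->|n0] := posnP n.
  by case: k => [|k]; rewrite ?ffactn0 ?expr0 ?divr1// expr0n /= invr0 mulr0.
rewrite ler_pdivrMr ?exprn_gt0 ?ltr0n// mul1r -natrX ler_nat.
elim: k => [|k IH]; first by rewrite ffactn0.
by rewrite ffactnSr expnSr leq_mul// leq_subr.
Qed.

Lemma falling_ratio_cvg k : (fun n => falling_ratio n.+1 k) @ \oo --> (1 : R).
Proof.
elim: k => [|k IH].
  rewrite (_ : (fun n => _) = fun=> 1); first exact: cvg_cst.
  by apply/funext => n; rewrite /falling_ratio ffactn0 expr0 divr1.
have h : (fun n => falling_ratio n.+1 k * (1 - k%:R * n.+1%:R^-1)) @ \oo -->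
    (1 * (1 - k%:R * 0) : R).
  apply: cvgM => //; apply: cvgB; first exact: cvg_cst.
  by apply: cvgM; [exact: cvg_cst|exact: cvg_harmonic].
rewrite mulr0 subr0 mulr1 in h; apply: cvg_trans h; apply: near_eq_cvg.
exists k => // n /= kn; rewrite /falling_ratio ffactnSr natrM natrB ?(leqW kn)//.
have n0 : n.+1%:R != 0 :> R by rewrite pnatr_eq0.
rewrite exprSr; move: n.+1%:R n0 => N N0; by field; rewrite ?expf_neq0 ?N0.
Qed.

Lemma coef_appell_rev a n k : (k <= n)%N ->
  n%:R ^- k * (appell a n)`_(n - k) = falling_ratio n k * a k.
Proof.
move=> kn; rewrite coef_appell leq_subr subKn// mulrA /falling_ratio.
rewrite [_ / n%:R ^+ k]mulrC -(ffact_fact kn) natrM -[in RHS]mulrA mulfK ?factE_neq0//.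
by rewrite mulrA.
Qed.

(* The reversed Appell polynomial (z/n)^n A(n/z), as a product over the
   rescaled zeros of A. *)
Lemma appell_zeros a M n : a 0%N = 1 -> (0 < n)%N -> nonreal_le (appell a n) M ->
  exists (ws : seq R[i]) (xs : seq R) (Q : {poly R}),
  [/\ (size ws <= M)%N, (size Q <= M.+1)%N, toC Q = revprod ws, sorted (@absge R) xs &
    forall k, (revprod (ws ++ [seq x%:C | x <- xs]))`_k = (falling_ratio n k * a k)%:C].
Proof.
move=> a0 n0 hA; set A := appell a n.
have An : A`_n = 1.
  by rewrite coef_appell leqnn subnn a0 mulr1 divff// factE_neq0.
have A0 : A != 0 by apply/eqP => e; move/eqP: An; rewrite e coef0 eq_sym oner_eq0.
have sA : size A = n.+1.
  apply/eqP; rewrite eqn_leq size_appell /= ltnNge; apply/negP => h.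
  by move/eqP: An; rewrite nth_default// eq_sym oner_eq0.
have [q [s [AE qf qM]]] := nonreal_le_rootfree A0 hA.
have lq : lead_coef q = 1.
  have : lead_coef A = 1 by rewrite lead_coefE sA.
  by rewrite AE lead_coef_Mmonic ?monic_prod_XsubC.
have [ws0 [qE sws _]] := toC_factor qf.
rewrite lq scale1r in qE.
pose l := ws0 ++ [seq x%:C | x <- s].
have AEl : toC A = linprod l.
  by rewrite AE rmorphM /= toC_linprod qE /l big_cat.
have sl : size l = n.
  have := congr1 (fun p : {poly R[i]} => size p) AEl.
  by rewrite size_map_poly sA size_prod_XsubC => -[].
pose c : R := n%:R^-1.
have q1 : (size ws0).+1 = size q by rewrite sws prednK// size_poly_gt0 rootfree_neq0.
(* The parameters are the zeros of A divided by n. The third witness is the product over the nonreal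
   ones, written with real coefficients so that its limit is real. *)
exists [seq c%:C * w | w <- ws0], (sort (@absge R) [seq c * x | x <- s]),
  (\poly_(k < (size ws0).+1) (c ^+ k * q`_(size ws0 - k))); split.
- by rewrite size_map -ltnS q1.
- by apply: leq_trans (size_poly _ _) _; rewrite q1.
- apply/polyP => k; rewrite coef_map coef_poly /= ltnS; case: leqP => kw.
    rewrite coef_revprod_scaled// -qE coef_map /= rmorphM rmorphXn /=.
    by [].
  rewrite nth_default// (leq_trans (size_revprod _))// size_map //.
- by apply: sort_sorted => x y; exact: le_total.
- move=> k.
  have -> : revprod ([seq c%:C * w | w <- ws0] ++
      [seq x%:C | x <- sort (@absge R) [seq c * x | x <- s]]) =
      revprod [seq c%:C * y | y <- l].
    rewrite /l map_cat !revprod_cat; congr (_ * _).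
    rewrite /revprod; rewrite (perm_big [seq c%:C * y | y <- [seq x%:C | x <- s]])//.
    rewrite -map_comp (perm_trans (perm_map _ (permEl (perm_sort _ _))))//.
    rewrite -map_comp; apply/permP => P; congr (count P _); apply: eq_map => x /=.
    by rewrite -rmorphM.
  have [kn|kn] := leqP k n.
    rewrite coef_revprod_scaled ?sl// -AEl coef_map /= -rmorphXn -rmorphM /=.
    by rewrite /c exprVn coef_appell_rev.
  rewrite nth_default ?(leq_trans (size_revprod _)) ?size_map ?sl//.
  by rewrite /falling_ratio ffact_small// mul0r mul0r.
Qed.

Lemma revprod_locally_boundedC (T : Type) (W : T -> seq R[i]) M (B : R) : 0 <= B ->
  (forall t, (size (W t) <= M)%N) -> (forall t w, w \in W t -> nc w <= B) ->
  locally_bounded (fun t => revprod (W t)).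
Proof.
move=> B0 WM WB r r0; exists ((1 + B * r) ^+ M) => t z zr.
rewrite horner_revprod nc_prod.
have b1 : 1 <= 1 + B * r by rewrite lerDl mulr_ge0.
apply: (@le_trans _ _ (\prod_(w <- W t) (1 + B * r))).
  rewrite big_seq [leRHS]big_seq; apply: ler_prod => w wt.
  rewrite nc_ge0 /=; apply: le_trans (ncB _ _) _.
  by rewrite nc1 lerD2l ncM ler_pM ?nc_ge0// (WB t).
by rewrite big_const_seq count_predT iter_mulr_1 ler_weXn2l.
Qed.

(** The nonreal and the real factors are each locally bounded, so they converge separately along
    [U], and the product of the two limits is f. Taking a_0 = 1 makes the Appell polynomials
    monic. *)
Lemma bounded_nonreal_monic a M : a 0%N = 1 -> (forall n, nonreal_le (appell a n) M) ->
  exists (Q : {poly R}) (h : R[i] -> R[i]),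
  [/\ (size Q <= M.+1)%N, laguerre_polya h &
    represents (fun k => (a k)%:C) (fun z => (toC Q).[z] * h z)].
Proof.
move=> a0 aM.
(* The index [n.+1] keeps the scaling 1 / n meaningful. *)
have /choice[ws /choice[xs /choice[Q hQ]]] := fun n => appell_zeros a0 (ltn0Sn n) (aM n.+1).
have [B [s [S [B0 hB]]]] := zeros_bounded (fun k => `|a k|) M.
have {}hB n : [/\ forall w, w \in ws n -> nc w <= B, `|\sum_(x <- xs n) x| <= s &
     \sum_(x <- xs n) x ^+ 2 <= S].
  have [h1 _ _ _ h2] := hQ n; apply: hB => // k.
  rewrite h2 nc_real normrM ler_piMl//.
  by have /andP[f0 f1] := falling_ratio_le1 n.+1 k; rewrite ger0_norm.
have [U [UU Uoo]] := ultra_oo.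
have PU : ProperFilter U by exact: ultra_proper.
have bQ : locally_bounded (fun n => toC (Q n)).
  rewrite (_ : (fun n => _) = fun n => revprod (ws n)).
    apply: (@revprod_locally_boundedC _ _ M B) => // n; first by have [] := hQ n.
    by have [] := hB n.
  by apply/funext => n; have [] := hQ n.
have bR : locally_bounded (fun n => toC (revprod (xs n))).
  by apply: (@revprod_locally_bounded R _ xs s S) => n; have [] := hB n.
have coef_bound (p : nat -> {poly R}) : locally_bounded (fun n => toC (p n)) ->
    exists c : nat -> R, forall k, (fun n => (p n)`_k) @ U --> c k.
  move=> bp; have [C hC] := bp 1 ler01.
  apply: (@ultra_bounded_seq R nat nat U (fun n k => (p n)`_k) (fun=> C) UU) => n k.
  have := @cauchy_estimate R (toC (p n)) 1 C k ler01 (hC n).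
  by rewrite coef_map expr1n mulr1 -nc_real.
have [q hq] := coef_bound _ bQ; have [r hr] := coef_bound _ bR.
have cC (p : nat -> {poly R}) (c : nat -> R) :
    (forall k, (fun n => (p n)`_k) @ U --> c k) ->
    forall k, ctends U (fun n => (toC (p n))`_k) (c k)%:C.
  move=> pc k; pose proof (ctends_real (pc k)) as h.
  by apply: ctends_eq h => n; rewrite coef_map.
have [rr rH] := normal_limit bR (cC _ _ hr).
have [h hh] := rapid_represents rr.
(* The [Q n] have degree at most M, so their limit is again a polynomial of such degree. *)
pose P := \poly_(k < M.+1) q k.
have QP z : ctends U (fun n => (toC (Q n)).[z]) (toC P).[z].
  have e (p : {poly R}) : (size p <= M.+1)%N ->
      (toC p).[z] = \sum_(0 <= k < M.+1) (toC p)`_k * z ^+ k.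
    by move=> sp; apply: horner_nat_sum; rewrite size_map_poly.
  rewrite e ?size_poly//.
  have h1 : ctends U (fun n => \sum_(0 <= k < M.+1) (toC (Q n))`_k * z ^+ k)
      (\sum_(0 <= k < M.+1) (toC P)`_k * z ^+ k).
    apply: ctends_sum => k; apply: ctendsM; last exact: ctends_cst.
    rewrite coef_map coef_poly; case: ltnP => kM; first exact: cC hq k.
    apply: ctends_eq (ctends_cst _) => n; have [_ sQ _ _ _] := hQ n.
    by rewrite coef_map nth_default// (leq_trans sQ).
  by apply: ctends_eq h1 => n; rewrite e//; have [] := hQ n.
pose G n := Q n * revprod (xs n).
have bG : locally_bounded (fun n => toC (G n)).
  have := locally_boundedM bQ bR.
  by under [in X in X -> _]eq_fun do rewrite -rmorphM.
have Ga k : (fun n => (G n)`_k) @ U --> a k.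
  have h1 : (fun n => falling_ratio n.+1 k * a k) @ \oo --> a k.
    rewrite -[X in _ --> X]mul1r; apply: cvgM; first exact: falling_ratio_cvg.
    exact: cvg_cst.
  rewrite (_ : (fun n => _) = fun n => falling_ratio n.+1 k * a k).
    by move=> A /h1; exact: Uoo.
  apply/funext => n; apply: complexI; have [_ _ QE _ <-] := hQ n.
  by rewrite revprod_cat -QE -toC_revprod -rmorphM coef_map.
have [ar aG] := normal_limit bG (cC _ _ Ga).
have [F hF] := rapid_represents ar.
have FE z : F z = (toC P).[z] * h z.
  pose proof (aG F hF z) as h1; pose proof (ctendsM (QP z) (rH h hh z)) as h2.
  apply: (ctends_unique h1); apply: ctends_eq h2 => n.
  by rewrite /G rmorphM hornerM.
exists P, h; split; first exact: size_poly.
- apply: (@limit_laguerre_polya R nat U xs s S h UU).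
  + by move=> n; have [] := hB n.
  + by move=> n; have [] := hB n.
  + by move=> n; have [] := hQ n.
  + exact: rH.
  + exact: rapid_entire rr hh.
- by move=> z; rewrite -FE; exact: hF.
Qed.

End BoundedAppell.

Section BoundedNonreal.
Variable R : realType.
Implicit Types (a : nat -> R).

(** Dividing f by z^m changes the Appell polynomials only by an index shift and a nonzero scalar,
    which reduces f(0) = 0 to the case of a nonzero constant term. *)
Lemma appell_shift a m n :
  appell (fun k => if (k < m)%N then 0 else a (k - m)%N) (n + m) =
  ((n + m)`!%:R / n`!%:R) *: appell a n.
Proof.
apply/polyP => i; rewrite coefZ !coef_appell.
have [lin|nin] := leqP i n.
  rewrite (leq_trans lin) ?leq_addr// -addnBAC// ltnNge leq_addl /= addnK.
  by rewrite mulrA; congr (_ * _); have h1 := @factE_neq0 R n; have h2 := @factE_neq0 R i;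
     field; rewrite h1 h2.
case: ifP => [inm|_]; last by rewrite mulr0.
by rewrite ifT ?mulr0//; lia.
Qed.

Lemma laguerre_polyaMXn (h : R[i] -> R[i]) (c : R) m :
  laguerre_polya h -> laguerre_polya (fun z => c%:C * z ^+ m * h z).
Proof.
move=> [eh [c' [al [be [m' [p [al0 cp hE]]]]]]]; split.
  have e := @entire_horner R (c%:C *: 'X^m).
  pose proof (entireM e eh) as e'.
  rewrite (_ : (fun z => _) = fun z => (c%:C *: 'X^m).[z] * h z); first exact: e'.
  by apply/funext => z; rewrite hornerZ hornerXn.
exists (c * c'), al, be, (m + m')%N, p; split=> // z.
by rewrite hE rmorphM exprD /=; ring.
Qed.

Lemma represents_shift (f : nat -> R[i]) (F : R[i] -> R[i]) (c : R[i]) m :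
  represents f F ->
  represents (fun k => if (k < m)%N then 0 else c * f (k - m)%N)
             (fun z => c * z ^+ m * F z).
Proof.
move=> /representsP fF; apply/representsP => z.
pose proof (ctendsM (ctends_cst (c * z ^+ m)) (fF z)) as h.
have e n : series (fun k => (if (k < m)%N then 0 else c * f (k - m)%N) * z ^+ k) (n + m)%N =
    c * z ^+ m * series (fun k => f k * z ^+ k) n.
  rewrite /series /= (big_cat_nat (n := m)) ?leq_addl//= big_nat big1 => [|k /andP[_ ->]]; last first.
    by rewrite mul0r.
  rewrite add0r -{1}[m]add0n big_addn addnK mulr_sumr; apply: eq_bigr => k _.
  by rewrite ltnNge leq_addl /= addnK exprD; ring.
rewrite /ctends -(cvg_shiftn m); apply: cvg_trans h; apply: near_eq_cvg.
by apply: nearW => n /=; rewrite e.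
Qed.

Lemma represents_real a (F : R[i] -> R[i]) : represents (fun k => (a k)%:C) F -> real_fun F.
Proof.
move=> /representsP aF x; pose proof (ctends_Im (aF x%:C)) as h.
have Im0 : Im (F x%:C) = 0.
  apply: (cvg_unique (@Rhausdorff R) h).
  rewrite (_ : (fun t => _) = fun=> 0); first exact: cvg_cst.
  apply/funext => n; rewrite /series /= Im_sum big1// => k _.
  by rewrite -rmorphXn -rmorphM.
by case: (F x%:C) Im0 => u v /= ->; rewrite complex_real.
Qed.

Lemma bounded_nonreal_laguerre_polya a M : (forall n, nonreal_le (appell a n) M) ->
  exists (P : {poly R}) (h : R[i] -> R[i]),
  [/\ (size P <= M.+1)%N, laguerre_polya h &
    represents (fun k => (a k)%:C) (fun z => (toC P).[z] * h z)].
Proof.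
move=> aM; have [a0|an] := pselect (forall k, a k = 0).
  (* For f = 0 take P = 0; a member [h] of the class is still required and is obtained from the
     constant series 1, whose Appell polynomials are X^n. *)
  have a01 n : nonreal_le (appell (fun k => (k == 0%N)%:R : R) n) M.
    rewrite (_ : appell _ n = 1 * \prod_(x <- nseq n 0) ('X - x%:P)).
      by apply/nonreal_leM/nonreal_le_size; rewrite size_poly1.
    rewrite mul1r big_nseq iter_mulr_1 subr0; apply/polyP => i.
    rewrite coef_appell coefXn; case: (ltngtP i n) => // [lin|->].
      by rewrite subn_eq0 leqNgt lin mulr0.
    by rewrite subnn mulr1 divff// factE_neq0.
  have [//|Q [h [_ lph _]]] := bounded_nonreal_monic _ a01.
  exists 0, h; split; rewrite ?size_poly0//; apply/representsP => z.
  rewrite map_poly0 horner0 mul0r; apply: ctends_eq (ctends_cst 0) => n.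
  by rewrite /series /= big1// => k _; rewrite a0 mul0r.
have ex : exists k, a k != 0.
  by apply: contrapT => h; apply: an => k; apply/eqP/negPn/negP => ak; apply: h; exists k.
have [m [am mmin]] : exists m, a m != 0 /\ forall k, (k < m)%N -> a k = 0.
  exists (ex_minn ex); case: ex_minnP => m am mmin; split=> // k km.
  by apply/eqP/negPn/negP => /mmin; rewrite leqNgt km.
(* Thus f = a_m z^m b with b(0) = 1. The factor a_m z^m is given to the Laguerre-Pólya part, so that
   the degree bound on the polynomial is kept. *)
pose b k := a (k + m)%N / a m.
have aE k : a k = if (k < m)%N then 0 else a m * b (k - m)%N.
  by case: ltnP => [/mmin//|mk]; rewrite /b subnK// mulrCA mulfV// mulr1.
have bM n : nonreal_le (appell b n) M.
  have -> : appell b n = ((n + m)`!%:R / n`!%:R * a m)^-1 *: appell a (n + m).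
    have -> : appell a (n + m) = ((n + m)`!%:R / n`!%:R * a m) *: appell b n.
      rewrite -scalerA.
      have -> : a m *: appell b n = appell (fun k => a m * b k) n.
        by apply/polyP => i; rewrite coefZ !coef_appell; case: ifP; rewrite ?mulr0// mulrCA.
      by rewrite -appell_shift; congr appell; apply/funext => k; rewrite aE.
    by rewrite scalerA mulVf ?scale1r// !mulf_neq0 ?invr_eq0 ?factE_neq0.
  exact/nonreal_leZ/aM.
have [|Q [h [sQ lph bQ]]] := bounded_nonreal_monic _ bM.
  by rewrite /b add0n divff.
exists Q, (fun z => (a m)%:C * z ^+ m * h z).
split; [exact: sQ|exact: laguerre_polyaMXn|].
pose proof (@represents_shift _ _ (a m)%:C m bQ) as S.
have fE : (fun k => if (k < m)%N then 0 else (a m)%:C * (b (k - m)%N)%:C) =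
    fun k => (a k)%:C.
  apply/funext => k; rewrite [in RHS]aE; case: ifP => _; first by rewrite rmorph0.
  by rewrite [in RHS]rmorphM.
rewrite fE in S; move=> z; have := S z; rewrite mulrCA; exact.
Qed.

Lemma represents_entire (f : nat -> R[i]) F : represents f F -> entire F.
Proof. by move=> fF; exact: rapid_entire (represents_rapid fF) fF. Qed.

(** Unless the product vanishes identically, [h] has no nonreal zeros and only [P] contributes. *)
Lemma zero_count_le_size (P : {poly R}) (h : R[i] -> R[i]) M : laguerre_polya h ->
  (size P <= M.+1)%N ->
  (zero_count (fun z => ((toC P).[z] * h z)%R) (@nonreal R) <= M%:R%:E)%E.
Proof.
move=> lph PM; have [F0|F0] := pselect (forall z, (toC P).[z] * h z = 0).
  by rewrite /zero_count ifT ?lee_fin//; apply/asboolP.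
have [h0 P0] := laguerre_polya_factor_neq0 lph F0.
have [q [l [PE qf]]] := rootfree_factor P0.
have eh : entire h by case: lph.
rewrite (zero_count_rootfree qf eh h0 (s := l)) => [|z]; last by rewrite PE.
rewrite lee_fin ler_nat -subn1 leq_subLR add1n; apply: leq_trans PM.
by rewrite PE size_rootfree_factor// leq_addr.
Qed.

End BoundedNonreal.

(** * Monotonicity, stabilisation and the converse *)

Unset Implicit Arguments.

Theorem theorem3p6 (R : realType) (a : nat -> R) :
  let f : nat -> R[i] := fun k => (a k)%:C in
  let N_ : nat -> \bar R := fun n => zero_count (horner (appell f n)) (@nonreal R) in
  [/\ [/\ N_ 0%N = 0%E, N_ 1%N = 0%E &
          forall n : nat, (1 <= n)%N -> (N_ n <= N_ n.+1)%E],
      (forall F : R[i] -> R[i], represents f F -> laguerre_polya_star F ->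
         let N := zero_count F (@nonreal R) in
         (forall n : nat, (N_ n <= N)%E) /\ (\forall n \near \oo, N_ n = N)) &
      (exists M : R, forall n : nat, (N_ n <= M%:E)%E) ->
        exists F : R[i] -> R[i], represents f F /\ laguerre_polya_star F].
Proof.
move=> f N_.
have /choice[d hd] := fun n => zero_count_real_poly (appell a n).
have NE n : N_ n = (d n)%:R%:E.
  by rewrite /N_ /f appell_toC; have [] := hd n.
have dP n N : nonreal_le (appell a n) N <-> (d n <= N)%N.
  have [_ h1 h2] := hd n; split; first exact: h2.
  by move=> dN; exact: nonreal_le_mono dN h1.
have dS n : (d n <= d n.+1)%N.
  apply/dP; have h : nonreal_le (appell a n.+1) (d n.+1) by apply/dP.
  have -> : appell a n = n.+1%:R^-1 *: (appell a n.+1)^`().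
    by rewrite appell_deriv scalerA mulVf ?scale1r// pnatr_eq0.
  exact/nonreal_leZ/nonreal_le_deriv.
have d1 : d 1%N = 0%N.
  apply/eqP; rewrite -leqn0; apply/dP.
  have [->|A0] := eqVneq (appell a 1%N) 0; first exact: nonreal_le0.
  (* A root-free polynomial has odd size, so one of size at most 2 is constant. *)
  have [q [s [AE qf]]] := rootfree_factor A0.
  exists q, s; split=> //.
  have := size_appell a 1; rewrite AE size_rootfree_factor// => h.
  have := rootfree_odd qf; have : (size q <= 2)%N by apply: leq_trans (leq_addr _ _) h.
  by case: (size q) => [|[|[]]].
have d0 : d 0%N = 0%N by have := dS 0%N; rewrite d1 leqn0 => /eqP.
split.
- by split=> [||n _]; rewrite !NE ?d0 ?d1// lee_fin ler_nat.
- move=> F fF lF N.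
  have [e [Ne aM]] := laguerre_polya_star_count fF lF.
  have de n : (d n <= e)%N by apply/dP.
  split=> [n|]; first by rewrite NE /N Ne lee_fin ler_nat.
  (* The bounded sequence [d] attains its maximum at some m. The converse with bound [d m] writes F
     with a polynomial factor of degree at most [d m], whence e <= d m; monotonicity carries the
     equality to all n >= m. *)
  have [m hm] : exists m, forall n, (d n <= d m)%N.
    have ex : exists k, `[< exists n, d n = k >] by exists (d 0%N); apply/asboolP; exists 0%N.
    have ub k : `[< exists n, d n = k >] -> (k <= e)%N by move=> /asboolP[n <-].
    have [k /asboolP[m <-] kmax] := ex_maxnP ex ub.
    by exists m => n; apply: kmax; apply/asboolP; exists n.
  have [P [h [PM lph PF]]] := bounded_nonreal_laguerre_polya (fun n => (dP n _).2 (hm n)).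
  have FE : F = fun z => (toC P).[z] * h z.
    by apply/funext => z; exact: represents_unique fF PF z.
  have em : (e <= d m)%N.
    have := zero_count_le_size lph PM; rewrite -FE -/N /N Ne lee_fin ler_nat.
    exact.
  have dm : d m = e by apply/eqP; rewrite eqn_leq de.
  exists m => // n /= mn; rewrite NE /N Ne; congr (_%:R%:E).
  apply/eqP; rewrite eqn_leq de -dm.
  by apply: (homo_leq (fun=> leqnn _) leq_trans dS).
- move=> [M hM].
  have dM n : (d n <= Num.bound M)%N.
    have := hM n; rewrite NE lee_fin => h.
    have M0 : 0 <= M by apply: le_trans h.
    by rewrite -(ler_nat R); apply: le_trans h _; exact: ltW (archi_boundP M0).
  have [P [h [_ lph PF]]] := bounded_nonreal_laguerre_polya (fun n => (dP n _).2 (dM n)).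
  exists (fun z => (toC P).[z] * h z); split; first exact: PF.
  split.
  + exact: represents_entire PF.
  + exact: represents_real PF.
  + by exists P, h.
Qed.
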